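(* Assume that the distribution of $X$ is determined by its mean $\mu\in\Theta$, that the variance of $X$ is a positive continuous function of $\mu\in\Theta$, and that $\mathbb{E}[|X|^3]<\infty$ for $\mu\in\Theta$. Let $\mathcal{V}(\theta)$ denote the variance of $X$ when its mean is $\theta$, if $\theta\in\Theta$, and $\mathcal{V}(\theta)=0$ if $\theta\notin\Theta$. Let $\{\delta_\ell\}_{\ell\in\mathbb{Z}}$ be a non-increasing sequence of numbers in $(0,1)$, and let the sample sizes $n_\ell$ be as in the multistage setting of the context with $\Upsilon_\ell=\ln\frac1{\delta_\ell}$, $\ell\in\mathbb{Z}$, and $C_\ell\to\infty$ as $\ell\to\infty$. Let $\rho\in[0,1]$. For $\ell\ge\tau_\varepsilon$ let $\boldsymbol{D}_\ell=1$ if $$\mathcal{V}\big(Z_\ell+\rho[\mathscr{U}(Z_\ell,\varepsilon)-Z_\ell]\big)\le\frac{n_\ell[\mathscr{U}(Z_\ell,\varepsilon)-Z_\ell]^2}{\ln\frac1{\delta_\ell}}\quad\text{and}\quad\mathcal{V}\big(Z_\ell+\rho[\mathscr{L}(Z_\ell,\varepsilon)-Z_\ell]\big)\le\frac{n_\ell[\mathscr{L}(Z_\ell,\varepsilon)-Z_\ell]^2}{\ln\frac1{\delta_\ell}},$$ and $\boldsymbol{D}_\ell=0$ otherwise; sampling is continued until $\boldsymbol{D}_\ell=1$ for some $\ell\ge\tau_\varepsilon$. Then for every $\mu\in\Theta$ (with the notation of the context): (I) $\Pr\{\mathbf{n}<\infty\}=1$ and $\mathbb{E}[\mathbf{n}]<\infty$.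 (II) $\Pr\{\jmath-1\le\liminf_{\varepsilon\downarrow0}\boldsymbol{l}\le\limsup_{\varepsilon\downarrow0}\boldsymbol{l}\le\jmath\}=1$; moreover $\Pr\{\lim_{\varepsilon\downarrow0}\boldsymbol{l}=\jmath\}=1$ provided ( * ) holds, where ( * ) is the condition: $\jmath=1$, or both $\jmath>1$ and $\Lambda_{\jmath-1}(\mu,\nu)<1$. (III) $\liminf_{\varepsilon\downarrow0}\Pr\{\mu\in\boldsymbol{\mathcal{I}}\}\ge2[\Phi(\xi_{\jmath-1})+\Phi(\xi_\jmath)]-3$; moreover $\lim_{\varepsilon\downarrow0}\Pr\{\mu\in\boldsymbol{\mathcal{I}}\}=2\Phi(\xi_\jmath)-1$ provided ( * ) holds. (IV) $\big(\frac{\xi_{\jmath-1}}{\mathcal{Z}}\big)^2\le\liminf_{\varepsilon\downarrow0}\frac{\mathbb{E}[\mathbf{n}]}{\mathcal{N}(\varepsilon,\delta,\mu,\nu)}\le\limsup_{\varepsilon\downarrow0}\frac{\mathbb{E}[\mathbf{n}]}{\mathcal{N}(\varepsilon,\delta,\mu,\nu)}\le\big(\frac{\xi_\jmath}{\mathcal{Z}}\big)^2$; moreover $\lim_{\varepsilon\downarrow0}\frac{\mathbb{E}[\mathbf{n}]}{\mathcal{N}(\varepsilon,\delta,\mu,\nu)}=\big(\frac{\xi_\jmath}{\mathcal{Z}}\big)^2$ provided ( * ) holds. (V) For all $\ell\in\mathbb{Z}$, $\Pr\{\boldsymbol{l}>\ell\}\le\Pr\{\boldsymbol{D}_\ell=0\}$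 and $\lim_{\varepsilon\downarrow0}[\Pr\{\boldsymbol{D}_\ell=0\}-\Pr\{\boldsymbol{l}>\ell\}]=0$. (VI) $\underline{P}\le\Pr\{\mu\notin\boldsymbol{\mathcal{I}}\}\le\overline{P}\le Q$ and $\lim_{\varepsilon\downarrow0}|\Pr\{\mu\notin\boldsymbol{\mathcal{I}}\}-\overline{P}|=\lim_{\varepsilon\downarrow0}|\Pr\{\mu\notin\boldsymbol{\mathcal{I}}\}-\underline{P}|=0$; moreover $\lim_{\varepsilon\downarrow0}[Q-\Pr\{\mu\notin\boldsymbol{\mathcal{I}}\}]=0$ provided ( * ) holds. (VII) $\mathbb{E}[\mathbf{n}]\le n_{\tau_\varepsilon}+\sum_{\ell=\tau_\varepsilon}^\infty(n_{\ell+1}-n_\ell)\Pr\{\boldsymbol{D}_\ell=0\}$ and $\lim_{\varepsilon\downarrow0}\frac1{\mathbb{E}[\mathbf{n}]}\big[n_{\tau_\varepsilon}+\sum_{\ell=\tau_\varepsilon}^\infty(n_{\ell+1}-n_\ell)\Pr\{\boldsymbol{D}_\ell=0\}\big]=1$.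
   Context: $X$ is a real random variable with mean $\mu=\mathbb{E}[X]$ and variance $\nu=\mathbb{E}[|X-\mu|^2]$; the set of possible values of $\mu$ is an interval $\Theta\subseteq\mathbb{R}$. $X_1,X_2,\dots$ are i.i.d. samples of $X$. ''The distribution of $X$ is determined by $\mu$'' means that there is a family of distributions indexed by the mean $\mu\in\Theta$; $\Pr$ and $\mathbb{E}$ are taken under the distribution with mean $\mu$, and then $\nu=\mathcal{V}(\mu)$. $\Phi$ is the standard normal distribution function, $\delta\in(0,1)$ is fixed, $\mathcal{Z}=\Phi^{-1}(1-\delta/2)$. $\mathscr{L}(z,\varepsilon)$ and $\mathscr{U}(z,\varepsilon)$, for $z\in\mathbb{R}$, $\varepsilon>0$, are real functions such that: (i) they are continuous functions of $z$ and $\varepsilon>0$; (ii) for every $\varepsilon>0$, $\mathscr{L}(z,\varepsilon)\le z\le\mathscr{U}(z,\varepsilon)$ for all $z\in\mathbb{R}$ and $\mathscr{L}(\mu,\varepsilon)<\mu<\mathscr{U}(\mu,\varepsilon)$ for all $\mu\in\Theta$; (iii) for every $\mu\in\Theta$, as $(z,\varepsilon)\to(\mu,0)$ with $\varepsilon\downarrow0$, $\frac{z-\mathscr{L}(z,\varepsilon)}{\varepsilon}$ and $\frac{\mathscr{U}(z,\varepsilon)-z}{\varepsilon}$ both converge to $\kappa(\mu)>0$, where $\kappa$ is a continuous function of $\mu$. The functions $\mathcal{L}(z,\varepsilon)$, $\mathcal{U}(z,\varepsilon)$ are in the same class in the sense that for every $\mu\in\Theta$, as $z\to\mu$, $\varepsilon\downarrow0$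 jointly, $\frac{z-\mathcal{L}(z,\varepsilon)}{\varepsilon}$ and $\frac{\mathcal{U}(z,\varepsilon)-z}{\varepsilon}$ also both converge to $\kappa(\mu)$. $\mathcal{N}(\varepsilon,\delta,\mu,\nu)=\frac{\nu\mathcal{Z}^2}{[\kappa(\mu)\varepsilon]^2}$. Multistage setting. $\{C_\ell\}_{\ell\in\mathbb{Z}}$ is an increasing sequence of positive numbers with $1<\inf_{\ell\in\mathbb{N}}\frac{C_{\ell+1}}{C_\ell}\le\sup_{\ell\in\mathbb{N}}\frac{C_{\ell+1}}{C_\ell}<\infty$; $\{\Upsilon_\ell\}_{\ell\in\mathbb{Z}}$ is a non-decreasing sequence of positive numbers with $1\le\inf_{\ell\in\mathbb{N}}\frac{\Upsilon_{\ell+1}}{\Upsilon_\ell}\le\sup_{\ell\in\mathbb{N}}\frac{\Upsilon_{\ell+1}}{\Upsilon_\ell}<\infty$. The starting index $\tau_\varepsilon$ is an integer-valued function of $\varepsilon$ with $\lim_{\varepsilon\downarrow0}\tau_\varepsilon=1$. The sample sizes $\{n_\ell\}_{\ell\ge\tau_\varepsilon}$ form an increasing sequence of positive integers depending on $\varepsilon$ such that $\frac{\varepsilon^2n_\ell}{C_\ell\Upsilon_\ell}\to1$ uniformly for $\ell\ge1$ as $\varepsilon\downarrow0$. $Z_\ell=\frac1{n_\ell}\sum_{i=1}^{n_\ell}X_i$ for $\ell\ge\tau_\varepsilon$. Decision variables $\boldsymbol{D}_\ell\in\{0,1\}$ for $\ell\ge\tau_\varepsilon$ are given in the claim, and $\boldsymbol{D}_\ell=0$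 for $\ell<\tau_\varepsilon$. The stopping index $\boldsymbol{l}$ is the smallest $\ell\ge\tau_\varepsilon$ with $\boldsymbol{D}_\ell=1$; $\mathbf{n}=n_{\boldsymbol{l}}$; $\widehat{\boldsymbol\mu}=Z_{\boldsymbol{l}}$; $\boldsymbol{\mathcal{I}}=(\mathcal{L}(\widehat{\boldsymbol\mu},\varepsilon),\mathcal{U}(\widehat{\boldsymbol\mu},\varepsilon))$; $\boldsymbol{\mathcal{I}}_\ell=(\mathcal{L}(Z_\ell,\varepsilon),\mathcal{U}(Z_\ell,\varepsilon))$. For $\ell\in\mathbb{Z}$: $\xi_\ell=\kappa(\mu)\sqrt{\frac{C_\ell\Upsilon_\ell}{\nu}}$, $\Lambda_\ell(\mu,\nu)=\frac{\kappa^2(\mu)C_\ell}{\nu}$. $\jmath=\min\{\ell\ge1:\Lambda_\ell(\mu,\nu)>1\}$. Further $$\overline{P}=\sum_{\ell=\tau_\varepsilon}^\infty\Pr\{\mu\notin\boldsymbol{\mathcal{I}}_\ell,\boldsymbol{D}_{\ell-1}=0,\boldsymbol{D}_\ell=1\},\quad\underline{P}=1-\sum_{\ell=\tau_\varepsilon}^\infty\Pr\{\mu\in\boldsymbol{\mathcal{I}}_\ell,\boldsymbol{D}_{\ell-1}=0,\boldsymbol{D}_\ell=1\},$$ $$Q=\sum_{\ell=\tau_\varepsilon}^\infty\min[\Pr\{\mu\notin\boldsymbol{\mathcal{I}}_\ell\},\Pr\{\boldsymbol{D}_{\ell-1}=0\},\Pr\{\boldsymbol{D}_\ell=1\}].$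$
   Formalization: (I) is stated for all sufficiently small ε; the inequalities in (VI) are stated for ε with Pr{n<∞}=1; the clauses as ε↓0 in (II)–(VII) are stated for μ in the interior of Θ; the functions defining the confidence interval are assumed Borel measurable in z. *)

(* Defs.v *)
From HB Require Import structures.
From mathcomp Require Import all_boot all_order all_algebra.
From mathcomp Require Import finmap.
From mathcomp Require Import all_classical all_reals all_analysis.
Set Implicit Arguments.
Unset Strict Implicit.
Unset Printing Implicit Defensive.
Import Order.TTheory GRing.Theory Num.Theory.
Import numFieldNormedType.Exports.
Local Open Scope classical_set_scope.
Local Open Scope ring_scope.

(* [None] exactly when [A] has no least element. *)
Definition int_min (A : set int) : option int :=
  xget None [set Some l | l in A `&` lbound A].

Definition normal_cdf {R : realType} (x : R) : R :=
  fine (normal_prob 0 1 `]-oo, x]).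

Definition normal_quantile {R : realType} (p : R) : R :=
  xget 0 [set x | normal_cdf x = p].

Definition iid_with_law d (Omega : measurableType d) (R : realType)
    (P : probability Omega R) (X : nat -> {RV P >-> R})
    (law : probability R R) : Prop :=
  (forall i (A : set R), measurable A -> distribution P (X i) A = law A) /\
  (forall (J : {fset nat}) (A : nat -> set R), (forall i, measurable (A i)) ->
    P (\bigcap_(i in [set` J]) (X i @^-1` A i)) =
    (\prod_(i <- J) P (X i @^-1` A i))%E).

Definition variance_of_mean {R : realType} (Theta : set R)
    (dist : R -> probability R R) (t : R) : R :=
  if t \in Theta then fine 'V_(dist t)[idfun] else 0.

(* [z] ranges over a full neighbourhood of [t] in [R], independently of [e],
   and is not confined to [Theta]. *)
Definition half_width_limit {R : realType} (Theta : set R) (kappa : R -> R)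
    (L U : R -> R -> R) : Prop :=
  forall t, Theta t ->
    (fun p : R * R => (p.1 - L p.1 p.2) / p.2)
      @ filter_prod (nbhs t) (0 : R)^'+ --> kappa t /\
    (fun p : R * R => (U p.1 p.2 - p.1) / p.2)
      @ filter_prod (nbhs t) (0 : R)^'+ --> kappa t.

(* [X 0] is the first sample. *)
Definition sample_mean d (Omega : measurableType d) (R : realType)
    (P : probability Omega R) (X : nat -> {RV P >-> R}) (m : nat) (w : Omega)
    : R :=
  (\sum_(i < m) X i w) / m%:R.

Definition accepts {R : realType} (V : R -> R) (rho : R) (L U : R -> R -> R)
    (m : nat) (del z e : R) : bool :=
  (V (z + rho * (U z e - z)) <= m%:R * (U z e - z) ^+ 2 / ln (1 / del)) &&
  (V (z + rho * (L z e - z)) <= m%:R * (L z e - z) ^+ 2 / ln (1 / del)).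

(* In this section the precision is fixed: [t] is the starting index, [D l] is
   the event that the decision variable of stage [l] is 1 (the complement being
   the event that it is 0), [n l] the sample size and [I l] the random interval
   of stage [l]. Stages below [t] do not exist, and [D l] is meant to be empty
   there; sums over the stages l >= t are indexed by l = t + k. *)
Section multistage.
Context d (Omega : measurableType d) (R : realType).
Implicit Types (P : probability Omega R) (t : int) (D : int -> set Omega)
  (n : int -> nat) (I : int -> Omega -> set R) (w : Omega).

(* [None] when sampling never stops. *)
Definition stop_index t D w : option int :=
  int_min [set l : int | t <= l /\ D l w].

Definition stop_index_ext t D w : \bar R :=
  if stop_index t D w is Some l then l%:~R%:E else +oo%E.

Definition stop_size t D n w : \bar R :=
  if stop_index t D w is Some l then (n l)%:R%:E else +oo%E.

(* The value [set0] makes [mu] uncovered on the event of never stopping. *)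
Definition stop_interval t D I w : set R :=
  if stop_index t D w is Some l then I l w else set0.

Definition P_upper P t D I mu : \bar R :=
  (\sum_(0 <= k <oo)
     P ([set w | ~ I (t + k%:Z)%R w mu] `&` ~` D (t + k%:Z - 1)%R
        `&` D (t + k%:Z)%R))%E.

Definition P_lower P t D I mu : \bar R :=
  (1 - \sum_(0 <= k <oo)
     P ([set w | I (t + k%:Z)%R w mu] `&` ~` D (t + k%:Z - 1)%R
        `&` D (t + k%:Z)%R))%E.

Definition Q_bound P t D I mu : \bar R :=
  (\sum_(0 <= k <oo)
     Order.min (P [set w | ~ I (t + k%:Z)%R w mu])
       (Order.min (P (~` D (t + k%:Z - 1)%R)) (P (D (t + k%:Z)%R))))%E.

Definition size_bound P t D n : \bar R :=
  ((n t)%:R%:E + \sum_(0 <= k <oo)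
     (((n (t + k%:Z + 1))%:R - (n (t + k%:Z))%:R)%R%:E
      * P (~` D (t + k%:Z)%R)))%E.

End multistage.

(* Main.v *)
(* By the third moment, P(|Z_m - mu| >= r) = O(m^(-3/2)) for every r > 0, where
   Z_m is the mean of m samples.  If Lambda_l > 1 the rule stops at stage l as
   soon as Z_l is close to mu, uniformly in l >= j for small eps; as
   eps^2 n_l ~ C_l Upsilon_l grows geometrically, the weighted tail
   sum_{l >= j} n_{l+1} P(D_l = 0) is O(eps).  If mu is interior and
   Lambda_l < 1 the rule continues at stage l as soon as Z_l is close to mu, so
   P(D_l = 1) -> 0 for l < j - 1, and for l = j - 1 under the condition star.
   For each fixed eps, all the differences in the claim are bounded by finitely
   many of these two kinds of probabilities plus the tail.  The coverage
   probability of a single stage converges by the central limit theorem, which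
   is obtained from Stein's method: if g is Lipschitz with compact support and
   integrates to 0 against the normal density, then f' - x f = g has a solution
   with compact support and Lipschitz derivative, and expanding f around the sum
   without its i-th term gives E[g(W_n)] = O(n^(-1/2)). *)
Require Import Defs.
From HB Require Import structures.
From mathcomp Require Import all_boot all_order all_algebra.
From mathcomp Require Import finmap.
From mathcomp Require Import all_classical all_reals all_analysis.
From mathcomp Require Import measurable_realfun.
From mathcomp Require Import ring lra.
Set Implicit Arguments.
Unset Strict Implicit.
Unset Printing Implicit Defensive.
Import Order.TTheory GRing.Theory Num.Theory.
Import numFieldNormedType.Exports.
Local Open Scope classical_set_scope.
Local Open Scope ring_scope.

(** * Sums of independent random variables *)

(** The third moment makes one estimate serve twice. The tail n^(-3/2) is summable in n, so
    Borel-Cantelli gives the strong law without passing to subsequences. It also survives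
    multiplication by the next sample size: n_{l+1} n_l^(-3/2) is of order n_l^(-1/2), summable over
    geometrically growing stages, whereas the n^(-1) of Chebyshev would leave terms of order 1. The
    stage j - 1 shapes the bounds. Minimality of j only gives Lambda_{j-1} <= 1, and in case of
    equality nothing is known about the decision there. The inequalities at fixed precision
    therefore come in two forms: errors summed over the stages before j - 1, which vanish for every
    interior mu, and errors summed over the stages before j, which vanish under the condition star.
    Interiority enters through rejection: V is 0 outside Theta, so at a boundary point a sample mean
    on the wrong side can stop the procedure at any stage. All precisions share one sequence of
    samples, so the almost sure claims hold off the single null set of the strong law. *)

Section independence.
Context d (Omega : measurableType d) (R : realType) (P : probability Omega R).

Definition cyl (X : nat -> {RV P >-> R}) (r : seq nat) (A : nat -> set R)
  : set Omega := \bigcap_(i in [set` r]) (X i @^-1` A i).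

Lemma measurable_cyl X r A : (forall i, measurable (A i)) ->
  measurable (cyl X r A).
Proof.
move=> mA; apply: fin_bigcap_measurable; first exact: finite_seq.
by move=> i _; rewrite -[_ @^-1` _]setTI; exact: measurable_funP.
Qed.

Lemma cyl_cons X i r A : cyl X (i :: r) A = (X i @^-1` A i) `&` cyl X r A.
Proof.
apply/seteqP; split=> w /=.
  by move=> h; split; [apply: h; rewrite /= inE eqxx|move=> k kr; apply: h; rewrite /= inE; apply/orP; right].
by move=> [h1 h2] k; rewrite /= inE => /orP[/eqP->//|]; exact: h2.
Qed.

Lemma cyl_nil X A : cyl X [::] A = setT.
Proof. by apply/seteqP; split => // w _ k. Qed.

Definition sumX (X : nat -> {RV P >-> R}) (s : seq nat) (w : Omega) : R :=
  \sum_(i <- s) X i w.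

Lemma measurable_sumX X s : measurable_fun setT (sumX X s).
Proof. by apply: measurable_sum => i; exact: measurable_funP. Qed.

(** Both sides are finite measures in [C]: the push-forward of [P] restricted to [E], and [P E]
    times the push-forward of [P]. They agree on rectangles, a pi-system generating the plane, hence
    everywhere. *)
Lemma prodR_indep_set (Z : Omega -> R * R) (E : set Omega) (C : set (R * R)) :
  measurable_fun setT Z -> measurable E -> measurable C ->
  (forall A B, measurable A -> measurable B ->
    P (Z @^-1` (A `*` B) `&` E) = (P (Z @^-1` (A `*` B)) * P E)%E) ->
  P (Z @^-1` C `&` E) = (P (Z @^-1` C) * P E)%E.
Proof.
move=> mZ mE mC ZE.
pose m1 : {measure set (R * R) -> \bar R} := pushforward (mrestr P mE) Z.
have PE : (fine (P E))%:E = P E by rewrite fineK// fin_num_measure.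
have PE0 : 0 <= fine (P E) by rewrite fine_ge0.
pose m2 : {measure set (R * R) -> \bar R} :=
  mscale (NngNum PE0) (pushforward P Z).
pose G := [set A `*` B | A in @measurable _ R & B in @measurable _ R].
have -> : P (Z @^-1` C `&` E) = m1 mZ C by [].
have -> : (P (Z @^-1` C) * P E)%E = m2 mZ C by rewrite /m2 /= /mscale /= PE muleC.
apply: (measure_unique G (fun=> setT)) => //.
- exact: measurable_prod_measurableType.
- move=> _ _ [A mA [B mB <-]] [A' mA' [B' mB' <-]].
  exists (A `&` A'); first exact: measurableI.
  by exists (B `&` B'); [exact: measurableI|rewrite setXI].
- by move=> _; exists setT => //; exists setT => //; rewrite setXTT.
- by rewrite bigcup_const.
- move=> _ [A mA [B mB <-]]; rewrite /m1 /m2 /= /mscale /= PE muleC.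
  exact: ZE.
- by move=> _; rewrite /m1 /= /pushforward /mrestr setTI ltey_eq fin_num_measure.
Qed.

Definition indep_fam (X : nat -> {RV P >-> R}) :=
  forall (r : seq nat) (A : nat -> set R), uniq r ->
  (forall i, measurable (A i)) ->
  P (cyl X r A) = (\prod_(i <- r) P (X i @^-1` A i))%E.

Lemma sumX_cons X i s w : sumX X (i :: s) w = X i w + sumX X s w.
Proof. by rewrite /sumX big_cons. Qed.

(** The cylinder over [r] is carried along for the induction on [s]: the pair of the remaining sum
    and [X i] is tested on rectangles, and the condition on [X i] is moved into the cylinder, which
    then runs over [i :: r]. *)
Lemma indep_sumX X (s r : seq nat) B A : indep_fam X -> uniq (s ++ r) ->
  measurable B -> (forall i, measurable (A i)) ->
  P (sumX X s @^-1` B `&` cyl X r A) = (P (sumX X s @^-1` B) * P (cyl X r A))%E.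
Proof.
move=> iX; elim: s r B A => [|i s IH] r B A usr mB mA.
  have [B0|B0] := pselect (B 0).
    have -> : sumX X [::] @^-1` B = setT.
      by apply/seteqP; split => // w _ /=; rewrite /sumX big_nil.
    by rewrite setTI probability_setT mul1e.
  have -> : sumX X [::] @^-1` B = set0.
    by apply/seteqP; split => // w /=; rewrite /sumX big_nil.
  by rewrite set0I measure0 mul0e.
pose Z w := (sumX X s w, X i w).
have mXi : measurable_fun setT (X i) by exact: measurable_funP.
have mZ : measurable_fun setT Z.
  by apply/measurable_fun_pairP; split; [exact: measurable_sumX|].
pose C := (fun p : R * R => p.2 + p.1) @^-1` B.
have mC : measurable C.
  by rewrite /C -[_ @^-1` _]setTI; have := @measurable_funD _ (R * R)%type R setT snd fst measurable_snd measurable_fst; exact.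
have -> : sumX X (i :: s) @^-1` B = Z @^-1` C.
  by apply/seteqP; split => w /=; rewrite /C /= sumX_cons.
apply: prodR_indep_set => //; first exact: measurable_cyl.
move=> A1 A2 mA1 mA2.

have us : uniq (s ++ i :: r) by rewrite -cat1s uniq_catCA.
have us1 : uniq (s ++ [:: i]).
  by rewrite -(cat1s i r) catA cat_uniq in us; case/andP: us.
have uir : uniq (i :: r) by rewrite cat_uniq in us; case/and3P: us.
have -> : Z @^-1` (A1 `*` A2) = sumX X s @^-1` A1 `&` cyl X [:: i] (fun=> A2).
  by rewrite cyl_cons cyl_nil setIT.
(* [A'] puts the condition on [X i] into the family of sets; as [i] is not in [r], the conditions
   over [r] are unchanged. *)
pose A' k := if k == i then A2 else A k.
have mA' k : measurable (A' k) by rewrite /A'; case: ifP.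
have cylA' : cyl X [:: i] (fun=> A2) `&` cyl X r A = cyl X (i :: r) A'.
  rewrite !cyl_cons cyl_nil setIT /A' eqxx; congr (_ `&` _).
  apply: eq_bigcapr => k kr; case: eqP => // ki.
  by move: uir; rewrite /= -ki kr.
rewrite -setIA cylA' IH// IH//.
rewrite !iX//; last by case/andP: uir.
rewrite !big_cons big_nil mule1 {1}/A' eqxx -muleA; congr (_ * (_ * _))%E.
rewrite big_seq [RHS]big_seq; apply: eq_bigr => k kr.
by rewrite /A'; case: eqP => // ki; move: uir; rewrite /= -ki kr.
Qed.

Definition indep2 (X Y : Omega -> R) :=
  forall A B, measurable A -> measurable B ->
  P (X @^-1` A `&` Y @^-1` B) = (P (X @^-1` A) * P (Y @^-1` B))%E.

Lemma indep2_comp (X Y : Omega -> R) (a b : R -> R) :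
  measurable_fun setT a -> measurable_fun setT b ->
  indep2 X Y -> indep2 (a \o X) (b \o Y).
Proof.
move=> ma mb iXY A B mA mB; apply: (iXY (a @^-1` A) (b @^-1` B)).
- by rewrite -[_ @^-1` _]setTI; exact: ma.
- by rewrite -[_ @^-1` _]setTI; exact: mb.
Qed.

Section product_expectation.
Variables X Y : Omega -> R.
Hypotheses (mX : measurable_fun setT X) (mY : measurable_fun setT Y)
  (iXY : indep2 X Y) (intX : P.-integrable setT (EFin \o X))
  (intY : P.-integrable setT (EFin \o Y)).

Let Xm : {mfun Omega >-> R} := mfun_Sub (mem_set mX).
Let Ym : {mfun Omega >-> R} := mfun_Sub (mem_set mY).
Let mZ : measurable_fun setT (fun w => (X w, Y w)).
Proof. by apply/measurable_fun_pairP. Qed.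
Let Zm : {mfun Omega >-> (R * R)%type} := mfun_Sub (mem_set mZ).

Let dZ A : measurable A ->
  distribution P Zm A = (distribution P Xm \x distribution P Ym)%E A.
Proof.
move=> mA; apply/esym; apply: product_measure_unique => // B C mB mC.
Qed.

Let mprod : measurable_fun setT (fun p : R * R => (p.1 * p.2)%:E).
Proof. by apply/measurable_EFinP; exact: measurable_funM. Qed.

Let dX_int : (distribution P Xm).-integrable setT (@EFin R).
Proof.
by apply: integrable_pushforward => //.
Qed.

Let dY_int : (distribution P Ym).-integrable setT (@EFin R).
Proof.
by apply: integrable_pushforward => //.
Qed.

Let prod_int : (distribution P Xm \x distribution P Ym)%E.-integrable setT
  (fun p : R * R => (p.1 * p.2)%:E).
Proof.
apply/integrable12ltyP => //=.
have mabs : measurable_fun setT (fun x : R => `|x|%:E).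
  by apply/measurable_EFinP; exact: normr_measurable.
have /integrableP[_ iX] := dX_int; have /integrableP[_ iY] := dY_int.
under eq_integral do under eq_integral do rewrite normrM EFinM.
under eq_integral.
  move=> x _; rewrite ge0_integralZl//; over.
rewrite ge0_integralZr//=; last exact: integral_ge0.
by rewrite lte_mul_pinfty// ?integral_ge0// ge0_fin_numE// integral_ge0.
Qed.

Lemma indep2_integrable : P.-integrable setT (EFin \o (X \* Y)).
Proof.
apply/integrableP; split.
  by apply/measurable_EFinP; exact: measurable_funM.
have /integrableP[_] := prod_int; apply: le_lt_trans.
rewrite -(eq_measure_integral _ (fun A mA _ => dZ mA)).
by rewrite ge0_integral_distribution//; exact: measurableT_comp.
Qed.

(** By [dZ] the law of the pair is the product of the marginals, so Fubini's theorem factorises the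
    integral of the product. *)
Lemma indep2_expectation :
  (\int[P]_w (X w * Y w) = \int[P]_w X w * \int[P]_w Y w)%R.
Proof.
have iX := integrable_fin_num measurableT intX.
have iY := integrable_fin_num measurableT intY.
rewrite /Rintegral -fineM//; congr fine.
transitivity (\int[distribution P Zm]_p (p.1 * p.2)%:E)%E.
  by rewrite integral_distribution//; exact: indep2_integrable.
rewrite (eq_measure_integral _ (fun A mA _ => dZ mA)).
rewrite -integral12_prod_meas1// /fubini_F /=.
under eq_integral.
  by move=> x _; under eq_integral do rewrite EFinM; rewrite integralZl//; over.
have -> : (\int[P]_w (X w)%:E = \int[distribution P Xm]_x x%:E)%E.
  by rewrite integral_distribution.
have -> : (\int[P]_w (Y w)%:E = \int[distribution P Ym]_x x%:E)%E.
  by rewrite integral_distribution.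
have fY : (\int[distribution P Ym]_x x%:E)%E \is a fin_num.
  exact: integrable_fin_num dY_int.
rewrite -(fineK fY); exact: integralZr.
Qed.

End product_expectation.

End independence.

(** * Moments, tails and the strong law for partial sums *)

Section moments.
Context d (Omega : measurableType d) (R : realType) (P : probability Omega R).

Lemma RV_integrable_dominated (f g : Omega -> R) : measurable_fun setT f ->
  P.-integrable setT (EFin \o g) -> (forall w, `|f w| <= g w) ->
  P.-integrable setT (EFin \o f).
Proof.
move=> mf ig fg; apply: (le_integrable measurableT _ _ ig).
  exact/measurable_EFinP.
by move=> w _ /=; rewrite lee_fin (le_trans (fg w))// ler_norm.
Qed.

Lemma integrable_RVcst (c : R) : P.-integrable setT (EFin \o (cst c : Omega -> R)).
Proof. exact: finite_measure_integrable_cst. Qed.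

Lemma Rintegral_eq0 (f : Omega -> R) : (forall w, f w = 0) -> \int[P]_w f w = 0.
Proof.
move=> f0; rewrite (@eq_Rintegral _ _ _ _ setT (cst 0)); last by move=> w _.
by rewrite Rintegral_cst// mul0r.
Qed.

Lemma Rintegral_RVcst (c : R) : \int[P]_w (cst c : Omega -> R) w = c.
Proof.
transitivity (c * fine (P setT)); last by rewrite probability_setT mulr1.
exact: (@Rintegral_cst _ _ _ P setT measurableT c).
Qed.

(** The term linear in [y] keeps its sign and carries the factor x|x|: it integrates to 0 when [y]
    is centred and independent of [x]. Expanding (|x| + |y|)^3 would lose this cancellation. *)
Lemma cube_normD_le (x y : R) :
  `|x + y| ^+ 3 <= `|x| ^+ 3 + 3 * (x * `|x|) * y + 3 * (`|x| * y ^+ 2) + `|y| ^+ 3.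
Proof.
wlog x0 : x y / 0 <= x => [H|].
  have [/H->//|x0] := leP 0 x.
  have := H (- x) (- y); rewrite -opprD !normrN oppr_ge0 ltW//.
  by move=> /(_ isT); congr (_ <= _); ring.
rewrite (ger0_norm x0).
have y3 : y ^+ 3 <= `|y| ^+ 3 by rewrite -normrX ler_norm.
have [xy0|xy0] := ler0P (x + y).
  have y0 : y <= 0 by lra.
  (* The difference of the two sides is [x] times a quadratic form, which is nonnegative after
     completing the square. *)
  rewrite (ler0_norm y0) -subr_ge0.
  have -> : x ^+ 3 + 3 * (x * x) * y + 3 * (x * y ^+ 2) + (- y) ^+ 3 - (- (x + y)) ^+ 3
    = 2 * x * ((x + 3 / 2 * y) ^+ 2 + 3 / 4 * y ^+ 2) by field.
  have := sqr_ge0 y; have := sqr_ge0 (x + 3 / 2 * y).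
  by move: (_ ^+ 2) (_ ^+ 2) => a b *; rewrite mulr_ge0 ?mulr_ge0//; lra.
by apply: le_trans (lerD (lexx _) y3); rewrite -subr_ge0 le_eqVlt; apply/orP; left; apply/eqP; ring.
Qed.

Lemma cube_normD_le4 (x y : R) : `|x + y| ^+ 3 <= 4 * (`|x| ^+ 3 + `|y| ^+ 3).
Proof.
have h : `|x + y| ^+ 3 <= (`|x| + `|y|) ^+ 3.
  by rewrite lerXn2r// ?nnegrE// ?ler_normD// addr_ge0.
apply: (le_trans h); have := normr_ge0 x; have := normr_ge0 y.
move: `|x| `|y| => a b b0 a0; rewrite -subr_ge0.
have -> : 4 * (a ^+ 3 + b ^+ 3) - (a + b) ^+ 3 = 3 * (a + b) * (a - b) ^+ 2 by ring.
by apply: mulr_ge0; [apply: mulr_ge0 => //; exact: addr_ge0|exact: sqr_ge0].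
Qed.

Lemma norm_le1Dcube (x : R) : `|x| <= 1 + `|x| ^+ 3.
Proof.
have [x1|x1] := leP `|x| 1; first by rewrite (le_trans x1)// lerDl exprn_ge0.
by rewrite (@le_trans _ _ (`|x| ^+ 3)) ?lerDr// ler_eXnr// ltW.
Qed.

Lemma sqr_le1Dcube (x : R) : x ^+ 2 <= 1 + `|x| ^+ 3.
Proof.
rewrite -real_normK ?num_real//.
have [x1|x1] := leP `|x| 1.
  by rewrite (@le_trans _ _ 1) ?exprn_ile1// lerDl exprn_ge0.
by rewrite (@le_trans _ _ (`|x| ^+ 3)) ?lerDr// ler_weXn2l// ltW.
Qed.

Definition L3 (f : Omega -> R) := measurable_fun setT f /\
  P.-integrable setT (EFin \o (fun w => `|f w| ^+ 3)).

Lemma L3D f g : L3 f -> L3 g -> L3 (fun w => f w + g w).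
Proof.
move=> [mf f3] [mg g3]; split; first exact: measurable_funD.
apply: (@RV_integrable_dominated _ (fun w => 4 * (`|f w| ^+ 3 + `|g w| ^+ 3))).
- by apply: measurable_funX; apply: measurableT_comp => //; exact: measurable_funD.
- have := integrableZl measurableT 4 (integrableD measurableT f3 g3).
  by apply: eq_integrable.
- by move=> w; rewrite ger0_norm ?exprn_ge0//; exact: cube_normD_le4.
Qed.

Lemma L3_cst c : L3 (fun=> c).
Proof. by split; [exact: measurable_cst|exact: (integrable_RVcst (`|c| ^+ 3))]. Qed.

(** Since 1 + |x|^3 dominates x, x^2 and x|x|, this one criterion yields the integrability of all
    lower moments. *)
Lemma L3_dominated f (h : R -> R) (c : R) : measurable_fun setT h -> L3 f ->
  (forall x, `|h x| <= c * (1 + `|x| ^+ 3)) ->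
  P.-integrable setT (EFin \o (h \o f)).
Proof.
move=> mh [mf f3] hc.
apply: (@RV_integrable_dominated _ (fun w => c * (1 + `|f w| ^+ 3))).
- exact: measurableT_comp.
- have := integrableZl measurableT c (integrableD measurableT (integrable_RVcst 1) f3).
  by apply: eq_integrable.
- by move=> w; exact: hc.
Qed.

Lemma L3_integrable f : L3 f -> P.-integrable setT (EFin \o f).
Proof.
move=> f3; apply: (@L3_dominated _ id 1) => //.
by move=> x; rewrite mul1r norm_le1Dcube.
Qed.

Lemma L3_integrable_norm f : L3 f -> P.-integrable setT (EFin \o (fun w => `|f w|)).
Proof.
move=> f3; apply: (@L3_dominated _ (@Num.norm R R) 1) => //.
by move=> x; rewrite mul1r normr_id norm_le1Dcube.
Qed.

Lemma L3_integrable_sqr f : L3 f -> P.-integrable setT (EFin \o (fun w => f w ^+ 2)).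
Proof.
move=> f3; apply: (@L3_dominated _ (fun x => x ^+ 2) 1) => //.
by move=> x; rewrite mul1r ger0_norm ?sqr_ge0// sqr_le1Dcube.
Qed.

Context (Y : nat -> {RV P >-> R}) (v b : R).
Hypotheses (iY : indep_fam Y) (Y3 : forall i, L3 (Y i))
  (EY1 : forall i, \int[P]_w Y i w = 0)
  (EY2 : forall i, \int[P]_w (Y i w ^+ 2) = v)
  (EY3 : forall i, \int[P]_w (`|Y i w| ^+ 3) = b).

Let S n := sumX Y (index_iota 0 n).

Lemma indep_fam_sumX s i : uniq (i :: s) -> indep2 P (sumX Y s) (Y i).
Proof.
move=> us A B mA mB.
have us1 : uniq (s ++ [:: i]) by rewrite (perm_uniq (permEl (perm_catC _ _))).
have cylE : cyl Y [:: i] (fun=> B) = Y i @^-1` B by rewrite cyl_cons cyl_nil setIT.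
by have := indep_sumX iY us1 mA (fun=> mB); rewrite cylE.
Qed.

Lemma L3_sumX s : L3 (sumX Y s).
Proof.
elim: s => [|i s IH].
  have -> : sumX Y [::] = cst 0; last exact: L3_cst.
  by apply/funext => w; rewrite /sumX big_nil.
have -> : sumX Y (i :: s) = (fun w => Y i w + sumX Y s w).
  by apply/funext => w; rewrite sumX_cons.
exact: L3D.
Qed.

Lemma sumX_rcons n w : S n.+1 w = S n w + Y n w.
Proof. by rewrite /S /sumX big_nat_recr. Qed.

Lemma indep_S n : indep2 P (S n) (Y n).
Proof.
by apply: indep_fam_sumX; rewrite /= mem_index_iota ltnn andbF iota_uniq.
Qed.

Lemma v_ge0 : 0 <= v.
Proof. by rewrite -(EY2 0); apply: Rintegral_ge0 => w _; exact: sqr_ge0. Qed.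

Lemma b_ge0 : 0 <= b.
Proof. by rewrite -(EY3 0); apply: Rintegral_ge0 => w _; exact: exprn_ge0. Qed.

Lemma expectation_prod_S n (h g : R -> R) :
  measurable_fun setT h -> measurable_fun setT g ->
  P.-integrable setT (EFin \o (h \o S n)) ->
  P.-integrable setT (EFin \o (g \o Y n)) ->
  P.-integrable setT (EFin \o (fun w => h (S n w) * g (Y n w))) /\
  \int[P]_w (h (S n w) * g (Y n w)) =
  \int[P]_w h (S n w) * \int[P]_w g (Y n w).
Proof.
move=> mh mg ih ig.
have mS : measurable_fun setT (h \o S n) by apply: measurableT_comp => //; exact: measurable_sumX.
have mY : measurable_fun setT (g \o Y n) by apply: measurableT_comp.
have ind := indep2_comp mh mg (@indep_S n).
by split; [exact: (indep2_integrable mS mY ind)|exact: (indep2_expectation mS mY ind)].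
Qed.

Lemma expectation_S2 n : \int[P]_w (S n w ^+ 2) = n%:R * v.
Proof.
elim: n => [|n IH].
  by rewrite mul0r; apply: Rintegral_eq0 => w; rewrite /S /sumX big_nil expr0n.
have [ip ep] := @expectation_prod_S n id id (@measurable_id _ _ setT) (@measurable_id _ _ setT)
  (L3_integrable (L3_sumX _)) (L3_integrable (Y3 n)).
have iS := L3_integrable_sqr (L3_sumX (index_iota 0 n)).
have iYn := L3_integrable_sqr (Y3 n).
transitivity (\int[P]_w ((S n w ^+ 2 + 2 * (S n w * Y n w)) + Y n w ^+ 2)).
  by apply: eq_Rintegral => w _; rewrite sumX_rcons; ring.
have i2 := integrableZl measurableT 2 ip.
have i12 := integrableD measurableT iS i2.
rewrite RintegralD// RintegralD// RintegralZl// ep EY1 IH EY2; ring.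
Qed.

(** Integrates |s| <= s^2 / (2 r) + r / 2 with r = sqrt n, the choice for which both terms have
    order sqrt n, as the second moment is n v. *)
Lemma expectation_S1 n :
  \int[P]_w `|S n w| <= Num.sqrt n%:R * ((v + 1) / 2).
Proof.
have [->|n0] := posnP n.
  rewrite sqrtr0 mul0r (_ : \int[P]_w _ = 0)//.
  by apply: Rintegral_eq0 => w; rewrite /S /sumX big_nil normr0.
set r := Num.sqrt n%:R.
have r0 : 0 < r by rewrite sqrtr_gt0 ltr0n.
have r2 : r * r = n%:R by rewrite -expr2 sqr_sqrtr.
have i2 := L3_integrable_sqr (L3_sumX (index_iota 0 n)).
have i3 := integrableZl measurableT (r^-1 / 2) i2.
have i4 := integrable_RVcst (r / 2).
apply: (@le_trans _ _ (\int[P]_w (r^-1 / 2 * S n w ^+ 2 + r / 2))).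
  apply: le_Rintegral => //; [exact/L3_integrable_norm/L3_sumX|exact: (integrableD measurableT i3 i4)|].
  move=> w _; rewrite -real_normK ?num_real//; move: `|_| => s.
  rewrite -subr_ge0.
  have -> : r^-1 / 2 * s ^+ 2 + r / 2 - s = r^-1 / 2 * (s - r) ^+ 2.
    by field; rewrite gt_eqF.
  by rewrite mulr_ge0 ?sqr_ge0// divr_ge0// invr_ge0 ltW.
rewrite (@RintegralD _ _ _ P setT _ (cst (r / 2)))// RintegralZl//.
rewrite Rintegral_RVcst expectation_S2 -r2.
by rewrite le_eqVlt; apply/orP; left; apply/eqP; field; rewrite gt_eqF.
Qed.

(** With E|S_n| <= sqrt n (v + 1) / 2, the increment 3 v E|S_n| + b is at most this constant times
    sqrt (n + 1). *)
Definition cubic_bound : R := 3 * v * ((v + 1) / 2) + b.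

Lemma cubic_bound_ge0 : 0 <= cubic_bound.
Proof. have := v_ge0; have := b_ge0; rewrite /cubic_bound; nra. Qed.

(* In |S_n + Y_n|^3 the term linear in Y_n has expectation 0 by independence, so
   each step adds at most 3 v E|S_n| + b = O(sqrt n). *)
Lemma expectation_S3 n :
  \int[P]_w (`|S n w| ^+ 3) <= cubic_bound * (n%:R * Num.sqrt n%:R).
Proof.
elim: n => [|n IH].
  rewrite mul0r mulr0 (_ : \int[P]_w _ = 0)//.
  by apply: Rintegral_eq0 => w; rewrite /S /sumX big_nil normr0 expr0n.
have mxx : measurable_fun setT (fun x : R => x * `|x|) by apply: measurable_funM.
have ixx : P.-integrable setT (EFin \o ((fun x : R => x * `|x|) \o S n)).
  apply: (@L3_dominated _ _ 1) => //; first exact: L3_sumX.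
  by move=> x; rewrite normrM normr_id -expr2 mul1r real_normK ?num_real// sqr_le1Dcube.
have [i1 e1] := @expectation_prod_S n (fun x => x * `|x|) id mxx (@measurable_id _ _ setT) ixx
   (L3_integrable (Y3 n)).
have mx2 : measurable_fun setT (fun x : R => x ^+ 2) by apply: measurable_funX.
have [i2 e2] := @expectation_prod_S n (fun x => `|x|) (fun x => x ^+ 2) (@normr_measurable R setT) mx2
   (L3_integrable_norm (L3_sumX _)) (L3_integrable_sqr (Y3 n)).
have iS3 := (L3_sumX (index_iota 0 n)).2.
have iY3 := (Y3 n).2.
have j1 := integrableZl measurableT 3 i1.
have j2 := integrableZl measurableT 3 i2.
have k1 := integrableD measurableT iS3 j1.
have k2 := integrableD measurableT k1 j2.
have k3 := integrableD measurableT k2 iY3.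
apply: (@le_trans _ _ (\int[P]_w (`|S n w| ^+ 3 + 3 * (S n w * `|S n w| * Y n w)
   + 3 * (`|S n w| * Y n w ^+ 2) + `|Y n w| ^+ 3))).
  apply: le_Rintegral => //; first exact: (L3_sumX (index_iota 0 n.+1)).2.
  by move=> w _; rewrite sumX_rcons (le_trans (cube_normD_le _ _))// !mulrA.
rewrite RintegralD// RintegralD// RintegralD// !RintegralZl// e1 e2 EY1 EY2 EY3.
have := expectation_S1 n; rewrite mulr0 mulr0 addr0.
move: IH; move: (\int[P]_w _) (\int[P]_w _) => A B hA hB.
have c0 := cubic_bound_ge0; have v0 := v_ge0; have b0 := b_ge0.
have sn : Num.sqrt n%:R <= Num.sqrt n.+1%:R :> R by rewrite ler_sqrt// ler_nat.
have s1 : 1 <= Num.sqrt n.+1%:R :> R by rewrite -[leLHS]sqrtr1 ler_sqrt// ler1n.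
(* The induction closes because n sqrt n + sqrt (n + 1) <= (n + 1) sqrt (n + 1). *)
apply: (@le_trans _ _ (cubic_bound * (n%:R * Num.sqrt n%:R) + cubic_bound * Num.sqrt n.+1%:R)).
  rewrite -addrA lerD// [leRHS]mulrDl.
  apply: lerD; last by rewrite ler_peMr.
  apply: (@le_trans _ _ (3 * (Num.sqrt n%:R * ((v + 1) / 2) * v))).
    by rewrite ler_wpM2l// ler_wpM2r.
  have -> : 3 * (Num.sqrt n%:R * ((v + 1) / 2) * v) =
    3 * v * ((v + 1) / 2) * Num.sqrt n%:R by ring.
  by rewrite ler_wpM2l// !mulr_ge0// ?divr_ge0 ?addr_ge0.
rewrite -mulrDr ler_wpM2l// [leRHS](_ : _ = n%:R * Num.sqrt n.+1%:R + Num.sqrt n.+1%:R).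
  by rewrite lerD2r ler_wpM2l.
by rewrite -[X in X * _ = _]natr1 mulrDl mul1r.
Qed.

(** Markov's inequality for the cube: a third moment of order n^(3/2) against (eta n)^3. *)
Lemma tail_S n (eta : R) : 0 < eta -> (0 < n)%N ->
  (P [set w | (eta * n%:R <= `|S n w|)%R] <=
   (cubic_bound / eta ^+ 3 / (n%:R * Num.sqrt n%:R))%:E)%E.
Proof.
move=> eta0 n0.
have nR0 : 0 < n%:R :> R by rewrite ltr0n.
have e0 : 0 < eta * n%:R by rewrite mulr_gt0.
have := @markov _ _ _ P (mfun_Sub (mem_set (measurable_sumX Y (index_iota 0 n))))
  (fun x => x ^+ 3) _ e0.
move=> /(_ (measurable_funX _ (@measurable_id _ _ setT))).
have h3 : {in Num.nneg &, {homo (fun x : R => x ^+ 3) : x y / x <= y}}.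
  by move=> x y /= x0 y0 xy; rewrite lerXn2r.
have h0 (r : R) : 0 <= r -> 0 <= r ^+ 3 by exact: exprn_ge0.
move=> /(_ h0 h3).
rewrite unlock => hm.
have iS3 := (L3_sumX (index_iota 0 n)).2.
have eI : (\int[P]_w (`|S n w| ^+ 3)%:E)%E = (\int[P]_w (`|S n w| ^+ 3))%:E.
  by rewrite /Rintegral fineK//; exact: (integrable_fin_num measurableT iS3).
have {hm} hm : (((eta * n%:R) ^+ 3)%:E * P [set w | (eta * n%:R <= `|S n w|)%R]
    <= (cubic_bound * (n%:R * Num.sqrt n%:R))%:E)%E.
  apply: le_trans hm _.
  by rewrite [leLHS](_ : _ = \int[P]_w (`|S n w| ^+ 3)%:E)%E// eI lee_fin; exact: expectation_S3.
have s0 : 0 < Num.sqrt n%:R :> R by rewrite sqrtr_gt0.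
have s2 : Num.sqrt n%:R * Num.sqrt n%:R = n%:R :> R by rewrite -expr2 sqr_sqrtr.
rewrite muleC -lee_pdivlMr ?exprn_gt0// in hm.
apply: le_trans hm _; rewrite -EFinM lee_fin le_eqVlt; apply/orP; left; apply/eqP.
have key (r m : R) : 0 < r -> r * r = m ->
    cubic_bound * (m * r) / (eta * m) ^+ 3 = cubic_bound / eta ^+ 3 / (m * r).
  by move=> r0 <-; field; rewrite !gt_eqF.
exact: key.
Qed.

(** For consecutive square roots t < s one has 1 / s^3 <= 2 / t - 2 / s, which telescopes. The
    induction is on the sharper bound 3 - 2 / sqrt N, an equality at N = 1. *)
Lemma sum_inv_nsqrtn N :
  \sum_(0 <= n < N) (n.+1%:R * Num.sqrt n.+1%:R)^-1 <= 3 :> R.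
Proof.
case: N => [|N]; first by rewrite big_geq.
apply: (@le_trans _ _ (3 - 2 / Num.sqrt N.+1%:R)); last first.
  by rewrite gerBl divr_ge0.
elim: N => [|N IH]; first by rewrite big_nat1 sqrtr1; lra.
rewrite big_nat_recr//=.
set s := Num.sqrt N.+2%:R; set t := Num.sqrt N.+1%:R in IH.
have s0 : 0 < s by rewrite sqrtr_gt0.
have t0 : 0 < t by rewrite sqrtr_gt0.
have s2 : N.+2%:R = s ^+ 2 by rewrite sqr_sqrtr.
have t2 : N.+1%:R = t ^+ 2 by rewrite sqr_sqrtr.
have ts : t <= s by rewrite ler_sqrt// ler_nat.
have st1 : (s - t) * (s + t) = 1.
  by rewrite -subr_sqr -s2 -t2 -natrB// subSnn.
rewrite s2; apply: (le_trans (lerD IH (lexx _))).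
rewrite -lerBrDl.
have -> : 3 - 2 / s - (3 - 2 / t) = 2 * (s - t) / (s * t).
  by field; rewrite !gt_eqF.
have -> : s - t = (s + t)^-1.
  by rewrite -[RHS]mul1r -st1 mulfK// gt_eqF// addr_gt0.
rewrite -[leLHS]mul1r ler_pdivrMr; last by rewrite mulr_gt0// exprn_gt0.
have -> : 2 / (s + t) / (s * t) * (s ^+ 2 * s) = 2 * s ^+ 2 / ((s + t) * t).
  by field; rewrite !gt_eqF// addr_gt0.
rewrite ler_pdivlMr; last by rewrite mulr_gt0// addr_gt0.
nra.
Qed.

Lemma ae_eventually_small (eta : R) : 0 < eta ->
  {ae P, forall w, \forall n \near \oo, `|S n w| < eta * n%:R}.
Proof.
move=> eta0.
(* Shifted by one because [tail_S] needs a positive number of summands. *)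
pose F n := [set w | eta * n.+1%:R <= `|S n.+1 w|].
have mF n : measurable (F n).
  rewrite -[F n]setTI; apply: measurable_fun_le => //.
  by apply: measurableT_comp => //; exact: measurable_sumX.
have sF : (\sum_(n <oo) P (F n) < +oo)%E.
  apply: (@le_lt_trans _ _ (cubic_bound / eta ^+ 3 * 3)%:E); last by rewrite ltry.
  apply: lime_le; first exact: is_cvg_nneseries.
  apply: nearW => N.
  apply: (@le_trans _ _ (\sum_(0 <= n < N)
      (cubic_bound / eta ^+ 3 * (n.+1%:R * Num.sqrt n.+1%:R)^-1)%:E))%E.
    by apply: lee_sum => n _; exact: tail_S.
  rewrite sumEFin lee_fin -mulr_sumr ler_wpM2l ?sum_inv_nsqrtn//.
  by rewrite divr_ge0 ?cubic_bound_ge0// exprn_ge0// ltW.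
exists (lim_sup_set F); split.
- by apply: bigcap_measurable => // k _; exact: bigcup_measurable.
- exact: lim_sup_set_cvg0.
- move=> w /= nw n _.
  apply: contrapT => nF; apply: nw.
  exists n.+1 => // k /= nk; rewrite ltNge; apply/negP => Fk.
  apply: nF; exists k.-1; first by rewrite /= -ltnS prednK// (leq_trans _ nk).
  by rewrite /F /= prednK// (leq_trans _ nk).
Qed.

(** The countably many tolerances 1 / (m + 1) suffice, so their exceptional sets unite to one null
    set. *)
Lemma SLLN : {ae P, forall w, (S n w / n%:R) @[n --> \oo] --> (0 : R)}.
Proof.
have : {ae P, forall w (m : nat), \forall n \near \oo, `|S n w| < m.+1%:R^-1 * n%:R}.
  by apply: ae_foralln => m; exact: ae_eventually_small.
apply: filterS => w H; apply/cvgrPdist_lt => e e0.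
have [m _ hm] := near_infty_natSinv_lt (PosNum e0).
have {hm} hm := hm m (leqnn _).
near=> n.
have n0 : 0 < n%:R :> R by rewrite ltr0n; near: n; exists 1%N.
rewrite sub0r normrN normrM normfV (ger0_norm (ltW n0)) ltr_pdivrMr//.
apply: (@lt_trans _ _ (m.+1%:R^-1 * n%:R)); last by rewrite ltr_pM2r.
by near: n; exact: H.
Unshelve. all: by end_near.
Qed.

End moments.

(** * Stein's method *)

Section lipschitz_taylor.
Context (R : realType) (f f1 : R -> R) (K : R).
Hypotheses (f_der : forall x : R, is_derive x (1 : R) f (f1 x)).

Lemma MVT_everywhere (x y : R) :
  exists2 c, `|c - x| <= `|y - x| & f y - f x = f1 c * (y - x).
Proof.
have fc a b : {within `[a, b], continuous f}.
  by apply: derivable_within_continuous => z _; have [] := f_der z.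
have [xy|/ltW yx] := leP x y.
  have [c] := @MVT_segment _ f f1 x y xy (fun z _ => f_der z) (fc _ _).
  rewrite in_itv /= => /andP[xc cy] E; exists c => //.
  by rewrite !ger0_norm ?subr_ge0// lerD2r.
have [c] := @MVT_segment _ f f1 y x yx (fun z _ => f_der z) (fc _ _).
rewrite in_itv /= => /andP[yc cx] E; exists c.
  by rewrite !ler0_norm ?subr_le0// lerN2 lerD2r.
by rewrite -[LHS]opprB E -mulrN opprB.
Qed.

Lemma derive_bounded_lipschitz (M : R) : (forall x, `|f1 x| <= M) ->
  forall x y, `|f y - f x| <= M * `|y - x|.
Proof.
move=> f1M x y; have [c _ ->] := MVT_everywhere x y.
by rewrite normrM ler_wpM2r.
Qed.

Hypothesis f1_lip : forall x y, `|f1 y - f1 x| <= K * `|y - x|.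

Lemma lipschitz_taylor (x h : R) : `|f (x + h) - f x - f1 x * h| <= K * h ^+ 2.
Proof.
have K0 : 0 <= K.
  have := f1_lip 0 1; rewrite subr0 normr1 mulr1; exact: le_trans.
have [c] := MVT_everywhere x (x + h); rewrite addrAC subrr add0r => cx ->.
rewrite -mulrBl normrM -[h ^+ 2]real_normK ?num_real// expr2 mulrA.
by rewrite ler_wpM2r// (le_trans (f1_lip _ _))// ler_wpM2l.
Qed.

End lipschitz_taylor.

Section stein.
Context d (Omega : measurableType d) (R : realType) (P : probability Omega R).
Context (Y : nat -> {RV P >-> R}) (b : R).
Hypotheses (iY : indep_fam Y) (Y3 : forall i, L3 P (Y i))
  (EY1 : forall i, \int[P]_w Y i w = 0)
  (EY2 : forall i, \int[P]_w (Y i w ^+ 2) = 1)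
  (EY3 : forall i, \int[P]_w (`|Y i w| ^+ 3) = b).
Context (f f1 : R -> R) (K M : R).
Hypotheses (f_der : forall x : R, is_derive x (1 : R) f (f1 x))
  (f1_lip : forall x y, `|f1 y - f1 x| <= K * `|y - x|)
  (mf : measurable_fun setT f) (mf1 : measurable_fun setT f1)
  (f_bd : forall x, `|f x| <= M) (f1_bd : forall x, `|f1 x| <= M).

Let S n := sumX Y (index_iota 0 n).
Let W n w := S n w / Num.sqrt n%:R.

Lemma bounded_integrable (h : R -> R) (Z : Omega -> R) (c : R) :
  measurable_fun setT h -> measurable_fun setT Z -> (forall x, `|h x| <= c) ->
  P.-integrable setT (EFin \o (fun w => h (Z w))).
Proof.
move=> mh mZ hc; apply: (@RV_integrable_dominated _ _ _ P _ (cst c)).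
- exact: measurableT_comp.
- exact: integrable_RVcst.
- by move=> w; exact: hc.
Qed.

(* [Y i] is independent of the sum of the other terms; expanding around that
   sum, the first two orders cancel because [Y i] has mean 0 and variance 1. *)
Lemma stein_term n i : (i < n)%N ->
  P.-integrable setT (EFin \o (fun w =>
    Y i w / Num.sqrt n%:R * f (W n w) - f1 (W n w) / n%:R)) /\
  `|\int[P]_w (Y i w / Num.sqrt n%:R * f (W n w) - f1 (W n w) / n%:R)| <=
  K * (1 + 2 * b) / (Num.sqrt n%:R * n%:R).
Proof.
move=> lin.
have n0 : (0 < n)%N by rewrite (leq_ltn_trans _ lin).
set r := Num.sqrt n%:R.
have r0 : 0 < r by rewrite sqrtr_gt0 ltr0n.
have r2 : n%:R = r * r by rewrite -expr2 sqr_sqrtr.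
rewrite r2.
pose s := rem i (index_iota 0 n).
have si : perm_eq (index_iota 0 n) (i :: s).
  by apply: perm_to_rem; rewrite mem_index_iota.
have us : uniq (i :: s) by rewrite -(perm_uniq si) iota_uniq.
have iS : indep2 P (sumX Y s) (Y i) by exact: indep_fam_sumX.
have SE w : S n w = sumX Y s w + Y i w.
  by rewrite /S {1}/sumX (perm_big _ si) /= big_cons addrC.
pose Wi w := sumX Y s w / r.
have WE w : W n w = Wi w + Y i w / r by rewrite /W SE mulrDl.
have mS' : measurable_fun setT (sumX Y s) by exact: measurable_sumX.
have mdiv : measurable_fun setT (fun x : R => x / r) by exact: measurable_funM.
have mYi : measurable_fun setT (Y i) by exact: measurable_funP.
have mWi : measurable_fun setT Wi by exact: (measurableT_comp mdiv).
have mW : measurable_fun setT (W n).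
  by apply: (measurableT_comp mdiv); exact: measurable_sumX.
have mfd : measurable_fun setT (fun x : R => f (x / r)) by exact: measurableT_comp.
have mf1d : measurable_fun setT (fun x : R => f1 (x / r)) by exact: measurableT_comp.
have msq : measurable_fun setT (fun x : R => x ^+ 2 - 1).
  by apply: measurable_funB => //; exact: measurable_funX.
have iYi := L3_integrable (Y3 i).
have iY2 : P.-integrable setT (EFin \o (fun w => Y i w ^+ 2 - 1)).
  by have := integrableB measurableT (L3_integrable_sqr (Y3 i)) (@integrable_RVcst _ _ _ P 1).
pose A w := f (Wi w) * Y i w.
pose B w := f1 (Wi w) * (Y i w ^+ 2 - 1).
have ifW := bounded_integrable mf mWi f_bd.
have if1W := bounded_integrable mf1 mWi f1_bd.
have indA := indep2_comp mfd (@measurable_id _ _ setT) iS.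
have indB := indep2_comp mf1d msq iS.
have mfW : measurable_fun setT (fun w => f (Wi w)) by exact: measurableT_comp.
have mf1W : measurable_fun setT (fun w => f1 (Wi w)) by exact: measurableT_comp.
have mY2 : measurable_fun setT (fun w => Y i w ^+ 2 - 1) by exact: (measurableT_comp msq).
have iA : P.-integrable setT (EFin \o A) by exact: (indep2_integrable mfW mYi indA).
have iB : P.-integrable setT (EFin \o B) by exact: (indep2_integrable mf1W mY2 indB).
have EA : \int[P]_w A w = 0.
  by rewrite (indep2_expectation mfW mYi indA)// EY1 mulr0.
have EB : \int[P]_w B w = 0.
  rewrite (indep2_expectation mf1W mY2 indB)//.
  rewrite (@RintegralB _ _ _ P setT _ (cst 1))//; last 2 first.
  - exact: L3_integrable_sqr.
  - exact: integrable_RVcst.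
  by rewrite EY2 Rintegral_RVcst subrr mulr0.

have K0 : 0 <= K.
  have := f1_lip 0 1; rewrite subr0 normr1 mulr1; exact: le_trans.
pose T w := Y i w / r * f (W n w) - f1 (W n w) / (r * r).
have iT1 : P.-integrable setT (EFin \o (fun w => Y i w / r * f (W n w))).
  apply: (@RV_integrable_dominated _ _ _ P _ (fun w => r^-1 * M * `|Y i w|)).
  - by apply: measurable_funM; [exact: (measurableT_comp mdiv)|exact: measurableT_comp].
  - by have := integrableZl measurableT (r^-1 * M) (L3_integrable_norm (Y3 i)).
  - move=> w; rewrite !normrM normfV (gtr0_norm r0) -[leRHS]mulrA mulrC.
    rewrite (mulrC _ (r^-1)) mulrCA ler_wpM2l ?invr_ge0 ?(ltW r0)//.
    by rewrite ler_wpM2r.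
have iT2 : P.-integrable setT (EFin \o (fun w => f1 (W n w) / (r * r))).
  have := integrableZr measurableT (r * r)^-1 (bounded_integrable mf1 mW f1_bd).
  by apply: eq_integrable.
have iT : P.-integrable setT (EFin \o T) by have := integrableB measurableT iT1 iT2.
split=> //.
have iA' := integrableZl measurableT r^-1 iA.
have iB' := integrableZl measurableT (r * r)^-1 iB.
have iAB : P.-integrable setT (EFin \o (fun w => r^-1 * A w + (r * r)^-1 * B w)).
  by have := integrableD measurableT iA' iB'.
pose D w := T w - (r^-1 * A w + (r * r)^-1 * B w).
have iD : P.-integrable setT (EFin \o D) by have := integrableB measurableT iT iAB.
have EAB : \int[P]_w (r^-1 * A w + (r * r)^-1 * B w) = 0.
  rewrite (@RintegralD _ _ _ P setT (fun w => r^-1 * A w) (fun w => (r * r)^-1 * B w))//.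
  by rewrite RintegralZl// RintegralZl// EA EB !mulr0 addr0.
have ETD : \int[P]_w T w = \int[P]_w D w 
  by rewrite (@RintegralB _ _ _ P setT T (fun w => r^-1 * A w + (r * r)^-1 * B w))// EAB subr0.
rewrite -/T ETD (le_trans (le_normr_Rintegral measurableT iD))//.
have iYn := L3_integrable_norm (Y3 i).
have iYb : P.-integrable setT (EFin \o (fun w => `|Y i w| ^+ 3 + `|Y i w|)).
  by have := integrableD measurableT (Y3 i).2 iYn.
have iYb' : P.-integrable setT
    (EFin \o (fun w => K / (r * (r * r)) * (`|Y i w| ^+ 3 + `|Y i w|))).
  by have := integrableZl measurableT (K / (r * (r * r))) iYb.
have iDn : P.-integrable setT (EFin \o (fun w => `|D w|)).
  by have := integrable_norm iD.
apply: (@le_trans _ _ (\int[P]_w (K / (r * (r * r)) * (`|Y i w| ^+ 3 + `|Y i w|)))).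
  apply: le_Rintegral => // w _.
  rewrite /D /T /A /B WE; move: (Wi w) (Y i w) => x y.
  have t1 := lipschitz_taylor f_der f1_lip x (y / r).
  have t2 := f1_lip (x + y / r) x.
  have xyr : x - (x + y / r) = - (y / r) by ring.
  rewrite xyr normrN in t2.
  (* What remains is y / r times the first-order Taylor remainder of [f], plus the increment of [f1]
     over the step y / r, divided by r^2. They are at most K |y|^3 / r^3 and K |y| / r^3. *)
  have -> : y / r * f (x + y / r) - f1 (x + y / r) / (r * r) -
     (r^-1 * (f x * y) + (r * r)^-1 * (f1 x * (y ^+ 2 - 1))) =
     y / r * (f (x + y / r) - f x - f1 x * (y / r)) +
     (f1 x - f1 (x + y / r)) / (r * r) by field; rewrite gt_eqF.
  rewrite [leRHS]mulrDr (le_trans (ler_normD _ _))// lerD//.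
    rewrite normrM (le_trans (ler_wpM2l _ t1))// le_eqVlt; apply/orP; left; apply/eqP.
    rewrite normrM normfV (gtr0_norm r0) exprMn -(real_normK (num_real y)).
    by field; rewrite gt_eqF.
  rewrite normrM (gtr0_norm (_ : 0 < (r * r)^-1)) ?invr_gt0 ?mulr_gt0//.
  have rr0 : 0 <= (r * r)^-1 by rewrite invr_ge0 mulr_ge0// ltW.
  rewrite (le_trans (ler_wpM2r rr0 t2))//.
  rewrite normrM normfV (gtr0_norm r0) le_eqVlt; apply/orP; left; apply/eqP.
  by field; rewrite gt_eqF.
rewrite RintegralZl// RintegralD//; last exact: (Y3 i).2.
rewrite EY3.
have EY : \int[P]_w `|Y i w| <= 1 + b.
  rewrite -(EY3 i) -(Rintegral_RVcst P 1) -RintegralD//; last 2 first.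
  - exact: integrable_RVcst.
  - exact: (Y3 i).2.
  apply: le_Rintegral => //.
    by have := integrableD measurableT (@integrable_RVcst _ _ _ P 1) (Y3 i).2.
  by move=> w _; exact: norm_le1Dcube.
have -> : K * (1 + 2 * b) / (r * (r * r)) = K / (r * (r * r)) * (b + (1 + b)).
  by field; rewrite gt_eqF.
by rewrite ler_wpM2l ?lerD2l// divr_ge0// !mulr_ge0 ?ltW.
Qed.

(** Cutting [f1 (W n w)] into [n] equal shares pairs each share with one [Y i]; the [n] errors of
    [stein_term], each of order n^(-3/2), add up to order n^(-1/2). *)
Lemma stein_bound n : (0 < n)%N ->
  `|\int[P]_w (W n w * f (W n w) - f1 (W n w))| <= K * (1 + 2 * b) / Num.sqrt n%:R.
Proof.
move=> n0.
have r0 : 0 < Num.sqrt n%:R :> R by rewrite sqrtr_gt0 ltr0n.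
pose t i w := Y i w / Num.sqrt n%:R * f (W n w) - f1 (W n w) / n%:R.
have it i : (i < n)%N -> P.-integrable setT (EFin \o t i).
  by move=> /stein_term[].
have H m : (m <= n)%N ->
    P.-integrable setT (EFin \o (fun w => \sum_(0 <= i < m) t i w)) /\
    `|\int[P]_w (\sum_(0 <= i < m) t i w)| <=
      m%:R * (K * (1 + 2 * b) / (Num.sqrt n%:R * n%:R)).
  elim: m => [_|m IH mn].
    have E : (fun w => \sum_(0 <= i < 0) t i w) = cst 0.
      by apply/funext => w; rewrite big_geq.
    rewrite E mul0r Rintegral_RVcst normr0; split => //.
    exact: integrable_RVcst.
  have [i1 h1] := IH (ltnW mn).
  have E : (fun w => \sum_(0 <= i < m.+1) t i w) =
           (fun w => \sum_(0 <= i < m) t i w + t m w).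
    by apply/funext => w; rewrite big_nat_recr.
  have i2 := it _ mn.
  rewrite E; split; first by have := integrableD measurableT i1 i2.
  rewrite RintegralD// (le_trans (ler_normD _ _))// -natr1 mulrDl mul1r lerD//.
  by have [] := stein_term mn.
have [_] := H n (leqnn _).
have -> : (fun w => \sum_(0 <= i < n) t i w) =
          (fun w => W n w * f (W n w) - f1 (W n w)).
  apply/funext => w; rewrite /t big_split/= sumrN.
  congr (_ - _).
    by rewrite -!mulr_suml.
  rewrite sumr_const_nat subn0 -[LHS]mulr_natr mulfVK//.
  by rewrite pnatr_eq0 -lt0n.
move=> h; apply: (le_trans h); rewrite le_eqVlt; apply/orP; left; apply/eqP.
by field; rewrite gt_eqF// pnatr_eq0 -lt0n.
Qed.

End stein.

(** * Lipschitz functions and cut-offs *)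

Section lipschitz.
Context (R : realType).
Implicit Types (h : R -> R) (K : R).

Definition lip K h := forall x y, `|h y - h x| <= K * `|y - x|.

Lemma lip_ge0 K h : lip K h -> 0 <= K.
Proof.
by move=> /(_ 0 1); rewrite subr0 normr1 mulr1; exact: le_trans.
Qed.

Lemma lip_continuous K h : lip K h -> continuous h.
Proof.
move=> hl x; have K0 := lip_ge0 hl.
apply/cvgrPdist_lt => e e0; near=> y.
rewrite distrC (le_lt_trans (hl _ _))//.
have : `|y - x| < e / (K + 1).
  rewrite distrC; near: y; apply: (@nbhsx_ballx _ _ x); rewrite divr_gt0//; lra.
rewrite ltr_pdivlMr; last lra.
move: (normr_ge0 (y - x)); nra.
Unshelve. all: by end_near. Qed.

Lemma lipB K K' h h' : lip K h -> lip K' h' -> lip (K + K') (fun x => h x - h' x).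
Proof.
move=> hl hl' x y.
have -> : h y - h' y - (h x - h' x) = (h y - h x) - (h' y - h' x) by ring.
by rewrite (le_trans (ler_normB _ _))// mulrDl lerD.
Qed.

Lemma lipZ K h c : lip K h -> lip (`|c| * K) (fun x => c * h x).
Proof. by move=> hl x y; rewrite -mulrBr normrM -mulrA ler_wpM2l. Qed.

(* Piecewise linear cut-off: 1 for |x| <= a and 0 for |x| >= b. *)
Definition tent (a b x : R) : R := Num.max 0 (Num.min 1 ((b - `|x|) / (b - a))).

Lemma tent_ge0 a b x : 0 <= tent a b x.
Proof. by rewrite /tent le_max lexx. Qed.

Lemma tent_le1 a b x : tent a b x <= 1.
Proof. by rewrite /tent ge_max ler01 ge_min lexx. Qed.

Lemma tent_eq1 a b x : a < b -> `|x| <= a -> tent a b x = 1.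
Proof.
move=> ab xa; rewrite /tent min_l ?max_r//.
by rewrite ler_pdivlMr ?subr_gt0// mul1r lerD2l lerN2.
Qed.

Lemma tent_eq0 a b x : a < b -> b <= `|x| -> tent a b x = 0.
Proof.
move=> ab xa; rewrite /tent max_l// ge_min; apply/orP; right.
by rewrite pmulr_lle0 ?invr_gt0 ?subr_gt0// subr_le0.
Qed.

Lemma tent_lip a b : a < b -> lip (b - a)^-1 (tent a b).
Proof.
move=> ab x y; rewrite /tent.
(* Describing the truncation to [0, 1] by three linear cases turns its contraction property into
   linear arithmetic in each of nine combinations. *)
have clampE (u : R) : exists2 c, Num.max 0 (Num.min 1 u) = c &
    [\/ u <= 0 /\ c = 0, 0 <= u <= 1 /\ c = u | 1 <= u /\ c = 1].
  have [u0|u0] := leP u 0.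
    exists 0; last by constructor 1.
    by rewrite max_l// ge_min u0 orbT.
  have [u1|/ltW u1] := leP u 1.
    by exists u; [rewrite max_r// ltW|constructor 2; rewrite ltW].
  by exists 1; [rewrite max_r|constructor 3].
have clamp (u v : R) : `|Num.max 0 (Num.min 1 u) - Num.max 0 (Num.min 1 v)| <= `|u - v|.
  have [c -> cu] := clampE u; have [c' -> cv] := clampE v.
  have : - `|u - v| <= u - v <= `|u - v| by rewrite -ler_norml.
  have := normr_ge0 (u - v).
  rewrite ler_norml; move: `|u - v| => z z0 /andP[z1 z2].
  by apply/andP; split; case: cu => -[? ?]; case: cv => -[? ?]; lra.
rewrite (le_trans (clamp _ _))// -mulrBl normrM mulrC normfV (@gtr0_norm _ (b - a)) ?subr_gt0//.
rewrite ler_wpM2l ?invr_ge0 ?subr_ge0 ?(ltW ab)//.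
have -> : b - `|y| - (b - `|x|) = `|x| - `|y| by ring.
by rewrite (le_trans (ler_dist_dist _ _))// distrC.
Qed.

End lipschitz.

(** * The Stein equation for the standard normal density *)

Section stein_solution.
Context (R : realType).
Notation mu := (@lebesgue_measure R).
Let phi : R -> R := normal_pdf 0 1.
Let peak : R := normal_peak 1.

Lemma std_pdfE x : phi x = peak * expR (- (x ^+ 2 / 2)).
Proof.
rewrite /phi normal_pdfE ?oner_neq0//; congr (_ * expR _).
by rewrite subr0 expr1n mulNr.
Qed.

Lemma std_pdf_gt0 x : 0 < phi x.
Proof. by rewrite std_pdfE mulr_gt0 ?expR_gt0 ?normal_peak_gt0 ?oner_neq0. Qed.

(* psi = 1 / phi *)
Let psi (x : R) : R := peak^-1 * expR (x ^+ 2 / 2).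

Lemma psi_std_pdf x : psi x * phi x = 1.
Proof.
have p0 : peak != 0 by rewrite gt_eqF// normal_peak_gt0// oner_neq0.
rewrite /psi std_pdfE mulrACA mulVf// mul1r -expRD addrC addNr expR0 //.
Qed.

Lemma is_derive_psi (x : R) : is_derive x (1 : R) psi (x * psi x).
Proof.
have h : is_derive x (1 : R) (fun y : R => y ^+ 2 / 2) x.
  have -> : (fun y : R => y ^+ 2 / 2) = (2^-1 : R) *: (id ^+ 2 : R -> R).
    by apply/funext => y; rewrite /= fctE /GRing.scale /= mulrC.
  apply: is_derive_eq.
  have -> : 2^-1 *: (2 * x ^+ 2.-1)%:A = 2^-1 * ((2 * x) * 1) :> R by [].
  by field.
have h2 := @is_derive1_comp _ expR (fun y : R => y ^+ 2 / 2) x _ _ (is_derive_expR _) h.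
have := is_deriveZ peak^-1 h2.
rewrite [X in is_derive _ _ _ X -> _](_ : _ = x * psi x)//.
rewrite /psi /GRing.scale /=; ring.
Qed.

Section solution.
Context (g : R -> R) (B K : R).
Hypotheses (g_lip : lip K g) (g_supp : forall x, B <= `|x| -> g x = 0) (B0 : 0 < B)
  (g_int : \int[mu]_x (g x * phi x) = 0).

Lemma supp_bounded (h : R -> R) : continuous h -> (forall x, B <= `|x| -> h x = 0) ->
  exists M, forall x, `|h x| <= M.
Proof.
move=> ch h0.

have BB : - B <= B by rewrite (@le_trans _ _ 0)// ?oppr_le0 ltW.
have cn : {within `[- B, B], continuous (fun x => `|h x|)}.
  apply: continuous_subspaceT => x.
  by apply: continuous_comp; [exact: ch|exact: norm_continuous].
have [c _ hc] := EVT_max BB cn.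
exists `|h c| => x; have [xB|xB] := leP `|x| B.
  by apply: hc; rewrite in_itv /= -ler_norml.
by rewrite h0 ?normr0// ltW.
Qed.

Let g_cont : continuous g := lip_continuous g_lip.

Let gphi_cont : continuous (fun x => g x * phi x).
Proof.
by move=> x; apply: cvgM; [exact: g_cont|apply: continuous_normal_pdf; exact: oner_neq0].
Qed.

Lemma integrable_supp_pdf : mu.-integrable setT (EFin \o (fun x => g x * phi x)).
Proof.
have [M gM] := supp_bounded g_cont g_supp.
have iphi := integrable_normal_pdf (0 : R) 1.
apply: (le_integrable measurableT _ _ (integrableZl measurableT M iphi)).
  by apply/measurable_EFinP; exact: continuous_measurable_fun.
move=> x _ /=; rewrite lee_fin normrM.
have p0 := std_pdf_gt0 x.
by rewrite (le_trans _ (ler_norm _))// (gtr0_norm p0) ler_wpM2r// ltW.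
Qed.

Let G (x : R) : R := \int[mu]_(t in `]-oo, x]) (g t * phi t).

Let G_der x : is_derive x (1 : R) G (g x * phi x).
Proof.
have xx : x < x + 1 by rewrite ltrDl.
have iG : mu.-integrable `]-oo, x + 1] (EFin \o (fun x => g x * phi x)).
  by apply: (integrableS measurableT _ _ integrable_supp_pdf).
have [d1 d2] := continuous_FTC1 xx iG (ltNyr x) (@gphi_cont x).
by apply: (DeriveDef d1); rewrite -derive1E; exact: d2.
Qed.

Let G_supp x : B <= `|x| -> G x = 0.
Proof.
move=> Bx; rewrite /G; have [x0|x0] := leP 0 x.
  rewrite ger0_norm// in Bx.
  rewrite -g_int Rintegral_mkcond; apply: eq_Rintegral => t _.
  rewrite /patch; case: ifPn => // /negP tx.
  rewrite g_supp ?mul0r//; apply: le_trans Bx _; apply: le_trans (ler_norm t).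
  by rewrite leNgt; apply/negP => xt; apply: tx; rewrite inE /= in_itv /= ltW.
rewrite ltr0_norm// in Bx.
rewrite (@eq_Rintegral _ _ _ _ _ (cst 0)).
  by rewrite Rintegral_cst// mul0r.
move=> t; rewrite inE /= in_itv /= => tx.
rewrite g_supp ?mul0r//; apply: le_trans Bx _.
rewrite -normrN; apply: le_trans (ler_norm (- t)); lra.
Qed.

(* Integrating g phi over the line gives 0, hence G has compact support. *)
Definition stein_sol (x : R) : R := psi x * G x.
Definition stein_sol' (x : R) : R := g x + x * stein_sol x.

(** The product rule with psi' = x psi, G' = g phi and psi phi = 1; this is the Stein equation f' -
    x f = g. *)
Lemma stein_sol_der x : is_derive x (1 : R) stein_sol (stein_sol' x).
Proof.
have h1 := is_derive_psi x; have h2 := G_der x.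
have := is_deriveM h1 h2; rewrite /GRing.scale /=.
rewrite [X in is_derive _ _ _ X -> _](_ : _ = stein_sol' x) //.
rewrite /stein_sol' /stein_sol mulrCA -[in RHS](mul1r (g x)) -(psi_std_pdf x).
ring.
Qed.

Let f_cont : continuous stein_sol.
Proof.
by move=> x; apply/differentiable_continuous/derivable1_diffP; have [] := stein_sol_der x.
Qed.

Let f'_cont : continuous stein_sol'.
Proof.
move=> x; apply: (@cvgD _ R^o); first exact: g_cont.
by apply: cvgM; [exact: cvg_id|exact: f_cont].
Qed.

Lemma stein_sol_supp x : B <= `|x| -> stein_sol x = 0.
Proof. by move=> Bx; rewrite /stein_sol G_supp// mulr0. Qed.

Lemma stein_sol'_supp x : B <= `|x| -> stein_sol' x = 0.
Proof. by move=> Bx; rewrite /stein_sol' stein_sol_supp// g_supp// mulr0 addr0. Qed.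

(** As f' = g + x f, only the product x f needs an argument: one of the two points may be taken in
    [-B, B], where the factor x is bounded, since x f vanishes at both points otherwise. *)
Lemma stein_sol_props : exists K' M, [/\ lip K' stein_sol',
  forall x, `|stein_sol x| <= M & forall x, `|stein_sol' x| <= M].
Proof.
have [M0 h0] := supp_bounded f_cont stein_sol_supp.
have [M1 h1] := supp_bounded f'_cont stein_sol'_supp.
have fl := derive_bounded_lipschitz stein_sol_der h1.
have M00 : 0 <= M0 := le_trans (normr_ge0 _) (h0 0).
have M10 : 0 <= M1 := le_trans (normr_ge0 _) (h1 0).
exists (K + (M0 + B * M1)), (Num.max M0 M1); split.
- have xl x y : `|x| <= B -> `|y * stein_sol y - x * stein_sol x| <= (M0 + B * M1) * `|y - x|.
    move=> xB.
    have -> : y * stein_sol y - x * stein_sol x =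
      (y - x) * stein_sol y + x * (stein_sol y - stein_sol x) by ring.
    rewrite (le_trans (ler_normD _ _))// !normrM mulrDl mulrC lerD//.
      by rewrite ler_wpM2r// -!normrM; exact: h0.
    rewrite -mulrA; apply: ler_pM => //; exact: fl.
  move=> x y.
  have -> : stein_sol' y - stein_sol' x = (g y - g x) + (y * stein_sol y - x * stein_sol x).
    rewrite /stein_sol'; ring.
  rewrite (le_trans (ler_normD _ _))// [leRHS]mulrDl lerD//.
  have [xB|/ltW xB] := leP `|x| B; first exact: xl.
  have [yB|/ltW yB] := leP `|y| B.
    by rewrite distrC (distrC y x); exact: xl.
  rewrite !stein_sol_supp// !mulr0 subrr normr0 mulr_ge0// addr_ge0// mulr_ge0// ltW//.
- by move=> x; rewrite le_max h0.
- by move=> x; rewrite le_max h1 orbT.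
Qed.

Lemma measurable_stein_sol : measurable_fun setT stein_sol.
Proof. exact: continuous_measurable_fun. Qed.

Lemma measurable_stein_sol' : measurable_fun setT stein_sol'.
Proof. exact: continuous_measurable_fun. Qed.

End solution.
End stein_solution.

(** * The normal distribution and the central limit theorem *)

Section std_normal.
Context (R : realType).
Notation mu := (@lebesgue_measure R).
Let phi : R -> R := normal_pdf 0 1.

Lemma normal_probE (A : set R) : fine (normal_prob 0 1 A) = \int[mu]_(x in A) phi x.
Proof. by []. Qed.

Let iphi A : measurable A -> mu.-integrable A (EFin \o phi).
Proof.
move=> mA; apply: (integrableS measurableT mA (@subsetT _ _)).
exact: (integrable_normal_pdf (0 : R) 1).
Qed.

Let c_phi : continuous phi.
Proof. by apply: continuous_normal_pdf; exact: oner_neq0. Qed.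

Lemma std_pdfN (x : R) : phi (- x) = phi x.
Proof. by rewrite /phi !std_pdfE sqrrN. Qed.

Lemma normal_cdf_continuous : continuous (@normal_cdf R).
Proof.
move=> x; apply/differentiable_continuous/derivable1_diffP.
have xx : x < x + 1 by rewrite ltrDl.
have mitv : measurable [set` `]-oo, x + 1]] by [].
by have [] := continuous_FTC1 xx (iphi mitv) (ltNyr x) (@c_phi x).
Qed.

Lemma normal_cdfN (x : R) : normal_cdf (- x) = 1 - normal_cdf x.
Proof.
have h1 : normal_cdf (- x) = \int[mu]_(t in `[x, +oo[) phi t.
  rewrite /normal_cdf normal_probE /Rintegral ge0_integration_by_substitutionNy.
  - by congr fine; apply: eq_integral => t _ /=; rewrite std_pdfN.
  - exact: continuous_subspaceT.
  - by move=> t _; exact: normal_pdf_ge0.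
have iT : mu.-integrable [set` Interval -oo%O +oo%O] (EFin \o phi).
  by apply: iphi.
have hx : (-oo <= BRight x)%O by [].
have hy : (BRight x <= +oo)%O by [].
have := Rintegral_itvB iT hx hy.
rewrite set_itvNyy.
have -> : \int[mu]_t phi t = 1.
  by rewrite -normal_probE probability_setT.
rewrite Rintegral_itv_obnd_cbnd; last exact: iphi.
by rewrite -h1 => <-.
Qed.

Lemma normal_cdf_itv (b : R) : 0 <= b ->
  fine (normal_prob 0 1 `[- b, b]) = 2 * normal_cdf b - 1.
Proof.
move=> b0; have bb : - b <= b by rewrite (@le_trans _ _ 0)// oppr_le0.
have iT : mu.-integrable [set` Interval -oo%O (BRight b)] (EFin \o phi).
  by apply: iphi.
have bb' : (BRight (- b) <= BRight b)%O by rewrite bnd_simp.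
have hx : (-oo <= BRight (- b))%O by [].
have := Rintegral_itvB iT hx bb'.
rewrite Rintegral_itv_obnd_cbnd; last exact: iphi.
rewrite -!normal_probE => <-.
rewrite -!/(normal_cdf _) normal_cdfN; ring.
Qed.

Lemma normal_cdf_le1 (x : R) : normal_cdf x <= 1.
Proof.
rewrite /normal_cdf -[leRHS]/(fine 1%:E) fine_le ?fin_num_measure//.
exact: probability_le1.
Qed.

Lemma normal_cdf0 : @normal_cdf R 0 = 1 / 2.
Proof. have := normal_cdfN 0; rewrite oppr0; lra. Qed.

Lemma normal_cdf_itv_cvg1 :
  fine (normal_prob 0 1 `[- (n%:R : R), n%:R]) @[n --> \oo] --> (1 : R).
Proof.
apply: fine_cvg; rewrite -(@probability_setT _ _ _ (normal_prob (0 : R) 1)).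
have -> : [set: R] = \bigcup_n [set` `[- (n%:R : R), n%:R]].
  apply/esym/seteqP; split => // x _.
  exists (Num.bound `|x|) => //=; rewrite in_itv /= -ler_norml.
  exact/ltW/archi_boundP.
apply: (@nondecreasing_cvg_mu _ _ _ (normal_prob (0 : R) 1)
  (fun n => [set` `[- (n%:R : R), n%:R]])) => //.
  exact: bigcup_measurable.
move=> m n mn; apply/subsetPset => x /=; rewrite !in_itv /= -!ler_norml => /le_trans; apply.
by rewrite ler_nat.
Qed.

(** The quantile is a chosen preimage, so existence suffices: the intermediate value theorem applies
    on [0, N] for large N, as Phi(0) = 1/2 and Phi(N) tends to 1. *)
Lemma normal_quantile_cdf (p : R) : 1 / 2 <= p < 1 ->
  normal_cdf (normal_quantile p) = p.
Proof.
move=> /andP[p12 p1].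
have [N _ /(_ N (leqnn _)) hN] :
    \forall n \near \oo, p < fine (normal_prob 0 1 `[- (n%:R : R), n%:R]).
  exact: (cvgr_gt _ normal_cdf_itv_cvg1 _ p1).
have pN : p <= normal_cdf (N%:R : R).
  rewrite normal_cdf_itv// in hN; have := normal_cdf_le1 (N%:R : R); lra.
have [c _ cp] : exists2 c : R, c \in `[0, N%:R] & normal_cdf c = p.
  apply: IVT => //; first exact/continuous_subspaceT/normal_cdf_continuous.
  rewrite normal_cdf0 ge_min p12 /= le_max pN orbT//.
by rewrite /normal_quantile; apply: (@xgetPex _ 0 [set x | normal_cdf x = p]); exists c.
Qed.

(** Makes the reference sample size, which is proportional to the squared quantile, a legitimate
    divisor. *)
Lemma normal_quantile_neq0 (p : R) : 1 / 2 < p < 1 -> normal_quantile p != 0.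
Proof.
move=> /andP[p12 p1]; apply/eqP => q0.
have := @normal_quantile_cdf p; rewrite q0 normal_cdf0 (ltW p12) p1 => /(_ isT) E.
by rewrite E ltxx in p12.
Qed.

(** Together with [int_le_normal_prob] this sandwiches an indicator between test functions, so that
    a limit theorem for tents passes to intervals. *)
Lemma normal_prob_le_int (A : set R) (h : R -> R) : measurable A ->
  mu.-integrable setT (EFin \o (fun x => h x * phi x)) -> (forall x, 0 <= h x) ->
  (forall x, A x -> 1 <= h x) -> fine (normal_prob 0 1 A) <= \int[mu]_x (h x * phi x).
Proof.
move=> mA ih h0 h1; rewrite normal_probE Rintegral_mkcond; apply: le_Rintegral => //.
  by rewrite -restrict_EFin; apply/integrable_restrict => //; rewrite setTI; exact: iphi.
move=> x _; rewrite /patch; case: ifPn => [xA|_].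
  by rewrite ler_peMl ?normal_pdf_ge0//; apply: h1; rewrite inE in xA.
by rewrite mulr_ge0// normal_pdf_ge0.
Qed.

Lemma int_le_normal_prob (A : set R) (h : R -> R) : measurable A ->
  mu.-integrable setT (EFin \o (fun x => h x * phi x)) -> (forall x, h x <= 1) ->
  (forall x, ~ A x -> h x = 0) -> \int[mu]_x (h x * phi x) <= fine (normal_prob 0 1 A).
Proof.
move=> mA ih h0 h1; rewrite normal_probE [leRHS]Rintegral_mkcond; apply: le_Rintegral => //.
  by rewrite -restrict_EFin; apply/integrable_restrict => //; rewrite setTI; exact: iphi.
move=> x _; rewrite /patch; case: ifPn => [xA|xA].
  by rewrite ler_piMl ?normal_pdf_ge0//; apply: h1; rewrite inE in xA.
by rewrite h1 ?mul0r//; move=> Ax; move/negP: xA; apply; rewrite inE.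
Qed.

End std_normal.

(** * The central limit theorem for symmetric intervals *)

Section clt.
Context d (Omega : measurableType d) (R : realType) (P : probability Omega R).
Notation leb := (@lebesgue_measure R).
Context (Y : nat -> {RV P >-> R}) (b : R).
Hypotheses (iY : indep_fam Y) (Y3 : forall i, L3 P (Y i))
  (EY1 : forall i, \int[P]_w Y i w = 0)
  (EY2 : forall i, \int[P]_w (Y i w ^+ 2) = 1)
  (EY3 : forall i, \int[P]_w (`|Y i w| ^+ 3) = b).
Let phi : R -> R := normal_pdf 0 1.
Let S n := sumX Y (index_iota 0 n).
Let W n w := S n w / Num.sqrt n%:R.

Lemma measurable_W n : measurable_fun setT (W n).
Proof. by apply: measurable_funM => //; exact: measurable_sumX. Qed.

Lemma cvg_div_sqrt (c : R) : (c / Num.sqrt n%:R) @[n --> \oo] --> (0 : R).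
Proof.
apply/cvgrPdist_lt => e e0; near=> n.
have n0 : 0 < n%:R :> R by rewrite ltr0n; near: n; exists 1%N.
have s0 : 0 < Num.sqrt n%:R :> R by rewrite sqrtr_gt0.
rewrite sub0r normrN normrM normfV (gtr0_norm s0) ltr_pdivrMr// -ltr_pdivrMl//.
rewrite -(ger0_norm (_ : 0 <= e^-1 * `|c|)); last by rewrite mulr_ge0// invr_ge0 ltW.
rewrite -sqrtr_sqr ltr_sqrt//.
by near: n; exact: nbhs_infty_gtr.
Unshelve. all: by end_near. Qed.

(** At the solution f of the Stein equation, x f(x) - f'(x) = - g(x), so [stein_bound] is directly a
    bound on the expectation of [g]. *)
Lemma clt_zero (g : R -> R) (B K : R) : lip K g ->
  (forall x, B <= `|x| -> g x = 0) -> 0 < B -> \int[leb]_x (g x * phi x) = 0 ->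
  (\int[P]_w g (W n w)) @[n --> \oo] --> (0 : R).
Proof.
move=> gl gs B0 g0.
have [K' [M [l1 l2 l3]]] := stein_sol_props gl gs B0 g0.
have h1 := stein_sol_der gl gs B0.
have m1 := measurable_stein_sol gl gs B0.
have m2 := measurable_stein_sol' gl gs B0.
apply/cvgrPdist_le => e e0; near=> n.
have n0 : (0 < n)%N by near: n; exists 1%N.
have := stein_bound iY Y3 EY1 EY2 EY3 h1 l1 m1 m2 l2 l3 n0.
rewrite sub0r normrN.
have -> : \int[P]_w (W n w * stein_sol g (W n w) - stein_sol' g (W n w)) =
  \int[P]_w (- 1 * g (W n w)).
  by apply: eq_Rintegral => w _; rewrite /stein_sol'; ring.
have ig : P.-integrable setT (EFin \o (fun w => g (W n w))).
  have [M' gM] := supp_bounded B0 (lip_continuous gl) gs.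
  apply: (@bounded_integrable _ _ _ _ _ _ M') => //.
    by apply: continuous_measurable_fun; exact: lip_continuous gl.
  exact: measurable_W.
rewrite RintegralZl// mulN1r normrN => /le_trans; apply.
have : `|0 - K' * (1 + 2 * b) / Num.sqrt n%:R| <= e.
  by near: n; move: e e0; apply/cvgrPdist_le; exact: cvg_div_sqrt.
by rewrite sub0r normrN; apply: le_trans; exact: ler_norm.
Unshelve. all: by end_near. Qed.

Let tent_int (a c : R) : a < c -> 0 < c ->
  leb.-integrable setT (EFin \o (fun x => tent a c x * phi x)).
Proof.
move=> ab b0.
exact: (integrable_supp_pdf (tent_lip ab) (fun x => @tent_eq0 _ a c x ab) b0).
Qed.

Let tent_P_int (a c : R) n : a < c ->
  P.-integrable setT (EFin \o (fun w => tent a c (W n w))).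
Proof.
move=> ab; apply: (@bounded_integrable _ _ _ _ _ _ 1) => //.
- by apply: continuous_measurable_fun; exact: (lip_continuous (tent_lip ab)).
- exact: measurable_W.
- by move=> x; rewrite ger0_norm ?tent_ge0// tent_le1.
Qed.

Lemma expectation_W2 n : (0 < n)%N -> \int[P]_w (W n w ^+ 2) = 1.
Proof.
move=> n0; have nR : 0 < n%:R :> R by rewrite ltr0n.
transitivity (\int[P]_w (n%:R^-1 * S n w ^+ 2)).
  by apply: eq_Rintegral => w _; rewrite /W exprMn exprVn sqr_sqrtr ?ltW// mulrC.
rewrite RintegralZl//; last exact/L3_integrable_sqr/L3_sumX.
by rewrite (expectation_S2 iY Y3 EY1 EY2) mulr1 mulVf// gt_eqF.
Qed.

(** Pointwise the tent is at least 1 - x^2 / A^2, and the second moment of [W n] is 1. *)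
Lemma plateau_expectation (A : R) n : 0 < A -> (0 < n)%N ->
  1 - A ^- 2 <= \int[P]_w tent A (A + 1) (W n w) <= 1.
Proof.
move=> A0 n0; have AA : A < A + 1 by rewrite ltrDl.
have iW2 : P.-integrable setT (EFin \o (fun w => A ^- 2 * W n w ^+ 2)).
  have := integrableZl measurableT (A ^- 2 * n%:R^-1)
    (L3_integrable_sqr (L3_sumX Y3 (index_iota 0 n))).
  apply: eq_integrable => // w _ /=; congr EFin.
  by rewrite /W /S exprMn exprVn sqr_sqrtr//; ring.
have iW2' : P.-integrable setT (EFin \o (fun w => W n w ^+ 2)).
  have := integrableZl measurableT (n%:R^-1)
    (L3_integrable_sqr (L3_sumX Y3 (index_iota 0 n))).
  apply: eq_integrable => // w _ /=; congr EFin.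
  by rewrite /W /S exprMn exprVn sqr_sqrtr//; ring.
have i1 := @integrable_RVcst _ _ _ P 1.
apply/andP; split; last first.
  rewrite -[leRHS](Rintegral_RVcst P 1); apply: le_Rintegral => //.
    exact: tent_P_int.
  by move=> w _; exact: tent_le1.
have -> : 1 - A ^- 2 = \int[P]_w (1 - A ^- 2 * W n w ^+ 2).
  rewrite (@RintegralB _ _ _ P setT (cst 1))// Rintegral_RVcst RintegralZl//.
  by rewrite expectation_W2// mulr1.
apply: le_Rintegral => //.
- by have := integrableB measurableT i1 iW2.
- exact: tent_P_int.
move=> w _; move: (W n w) => x.
have [xA|Ax] := leP `|x| A.
  rewrite tent_eq1// gerBl mulr_ge0 ?sqr_ge0// invr_ge0 sqr_ge0//.
apply: le_trans (tent_ge0 _ _ _); rewrite subr_le0.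
rewrite mulrC ler_pdivlMr ?exprn_gt0// mul1r -[leRHS]real_normK ?num_real//.
by rewrite lerXn2r ?nnegrE// ltW.
Qed.

(* Subtracting a multiple of a wide plateau makes the integral against phi
   vanish; the plateau itself has expectation close to 1 by Chebyshev. *)
Lemma clt_tent (a0 b0 : R) : 0 <= a0 -> a0 < b0 ->
  (\int[P]_w tent a0 b0 (W n w)) @[n --> \oo] --> \int[leb]_x (tent a0 b0 x * phi x).
Proof.
move=> a00 ab; have b00 : 0 < b0 by lra.
set I := \int[leb]_x (tent a0 b0 x * phi x).
have I0 : 0 <= I.
  by apply: Rintegral_ge0 => x _; rewrite mulr_ge0 ?tent_ge0// normal_pdf_ge0.
have I1 : I <= 1.
  apply: (@le_trans _ _ (fine (normal_prob (0 : R) 1 setT))); last by rewrite probability_setT.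
  by apply: int_le_normal_prob => //; [exact: tent_int|exact: tent_le1|move=> x []].
apply/cvgrPdist_le => e e0.
(* [eta <= 1 / 2] forces m >= 1 / 2, hence I / m <= 2; [eta <= e / 4] then keeps the error of the
   plateau below e / 2, the other half being left to [clt_zero]. *)
pose eta := Num.min (e / 4) (1 / 2).
have eta0 : 0 < eta by rewrite /eta lt_min; apply/andP; split; lra.
have eta1 : eta <= e / 4 by rewrite /eta ge_min lexx.
have eta2 : eta <= 1 / 2 by rewrite /eta ge_min lexx orbT.
have [N [N0 hN1 hN2]] : exists N : nat, [/\ (0 < N)%N, (N%:R : R) ^- 2 <= eta &
    1 - eta <= fine (normal_prob (0 : R) 1 `[- (N%:R : R), N%:R])].
  have h : 1 - eta < 1 by lra.
  near \oo%classic => N; exists N; split; first by near: N; exists 1%N.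
    have n0 : 0 < N%:R :> R by rewrite ltr0n; near: N; exists 1%N.
    rewrite -[leRHS]invrK lef_pV2 ?posrE ?exprn_gt0 ?invr_gt0//.
    apply: (@le_trans _ _ N%:R).
      by apply: ltW; near: N; exact: nbhs_infty_gtr.
    by rewrite -natrX ler_nat expnS leq_pmulr// expn1; near: N; exists 1%N.
  by apply: ltW; near: N; exact: (cvgr_gt _ (@normal_cdf_itv_cvg1 R) _ h).
have NR : 0 < N%:R :> R by rewrite ltr0n.
have NN : N%:R < N%:R + 1 :> R by rewrite ltrDl.
have NN0 : 0 < N%:R + 1 :> R by rewrite addr_gt0.
pose m := \int[leb]_x (tent N%:R (N%:R + 1) x * phi x).
have m1 : 1 - eta <= m.
  apply: (le_trans hN2); apply: normal_prob_le_int => //.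
  - exact: tent_int.
  - by move=> x; exact: tent_ge0.
  - by move=> x /=; rewrite in_itv /= -ler_norml => xN; rewrite tent_eq1.
have m2 : m <= 1.
  apply: (@le_trans _ _ (fine (normal_prob (0 : R) 1 setT))); last by rewrite probability_setT.
  by apply: int_le_normal_prob => //; [exact: tent_int|exact: tent_le1|move=> x []].
have m0 : 0 < m by lra.
pose g x := tent a0 b0 x - I / m * tent N%:R (N%:R + 1) x.
have gl := lipB (tent_lip ab) (lipZ (I / m) (tent_lip NN)).
have gs x : Num.max b0 (N%:R + 1) <= `|x| -> g x = 0.
  by rewrite ge_max => /andP[h1 h2]; rewrite /g !tent_eq0// mulr0 subr0.
have B0 : 0 < Num.max b0 (N%:R + 1) by rewrite lt_max b00.
have i1 := tent_int ab b00; have i2 := tent_int NN NN0.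
have i3 := integrableZl measurableT (I / m) i2.
have g0 : \int[leb]_x (g x * phi x) = 0.
  transitivity (\int[leb]_x (tent a0 b0 x * phi x - I / m * (tent N%:R (N%:R + 1) x * phi x))).
    by apply: eq_Rintegral => x _; rewrite /g; ring.
  rewrite RintegralB// RintegralZl// -/I -/m; field; rewrite gt_eqF//.
have cg := clt_zero gl gs B0 g0.
have e2 : 0 < e / 2 by rewrite divr_gt0.
move/cvgrPdist_le: cg => /(_ _ e2) cg.
near=> n.
have n0 : (0 < n)%N by near: n; exists 1%N.
have : `|0 - \int[P]_w g (W n w)| <= e / 2 by near: n; exact: cg.
have j1 := tent_P_int n ab; have j2 := tent_P_int n NN.
have j3 := integrableZl measurableT (I / m) j2.
rewrite /g (@RintegralB _ _ _ P setT (fun w => tent a0 b0 (W n w)))// RintegralZl//.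
have /andP[] := plateau_expectation NR n0.
move: (\int[P]_w _) (\int[P]_w _) => t h h1 h2.
have hm : `|h - m| <= eta by rewrite ler_norml; apply/andP; split; lra.
have Im : `|I / m * (h - m)| <= e / 2.
  rewrite normrM (ger0_norm (divr_ge0 I0 (ltW m0))).
  apply: (@le_trans _ _ (2 * eta)); last lra.
  apply: ler_pM => //; first by rewrite divr_ge0// ltW.
  rewrite ler_pdivrMr//; lra.
have -> : 0 - (t - I / m * h) = (I - t) + I / m * (h - m) by field; rewrite gt_eqF.
move=> h3; have -> : I - t = (I - t + I / m * (h - m)) - I / m * (h - m) by rewrite addrK.
by rewrite (le_trans (ler_normB _ _))// [leRHS]splitr lerD.
Unshelve. all: by end_near. Qed.

(** The indicator of the interval lies between two tents with ramps of width t on either side of x;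
    continuity of Phi at x closes the gap between their limits. *)
Lemma clt (x : R) : 0 < x ->
  fine (P [set w | `|W n w| < x]) @[n --> \oo] --> 2 * normal_cdf x - 1.
Proof.
move=> x0.
have mWx n : measurable [set w | `|W n w| < x].
  have -> : [set w | `|W n w| < x] = ~` [set w | x <= `|W n w|].
    by apply/seteqP; split => w /=; [move=> wx; apply/negP; rewrite -ltNge|move/negP; rewrite -ltNge].
  apply: measurableC; rewrite -[X in measurable X]setTI; apply: measurable_fun_le => //.
  by apply: measurableT_comp => //; exact: measurable_W.
have PE n : fine (P [set w | `|W n w| < x]) =
    \int[P]_w (\1_[set w | `|W n w| < x] w : R).
  by rewrite /Rintegral integral_indic// setIT.
have iE n : P.-integrable setT (EFin \o (\1_[set w | `|W n w| < x] : Omega -> R)).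
  by apply: integrable_indic => //; rewrite ltey_eq fin_num_measure.
apply/cvgrPdist_le => e e0.
have cF : {for x, continuous (@normal_cdf R)} := @normal_cdf_continuous R x.
(* Phi enters the limit with the factor 2, so e / 4 here leaves e / 2 for the convergence of the
   tents. *)
move/cvgrPdist_le: cF => /(_ (e / 4)); rewrite divr_gt0// => /(_ isT) /nbhs_ballP[r /= r0 hr].
near (0 : R)^'+ => t.
have t0 : 0 < t by near: t; exact: nbhs_right_gt.
have tx : t < x by near: t; exact: nbhs_right_lt.
have [cF1 cF2] : `|normal_cdf x - normal_cdf (x + t)| <= e / 4 /\
       `|normal_cdf x - normal_cdf (x - t)| <= e / 4.
  have tr : t < r by near: t; exact: nbhs_right_lt.
  split; apply: hr; rewrite /ball /=.
    by rewrite opprD addrA subrr add0r normrN gtr0_norm.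
  by rewrite opprB addrCA subrr addr0 gtr0_norm.
have ab1 : x < x + t by rewrite ltrDl.
have ab2 : x - t < x by rewrite ltrBlDr ltrDl.
have xt0 : 0 <= x - t by rewrite subr_ge0 ltW.
have c1 := clt_tent (ltW x0) ab1.
have c2 := clt_tent xt0 ab2.
have e4 : 0 < e / 2 by rewrite divr_gt0.
move/cvgrPdist_le: c1 => /(_ _ e4) c1.
move/cvgrPdist_le: c2 => /(_ _ e4) c2.
near=> n.
have h1 : `|\int[leb]_x0 (tent x (x + t) x0 * phi x0) - \int[P]_w tent x (x + t) (W n w)| <= e / 2.
  by near: n; exact: c1.
have h2 : `|\int[leb]_x0 (tent (x - t) x x0 * phi x0) - \int[P]_w tent (x - t) x (W n w)| <= e / 2.
  by near: n; exact: c2.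
have u1 : fine (P [set w | `|W n w| < x]) <= \int[P]_w tent x (x + t) (W n w).
  rewrite PE; apply: le_Rintegral => //; first exact: tent_P_int.
  move=> w _; rewrite indicE; case: (boolP (w \in _)) => [|_]; last exact: tent_ge0.
  by rewrite inE /= => wx; rewrite tent_eq1// ltW.
have u2 : \int[P]_w tent (x - t) x (W n w) <= fine (P [set w | `|W n w| < x]).
  rewrite PE; apply: le_Rintegral => //; first exact: tent_P_int.
  move=> w _; rewrite indicE; case: (boolP (w \in _)) => [_|]; first exact: tent_le1.
  by move=> /negP wx; rewrite tent_eq0// leNgt; apply/negP => ?; apply: wx; rewrite inE.
have xt : 0 < x + t by rewrite addr_gt0.
have v1 : \int[leb]_x0 (tent x (x + t) x0 * phi x0) <= 2 * normal_cdf (x + t) - 1.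
  rewrite -normal_cdf_itv ?(ltW xt)//; apply: int_le_normal_prob => //.
  - exact: tent_int.
  - exact: tent_le1.
  - move=> y /= /negP; rewrite in_itv /= -ler_norml -ltNge => yx; rewrite tent_eq0// ltW//.
have v2 : 2 * normal_cdf (x - t) - 1 <= \int[leb]_x0 (tent (x - t) x x0 * phi x0).
  rewrite -normal_cdf_itv//; apply: normal_prob_le_int => //.
  - exact: tent_int.
  - exact: tent_ge0.
  - by move=> y /=; rewrite in_itv /= -ler_norml => yx; rewrite tent_eq1.
move: h1 h2 cF1 cF2; rewrite !ler_norml => /andP[? ?] /andP[? ?] /andP[? ?] /andP[? ?].
apply/andP; split; lra.
Unshelve. all: by end_near. Qed.

End clt.

(** * Stopping at a fixed precision *)

Section stopping.
Context d (Omega : measurableType d) (R : realType) (P : probability Omega R).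
Context (D : nat -> set Omega) (N : nat -> nat) (J : nat).
Hypotheses (mD : forall k, measurable (D k)) (N_inc : forall k, (N k < N k.+1)%N).
Local Open Scope ereal_scope.

Definition first_at k := [set w | D k w /\ forall i, (i < k)%N -> ~ D i w].
Definition not_yet k := [set w | forall i, (i <= k)%N -> ~ D i w].
(** The rejection at the preceding stage; before the first stage the decision variable is 0, hence
    the whole space at position 0. *)
Definition prevC k := if k is k'.+1 then ~` D k' else setT.
Definition Nstep k : R := ((N k.+1)%:R - (N k)%:R)%R.
(** The union bound for an acceptance before stage [m], the price of treating the early stages as
    rejecting. *)
Definition accept_sum m := \sum_(0 <= i < m) P (D i).
(* The weights [N k.+1 >= 1] make the one series dominate both excess sample
   sizes and excess probabilities. *)
Definition reject_tail := \sum_(J <= k <oo) (N k.+1)%:R%:E * P (~` D k).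

Lemma Nstep_ge1 k : (1 <= Nstep k)%R.
Proof. by rewrite /Nstep -natrB ?(ltnW (N_inc k))// ler1n subn_gt0. Qed.

Lemma Nstep_ge0 k : (0 <= Nstep k)%R.
Proof. exact: le_trans (Nstep_ge1 k). Qed.

Lemma sum_Nstep m : (\sum_(0 <= k < m) Nstep k = (N m)%:R - (N 0%N)%:R)%R.
Proof. by rewrite -(@telescope_sumr _ 0%N m (fun k => (N k)%:R%R)). Qed.

Lemma N_ge k : (k <= N k)%N.
Proof. by elim: k => // k IH; exact: leq_ltn_trans (N_inc k). Qed.

Lemma measurable_not_yet k : measurable (not_yet k).
Proof.
have -> : not_yet k = \bigcap_(i in `I_k.+1) ~` D i by [].
apply: fin_bigcap_measurable; first exact: finite_II.
by move=> i _; exact: measurableC.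
Qed.

Lemma measurable_first_at k : measurable (first_at k).
Proof.
have -> : first_at k = D k `&` \bigcap_(i in `I_k) ~` D i by [].
apply: measurableI => //; apply: fin_bigcap_measurable; first exact: finite_II.
by move=> i _; exact: measurableC.
Qed.

Lemma measurable_prevC k : measurable (prevC k).
Proof. by case: k => [|k] //=; exact: measurableC. Qed.

(** The common form of the comparisons of events below: apart from an acceptance before stage [m],
    the event [A] implies [B]. *)
Lemma measure_setD_accept (A B : set Omega) m : measurable A -> measurable B ->
  (forall w, A w -> ~ B w -> exists2 i, (i < m)%N & D i w) ->
  P A <= P B + accept_sum m.
Proof.
move=> mA mB AB.
have mU : measurable (\big[setU/set0]_(i < m) D i).
  by apply: bigsetU_measurable => i _.
apply: (@le_trans _ _ (P (B `|` \big[setU/set0]_(i < m) D i))).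
  apply: le_measure; rewrite ?inE//; first exact: measurableU.
  move=> w Aw; have [Bw|nBw] := pselect (B w); first by left.
  by right; have [i im Di] := AB w Aw nBw; rewrite -bigcup_mkord; exists i.
rewrite (le_trans (measureU2 _ _ _))// leeD2l// /accept_sum big_mkord.
by apply: Boole_inequality => i _.
Qed.

Lemma accept_sum_ge0 m : 0 <= accept_sum m.
Proof. exact: sume_ge0. Qed.

Lemma accept_sum_fin m : accept_sum m \is a fin_num.
Proof.
rewrite sum_fin_num; apply/allP => x /mapP[i _ ->].
exact: fin_num_measure.
Qed.

Lemma accept_sum_le m m' : (m <= m')%N -> accept_sum m <= accept_sum m'.
Proof.
by move=> mm; rewrite /accept_sum (big_cat_nat (leq0n m) mm)/= leeDl// sume_ge0.
Qed.

Lemma not_yet_le k : P (not_yet k) <= P (~` D k).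
Proof.
apply: le_measure; rewrite ?inE; [exact: measurable_not_yet|exact: measurableC|].
by move=> w; apply.
Qed.

Lemma rejectC_le k : P (~` D k) <= P (not_yet k) + accept_sum k.
Proof.
apply: measure_setD_accept; [exact: measurableC|exact: measurable_not_yet|].
move=> w Dk /existsNP[i /not_implyP[ik /contrapT Di]]; exists i => //.
(* Stage [k] itself rejects on the event considered, so the sum stops before [k]; this is why stage
   J - 1 is not charged in the bounds with [accept_sum J.-1]. *)
by rewrite ltn_neqAle ik andbT; apply/eqP => ki; apply: Dk; rewrite -ki.
Qed.

Lemma not_yet_ge k : 1 - accept_sum k.+1 <= P (not_yet k).
Proof.
rewrite leeBlDr ?accept_sum_fin// -(@probability_setT _ _ _ P).
apply: measure_setD_accept => //; first exact: measurable_not_yet.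
by move=> w _ /existsNP[i /not_implyP[ik /contrapT Di]]; exists i.
Qed.

(** * Expected sample size *)

Section expected_size.
Context (size_ : Omega -> \bar R).
Hypotheses (size_first : forall k w, first_at k w -> size_ w = (N k)%:R%:E)
  (size_never : forall w, (forall k, ~ D k w) -> size_ w = +oo).

Lemma first_at_or_never w : (exists k, first_at k w) \/ (forall k, ~ D k w).
Proof.
have [[k Dk]|/forallNP] := pselect (exists k, D k w); last by right.
left; pose Q k := `[< D k w >].
have exQ : exists k, Q k by exists k; apply/asboolP.
case: (ex_minnP exQ) => m /asboolP Dm mmin; exists m; split => // i im Di.
by have := mmin i; rewrite leqNgt im => /(_ (introT (asboolP _) Di)).
Qed.

(** Each stage passed without stopping adds its increment, so the sum telescopes to [N m] when stage
    [m] is the first to accept. If no stage accepts, both sides are infinite, as [N k >= k]. *)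
Lemma size_series w :
  size_ w = (N 0)%:R%:E + \sum_(k <oo) (Nstep k)%:E * (\1_(not_yet k) w)%:E.
Proof.
have ge0 k : 0 <= (Nstep k)%:E * (\1_(not_yet k) w)%:E.
  by rewrite mule_ge0 ?lee_fin ?Nstep_ge0.
have [[m fm]|never] := first_at_or_never w.
  rewrite (size_first fm) (@nneseries_split _ _ 0%N m)// add0n.
  rewrite (@eq_big_nat _ _ _ _ _ _ (fun k => (Nstep k)%:E)); last first.
    move=> k /andP[_ km]; rewrite indicE mem_set ?mule1//= => i ik.
    by apply: fm.2; exact: leq_ltn_trans km.
  rewrite sumEFin sum_Nstep eseries0 ?adde0//; last first.
    move=> k mk _; rewrite indicE memNset ?mule0// => /(_ m mk).
    by apply; exact: fm.1.
  by rewrite -EFinD addrC subrK.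
rewrite size_never//; apply/esym/eq_infty => A; rewrite -leeBlDl//.
apply: (@le_trans _ _ (\sum_(0 <= k < Num.bound A) (Nstep k)%:E * (\1_(not_yet k) w)%:E)).
  rewrite (eq_bigr (fun k => (Nstep k)%:E)); last first.
    by move=> k _; rewrite indicE mem_set ?mule1// => i _; exact: never.
  rewrite sumEFin sum_Nstep -EFinB lee_fin lerD2r.
  apply: (@le_trans _ _ (Num.bound A)%:R%R); last by rewrite ler_nat N_ge.
  have [A0|A0] := leP 0%R A; first exact/ltW/archi_boundP.
  by rewrite (le_trans (ltW A0)).
exact: nneseries_lim_ge.
Qed.

(** Reduces each bound on the expectation to a bound on the probabilities of [not_yet], which are
    then compared with those of rejection at a single stage. *)
Lemma expected_size_series : \int[P]_w size_ w =
  (N 0)%:R%:E + \sum_(k <oo) (Nstep k)%:E * P (not_yet k).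
Proof.
have mi k : measurable_fun setT (fun w => (\1_(not_yet k) w : R)%:E).
  apply/measurable_EFinP; apply: measurable_indic; exact: measurable_not_yet.
have mf k : measurable_fun setT (fun w => (Nstep k)%:E * (\1_(not_yet k) w)%:E).
  exact: measurable_funeM.
have ge0 k w : 0 <= (Nstep k)%:E * (\1_(not_yet k) w)%:E.
  by rewrite mule_ge0 ?lee_fin ?Nstep_ge0.
under eq_integral do rewrite size_series.
rewrite ge0_integralD//; last 2 first.
- by move=> w _; apply: nneseries_ge0 => k _ _.
- by apply: ge0_emeasurable_sum => // k w _ _.
have eP (c : R) : \int[P]__ c%:E = c%:E.
  transitivity (c%:E * P setT); last by rewrite probability_setT mule1.
  exact: (@integral_cst _ _ _ P setT measurableT c%:E).
rewrite eP integral_nneseries//.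
congr (_ + _); apply: eq_eseriesr => k _.
rewrite ge0_integralZl// ?lee_fin ?Nstep_ge0//.
by rewrite integral_indic ?setIT//; exact: measurable_not_yet.
Qed.

Let ge0 (A : nat -> set Omega) k : 0 <= (Nstep k)%:E * P (A k).
Proof. by rewrite mule_ge0 ?lee_fin ?Nstep_ge0. Qed.

Lemma expected_size_le_bound : \int[P]_w size_ w <=
  (N 0)%:R%:E + \sum_(k <oo) (Nstep k)%:E * P (~` D k).
Proof.
rewrite expected_size_series leeD2l//; apply: lee_nneseries => [k _ _|k _]; first exact: ge0.
by rewrite lee_wpmul2l ?lee_fin ?Nstep_ge0//; exact: not_yet_le.
Qed.

Lemma tail_le_reject_tail (A : nat -> set Omega) : (forall k, measurable (A k)) ->
  (forall k, A k `<=` ~` D k) ->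
  \sum_(J <= k <oo) (Nstep k)%:E * P (A k) <= reject_tail.
Proof.
move=> mA AD; apply: lee_nneseries => [k _ _|k _]; first exact: ge0.
apply: lee_pmul; rewrite ?lee_fin ?Nstep_ge0//.
  by rewrite /Nstep gerBl.
by apply: le_measure => //; rewrite inE//; exact: measurableC.
Qed.

Lemma expected_size_le : \int[P]_w size_ w <= (N J)%:R%:E + reject_tail.
Proof.
rewrite expected_size_series (@nneseries_split _ _ 0%N J); last by move=> k _; exact: ge0.
rewrite add0n addeA; apply: leeD; last first.
  by apply: tail_le_reject_tail => [k|k w]; [exact: measurable_not_yet|apply].
apply: (@le_trans _ _ ((N 0)%:R%:E + \sum_(0 <= k < J) (Nstep k)%:E)).
  rewrite leeD2l//; apply: lee_sum => k _.
  by rewrite -[leRHS]mule1 lee_wpmul2l ?lee_fin ?Nstep_ge0//; exact/probability_le1/measurable_not_yet.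
by rewrite sumEFin sum_Nstep -EFinD addrC subrK.
Qed.

(** Each of the first [m] terms of the series has probability at least [1 - accept_sum m], and their
    increments lead from [N 0] to [N m]; the rest of the series is dropped. *)
Lemma expected_size_ge m : (N m)%:R%:E * (1 - accept_sum m) <= \int[P]_w size_ w.
Proof.
rewrite expected_size_series.
apply: (@le_trans _ _ ((N 0)%:R%:E + \sum_(0 <= k < m) (Nstep k)%:E * P (not_yet k))); last first.
  by rewrite leeD2l//; apply: nneseries_lim_ge => k _ _; exact: ge0.
apply: (@le_trans _ _ ((N 0)%:R%:E + \sum_(0 <= k < m) (Nstep k)%:E * (1 - accept_sum m))).
  have /fineK E := accept_sum_fin m; rewrite -E.
  have a0 : (0 <= fine (accept_sum m))%R by rewrite fine_ge0// accept_sum_ge0.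
  under eq_bigr do rewrite -EFinB -EFinM.
  rewrite sumEFin -EFinB -EFinM -EFinD lee_fin -mulr_suml sum_Nstep.
  have : (0 <= (N 0)%:R * fine (accept_sum m))%R by rewrite mulr_ge0.
  lra.
rewrite leeD2l// big_nat [leRHS]big_nat; apply: lee_sum => k /andP[_ km].
rewrite lee_wpmul2l ?lee_fin ?Nstep_ge0//; apply: le_trans (not_yet_ge k).
by rewrite leeB// accept_sum_le.
Qed.

(** For k < J, replacing rejection at stage k by [not_yet k] costs [accept_sum k], and k <= J - 1;
    the increments of these stages sum to at most [N J]. From J on, all terms are put into
    [reject_tail]. *)
Lemma bound_le_expected_size :
  (N 0)%:R%:E + \sum_(k <oo) (Nstep k)%:E * P (~` D k) <=
  \int[P]_w size_ w + (N J)%:R%:E * accept_sum J.-1 + reject_tail.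
Proof.
rewrite expected_size_series (@nneseries_split _ _ 0%N J); last by move=> k _; exact: (ge0 (fun k => ~` D k)).
rewrite add0n addeA; apply: leeD; last first.
  by apply: (tail_le_reject_tail (A := fun k => ~` D k)) => k; [exact: measurableC|exact: subset_refl].
rewrite -addeA leeD2l//.
apply: (@le_trans _ _ (\sum_(0 <= k < J) ((Nstep k)%:E * P (not_yet k) + (Nstep k)%:E * accept_sum J.-1))).
  rewrite big_nat [leRHS]big_nat; apply: lee_sum => k /andP[_ kJ].
  rewrite -ge0_muleDr ?accept_sum_ge0// lee_wpmul2l ?lee_fin ?Nstep_ge0//.
  rewrite (le_trans (rejectC_le k))// leeD2l// accept_sum_le//.
  by rewrite -ltnS prednK// (leq_ltn_trans _ kJ).
rewrite big_split/=; apply: leeD.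
  by apply: nneseries_lim_ge => k _ _; exact: ge0.
rewrite -ge0_sume_distrl; last by move=> k _; rewrite lee_fin Nstep_ge0.
rewrite sumEFin sum_Nstep lee_wpmul2r ?accept_sum_ge0// lee_fin gerBl//.
Qed.

End expected_size.

(** * Events at the stopping stage *)

Section coverage.
Context (C : nat -> set Omega).
Hypothesis mC : forall k, measurable (C k).

Definition stop_in (A : nat -> set Omega) := \bigcup_k (first_at k `&` A k).

Lemma measurable_stop_in A : (forall k, measurable (A k)) -> measurable (stop_in A).
Proof.
move=> mA; apply: bigcup_measurable => k _.
by apply: measurableI => //; exact: measurable_first_at.
Qed.

(** Only the preceding decision is recorded, so candidates of different stages can occur together;
    this overlap is what separates the sum of their probabilities from that of [stop_in C]. *)
Definition candidate k := C k `&` prevC k `&` D k.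

Lemma measurable_candidate k : measurable (candidate k).
Proof. by apply: measurableI => //; apply: measurableI => //; exact: measurable_prevC. Qed.

Lemma stop_in_le : P (stop_in C) <= \sum_(k <oo) P (candidate k).
Proof.
apply: measure_sigma_subadditive => //.
- exact: measurable_candidate.
- exact: measurable_stop_in.
- move=> w [k _ [[Dk h] Ck]]; exists k => //; split => //; split => //.
  by case: k Dk h Ck => //= k _ h _; exact: h.
Qed.

Lemma trivIset_first_at (A : nat -> set Omega) :
  trivIset setT (fun k => first_at k `&` A k).
Proof.
apply/trivIsetP => i k _ _; wlog ik : i k / (i < k)%N => [H|_].
  rewrite neq_ltn => /orP[] ik; first by apply: H => //; rewrite ltn_eqF.
  by rewrite setIC; apply: H => //; rewrite ltn_eqF.
apply/seteqP; split => // w [[[Di _] _] [[_ h] _]]; exact: (h i ik Di).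
Qed.

Lemma candidate_tail_le k : (J < k)%N -> P (candidate k) <= (N k)%:R%:E * P (~` D k.-1).
Proof.
case: k => // k Jk; apply: (@le_trans _ _ (P (~` D k))).
  apply: le_measure; rewrite ?inE; [exact: measurable_candidate|exact: measurableC|].
  by move=> w [[_ ]].
rewrite -[leLHS]mul1e lee_wpmul2r// lee_fin ler1n (leq_ltn_trans _ (N_inc k))//.
Qed.

(** A candidate of stage k <= J that is not the first acceptance has an acceptance before k, and not
    at k - 1, which rejects: hence [accept_sum J.-1] for each of J + 1 stages. Beyond J a candidate
    forces the rejection at k - 1, a term of [reject_tail]. *)
Lemma candidates_le :
  \sum_(k <oo) P (candidate k) <= P (stop_in C) + (J.+1)%:R%:E * accept_sum J.-1 + reject_tail.
Proof.
rewrite (@nneseries_split _ _ 0%N J.+1)// add0n; apply: leeD; last first.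
  rewrite -[leLHS](@nneseries_addn _ _ J.+1)// /reject_tail.
  rewrite -(@nneseries_addn _ (fun k => (N k.+1)%:R%:E * P (~` D k)) J)//; last first.
    by move=> k; rewrite mule_ge0.
  apply: lee_nneseries => // k _.
  by rewrite (le_trans (candidate_tail_le _))// addnS ?ltnS ?leq_addl.
have -> : P (stop_in C) = \sum_(k <oo) P (first_at k `&` C k).
  rewrite /stop_in measure_semi_bigcup//.
  - by move=> k; apply: measurableI => //; exact: measurable_first_at.
  - exact: trivIset_first_at.
  - exact: measurable_stop_in.
apply: (@le_trans _ _ (\sum_(0 <= k < J.+1) (P (first_at k `&` C k) + accept_sum J.-1))).
  rewrite big_nat [leRHS]big_nat; apply: lee_sum => k /andP[_ kJ].
  apply: (@le_trans _ _ (P (first_at k `&` C k) + accept_sum k.-1)); last first.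
    by rewrite leeD2l// accept_sum_le// -!subn1 leq_sub2r.
  apply: measure_setD_accept; [exact: measurable_candidate|by apply: measurableI => //; exact: measurable_first_at|].
  move=> w [[Ck pk] Dk] nf.
  have : ~ (forall i, (i < k)%N -> ~ D i w) by move=> h; apply: nf.
  move=> /existsNP[i /not_implyP[ik /contrapT Di]]; exists i => //.
  case: k {nf Ck Dk kJ} pk ik => // k /= Dk; rewrite ltnS leq_eqVlt => /orP[/eqP ik|//].
  by exfalso; apply: Dk; rewrite -ik.
rewrite big_split/=; apply: leeD; first exact: nneseries_lim_ge.
have /fineK <- := accept_sum_fin J.-1.
by rewrite sumEFin -EFinM lee_fin sumr_const_nat subn0 mulr_natl.
Qed.

Definition min_series := \sum_(k <oo)
  Order.min (P (C k)) (Order.min (P (prevC k)) (P (D k))).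

Lemma candidates_le_min_series : \sum_(k <oo) P (candidate k) <= min_series.
Proof.
apply: lee_nneseries => // k _; rewrite !le_min.
by apply/and3P; split; apply: le_measure; rewrite ?inE//;
  try exact: measurable_candidate; try exact: measurable_prevC; move=> w [[]].
Qed.

(** A different entry of the minimum is used in each range: acceptance before J, the event [C J] at
    J, and the preceding rejection after J. *)
Lemma min_series_le : min_series <= P (C J) + accept_sum J + reject_tail.
Proof.
have m0 k : 0 <= Order.min (P (C k)) (Order.min (P (prevC k)) (P (D k))).
  by rewrite !le_min !measure_ge0.
rewrite /min_series (@nneseries_split _ _ 0%N J.+1)// add0n; apply: leeD; last first.
  rewrite -[leLHS](@nneseries_addn _ _ J.+1)// /reject_tail.
  rewrite -(@nneseries_addn _ (fun k => (N k.+1)%:R%:E * P (~` D k)) J)//; last first.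
    by move=> k; rewrite mule_ge0.
  apply: lee_nneseries => // k _; rewrite addnS ge_min; apply/orP; right.
  rewrite ge_min; apply/orP; left => /=; rewrite -[leLHS]mul1e lee_wpmul2r// lee_fin ler1n.
  exact: leq_ltn_trans (N_inc _).
rewrite big_nat_recr//= addeC; apply: leeD; first by rewrite ge_min lexx.
by apply: lee_sum => k _; rewrite !ge_min lexx !orbT.
Qed.

(** Without an acceptance before J and with acceptance at J, the stopping stage is J. Together with
    [stop_in_le2] this replaces the event at the random stage by the one at stage J. *)
Lemma stop_in_ge : P (C J) <= P (stop_in C) + accept_sum J + P (~` D J).
Proof.
have mUD : measurable (stop_in C `|` ~` D J).
  by apply: measurableU; [exact: measurable_stop_in|exact: measurableC].
apply: (@le_trans _ _ (P (stop_in C `|` ~` D J) + accept_sum J)).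
  apply: measure_setD_accept => // w CJ /not_orP[nS /contrapT DJ].
  have : ~ (forall i, (i < J)%N -> ~ D i w) by move=> h; apply: nS; exists J.
  by move=> /existsNP[i /not_implyP[ik /contrapT Di]]; exists i.
rewrite addeAC; apply: leeD => //; apply: measureU2; first exact: measurable_stop_in.
exact: measurableC.
Qed.

Lemma stop_in_le2 : P (stop_in C) <= P (C J) + accept_sum J + P (~` D J).
Proof.
have mUD : measurable (C J `|` ~` D J) by apply: measurableU => //; exact: measurableC.
apply: (@le_trans _ _ (P (C J `|` ~` D J) + accept_sum J)).
  apply: measure_setD_accept => //; first exact: measurable_stop_in.
  move=> w [k _ [[Dk h] Ck]] /not_orP[nC /contrapT DJ].
  exists k => //; rewrite ltn_neqAle; apply/andP; split.
    by apply/eqP => kJ; apply: nC; rewrite -kJ.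
  by rewrite leqNgt; apply/negP => Jk; exact: (h J Jk DJ).
by rewrite addeAC; apply: leeD => //; apply: measureU2 => //; exact: measurableC.
Qed.

(** Acceptance at J - 1 is not charged as an error; instead [C J.-1] joins the bound, so only the
    stages before J - 1 have to reject. *)
Lemma stop_in_le3 : (0 < J)%N ->
  P (stop_in C) <= P (C J.-1) + P (C J) + accept_sum J.-1 + P (~` D J).
Proof.
move=> J0.
have mCC : measurable (C J.-1 `|` C J) by apply: measurableU.
have mUD : measurable ((C J.-1 `|` C J) `|` ~` D J).
  by apply: measurableU => //; exact: measurableC.
apply: (@le_trans _ _ (P ((C J.-1 `|` C J) `|` ~` D J) + accept_sum J.-1)).
  apply: measure_setD_accept => //; first exact: measurable_stop_in.
  move=> w [k _ [[Dk h] Ck]] /not_orP[/not_orP[nC1 nC2] /contrapT DJ].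
  have kJ : (k <= J)%N by rewrite leqNgt; apply/negP => Jk; exact: (h J Jk DJ).
  have kJ' : k != J by apply/eqP => kJ'; apply: nC2; rewrite -kJ'.
  have kJ'' : k != J.-1 by apply/eqP => kJ''; apply: nC1; rewrite -kJ''.
  exists k => //; rewrite ltn_neqAle kJ'' -ltnS prednK// ltn_neqAle kJ' kJ//.
rewrite addeAC; apply: leeD => //.
rewrite (le_trans (measureU2 _ _ _))//; first exact: measurableC.
by apply: leeD => //; exact: measureU2.
Qed.

End coverage.

Definition never := [set w | forall k, ~ D k w].

Lemma measurable_never : measurable never.
Proof.
have -> : never = \bigcap_k ~` D k.
  by apply/seteqP; split => w h k; [move=> _; exact: h|exact: (h k Logic.I)].
by apply: bigcapT_measurable => k; exact: measurableC.
Qed.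

Lemma setC_stop_in (A : nat -> set Omega) :
  ~` stop_in A = stop_in (fun k => ~` A k) `|` never.
Proof.
apply/seteqP; split => w.
  move=> h; have [[k fk]|nv] := first_at_or_never w; last by right.
  by left; exists k => //; split => // Ak; apply: h; exists k.
move=> [[k _ [fk nA]]|nv] [i _ [fi Ai]]; last exact: (nv i fi.1).
have [ik|ki|ik] := ltngtP i k.
- exact: (fk.2 i ik fi.1).
- exact: (fi.2 k ki fk.1).
- by apply: nA; rewrite -ik.
Qed.

End stopping.

(** * Integer stages counted from the starting index *)

Lemma int_min_eq (A : set int) (l : int) : A l -> lbound A l -> int_min A = Some l.
Proof.
move=> Al lA; rewrite /int_min.
have [l' [Al' lA'] <-] : [set Some l | l in A `&` lbound A]
    (xget None [set Some l | l in A `&` lbound A]).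
  by apply: xgetPex; exists (Some l); exists l.
by congr Some; apply/eqP; rewrite eq_le lA'// lA.
Qed.

Lemma int_min_empty (A : set int) : (forall l, ~ A l) -> int_min A = None.
Proof.
by move=> A0; rewrite /int_min xgetPN// => x [l [Al _]] _; exact: (A0 l).
Qed.

Section stage_indexing.
Context d (Omega : measurableType d) (R : realType) (P : probability Omega R).
Context (t : int) (D : int -> set Omega) (n : int -> nat)
  (I : int -> Omega -> set R) (mu : R).
Hypothesis D_early : forall l, l < t -> D l = set0.

Definition stageD (k : nat) := D (t + k%:Z).
Definition stageN (k : nat) := n (t + k%:Z).
Definition stageI (k : nat) := [set w | I (t + k%:Z) w mu].

Lemma stage_of (l : int) : t <= l -> exists k : nat, l = t + k%:Z.
Proof.
rewrite -subr_ge0 => h; exists `|l - t|%N.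
rewrite gez0_abs//; ring.
Qed.

Lemma stop_index_first k w : first_at stageD k w ->
  stop_index t D w = Some (t + k%:Z).
Proof.
move=> [Dk h]; apply: int_min_eq; first by split => //; rewrite lerDl.
move=> l [tl Dl]; have [i E] := stage_of tl; rewrite E lerD2l lez_nat leqNgt.
by apply/negP => ik; apply: (h i ik); rewrite /stageD -E.
Qed.

Lemma stop_index_never w : (forall k, ~ stageD k w) -> stop_index t D w = None.
Proof.
move=> nv; apply: int_min_empty => l [tl Dl]; have [i E] := stage_of tl.
by apply: (nv i); rewrite /stageD -E.
Qed.

Lemma stop_size_first k w : first_at stageD k w ->
  stop_size R t D n w = (stageN k)%:R%:E.
Proof. by move=> f; rewrite /stop_size (stop_index_first f). Qed.

Lemma stop_size_never w : (forall k, ~ stageD k w) -> stop_size R t D n w = +oo%E.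
Proof. by move=> f; rewrite /stop_size stop_index_never. Qed.

Lemma stop_index_ext_first k w : first_at stageD k w ->
  stop_index_ext R t D w = (t + k%:Z)%:~R%:E.
Proof. by move=> f; rewrite /stop_index_ext (stop_index_first f). Qed.

Lemma stop_index_ext_never w : (forall k, ~ stageD k w) ->
  stop_index_ext R t D w = +oo%E.
Proof. by move=> f; rewrite /stop_index_ext stop_index_never. Qed.

Lemma stop_index_ext_gt (m : nat) :
  [set w | ((t + m%:Z)%:~R%:E < stop_index_ext R t D w)%E] = not_yet stageD m.
Proof.
apply/seteqP; split => w /=.
  have [[k fk]|nv] := first_at_or_never stageD w; last by move=> _ i _; exact: nv.
  rewrite (stop_index_ext_first fk) lte_fin ltr_int ltrD2l ltz_nat => mk i im.
  by apply: fk.2; exact: leq_ltn_trans mk.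
have [[k fk]|nv] := first_at_or_never stageD w; last first.
  by move=> _; rewrite (stop_index_ext_never nv) ltry.
move=> nm; rewrite (stop_index_ext_first fk) lte_fin ltr_int ltrD2l ltz_nat ltnNge.
by apply/negP => km; exact: (nm k km fk.1).
Qed.

Lemma stop_index_ext_gt_early (l : int) : l < t ->
  [set w | (l%:~R%:E < stop_index_ext R t D w)%E] = setT.
Proof.
move=> lt; apply/seteqP; split => // w _ /=.
have [[k fk]|nv] := first_at_or_never stageD w; last first.
  by rewrite (stop_index_ext_never nv) ltry.
by rewrite (stop_index_ext_first fk) lte_fin ltr_int (lt_le_trans lt)// lerDl.
Qed.

Lemma covered_stop_in :
  [set w | stop_interval t D I w mu] = stop_in stageD stageI.
Proof.
apply/seteqP; split => w /=; rewrite /stop_interval.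
  have [[k fk]|nv] := first_at_or_never stageD w; last by rewrite stop_index_never.
  by rewrite (stop_index_first fk) => Iw; exists k.
by move=> [k _ [fk Ik]]; rewrite (stop_index_first fk).
Qed.

Lemma prevC_stage k : prevC stageD k = ~` D (t + k%:Z - 1).
Proof.
case: k => [|k] /=; first by rewrite addr0 D_early ?setC0// ltrBlDr ltrDl.
by rewrite /stageD -addn1 PoszD addrA addrK.
Qed.

Lemma candidateE (C : nat -> set Omega) k :
  candidate stageD C k = C k `&` ~` D (t + k%:Z - 1) `&` D (t + k%:Z).
Proof. by rewrite /candidate prevC_stage. Qed.

Lemma P_upperE : P_upper P t D I mu =
  (\sum_(k <oo) P (candidate stageD (fun k => ~` stageI k) k))%E.
Proof. by apply: eq_eseriesr => k _; rewrite candidateE. Qed.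

Lemma P_lowerE : P_lower P t D I mu =
  (1 - \sum_(k <oo) P (candidate stageD stageI k))%E.
Proof. by congr (_ - _)%E; apply: eq_eseriesr => k _; rewrite candidateE. Qed.

Lemma Q_boundE : Q_bound P t D I mu = min_series P stageD (fun k => ~` stageI k).
Proof. by apply: eq_eseriesr => k _; rewrite prevC_stage. Qed.

Lemma size_boundE : size_bound P t D n = ((stageN 0)%:R%:E +
  \sum_(k <oo) (Nstep R stageN k)%:E * P (~` stageD k))%E.
Proof.
rewrite /size_bound /stageN addr0; congr (_ + _)%E; apply: eq_eseriesr => k _.
by rewrite /Nstep /stageN -addn1 PoszD addrA.
Qed.

End stage_indexing.

(** * Sample means of an i.i.d. sequence *)

Section sample_mean_limits.
Context d (Omega : measurableType d) (R : realType) (P : probability Omega R).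
Context (X : nat -> {RV P >-> R}) (law : probability R R) (mu nu : R).
Hypotheses (X_iid : iid_with_law X law) (nu_gt0 : 0 < nu)
  (law_mean : ('E_law[idfun] = mu%:E)%E) (law_var : fine 'V_law[idfun] = nu)
  (law_moment3 : ('E_law[fun x : R => (`|x| ^+ 3)%R] < +oo)%E).

Lemma iid_indep_fam : indep_fam X.
Proof.
move=> r A ur mA; have [_ /(_ [fset i in r]%fset A mA)] := X_iid.
have -> : \bigcap_(i in [set` [fset i in r]%fset]) (X i @^-1` A i) = cyl X r A.
  by apply: eq_bigcapl; split => i /=; rewrite !inE.
move=> ->; apply: perm_big; apply: uniq_perm => [||i] //.
by rewrite !inE.
Qed.

Lemma L3_law : L3 law (idfun : R -> R).
Proof.
split; first exact: measurable_id.
apply/integrableP; split.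
  by apply/measurable_EFinP; apply: measurable_funX.
move: law_moment3; rewrite unlock; congr (_ < _)%E.
by apply: eq_integral => x _ /=; rewrite normrX normr_id.
Qed.

Let sg := Num.sqrt nu.
Let sg0 : 0 < sg. Proof. by rewrite sqrtr_gt0. Qed.
Let std (x : R) : R := (x - mu) / sg.

Let m_std : measurable_fun setT std.
Proof. by apply: measurable_funM => //; exact: measurable_funB. Qed.

Let mY i : measurable_fun setT (std \o X i).
Proof. exact: measurableT_comp. Qed.

Definition stdX (i : nat) : {RV P >-> R} := mfun_Sub (mem_set (mY i)).

Lemma L3_std : L3 law std.
Proof.
split; first exact: m_std.
have := (L3D L3_law (L3_cst law (- mu))).2.
move=> /(integrableZl measurableT (sg^-1 ^+ 3)).
apply: eq_integrable => // x _ /=; congr EFin.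
by rewrite /std normrM normfV (gtr0_norm sg0) exprMn mulrC.
Qed.

(** Moments of [X i] are read off the common law, which makes them the same for all [i], as the
    lemmas on partial sums require. *)
Lemma law_transfer i (g : R -> R) : measurable_fun setT g ->
  law.-integrable setT (EFin \o g) ->
  P.-integrable setT (EFin \o (g \o X i)) /\ \int[P]_w g (X i w) = \int[law]_x g x.
Proof.
move=> mg ig.
have dE A : measurable A -> distribution P (X i) A = law A by move=> mA; exact: X_iid.1.
have mgE : measurable_fun setT (EFin \o g) by exact/measurable_EFinP.
have iP : P.-integrable setT (EFin \o (g \o X i)).
  apply/integrableP; split; first by apply/measurable_EFinP; exact: measurableT_comp.
  have /integrableP[_] := ig; apply: le_lt_trans.
  rewrite -(eq_measure_integral law (fun A mA _ => dE A mA)).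
  by rewrite ge0_integral_distribution//; exact: measurableT_comp.
split=> //; congr fine.
transitivity (\int[distribution P (X i)]_x (EFin \o g) x)%E.
  by rewrite integral_distribution.
exact: (eq_measure_integral law (fun A mA _ => dE A mA)).
Qed.

Lemma L3_stdX i : L3 P (stdX i).
Proof.
split; first exact: mY.
have mg : measurable_fun setT (fun x => `|std x| ^+ 3).
  by apply: measurable_funX; exact: measurableT_comp.
by have [] := law_transfer i mg L3_std.2.
Qed.

Lemma law_meanE : \int[law]_x x = mu.
Proof. by move: law_mean; rewrite unlock /Rintegral => ->. Qed.

Lemma law_varE : \int[law]_x ((x - mu) ^+ 2) = nu.
Proof.
rewrite -law_var /variance covariance.unlock law_mean expectation.unlock.
by congr fine; apply: eq_integral => x _ /=; rewrite expr2.
Qed.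

Lemma stdX_mean i : \int[P]_w stdX i w = 0.
Proof.
have [_ ->] := law_transfer i m_std (L3_integrable L3_std).
have iid := L3_integrable L3_law.
have i1 := @integrable_RVcst _ _ _ law mu.
have i2 := integrableB measurableT iid i1.
rewrite RintegralZr//.
rewrite (@RintegralB _ _ _ law setT idfun (cst mu))// Rintegral_RVcst law_meanE.
by rewrite subrr mul0r.
Qed.

Lemma stdX_var i : \int[P]_w (stdX i w ^+ 2) = 1.
Proof.
have mg : measurable_fun setT (fun x => std x ^+ 2) by apply: measurable_funX.
have [_ ->] := law_transfer i mg (L3_integrable_sqr L3_std).
have i1 := L3_integrable_sqr (L3D L3_law (L3_cst law (- mu))).
transitivity (\int[law]_x (nu^-1 * (x - mu) ^+ 2)).
  apply: eq_Rintegral => x _; rewrite /std exprMn exprVn sqr_sqrtr ?ltW//.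
  by rewrite mulrC.
by rewrite RintegralZl// law_varE mulVf// gt_eqF.
Qed.

Lemma stdX_moment3 i : \int[P]_w (`|stdX i w| ^+ 3) = \int[law]_x (`|std x| ^+ 3).
Proof.
have mg : measurable_fun setT (fun x => `|std x| ^+ 3).
  by apply: measurable_funX; exact: measurableT_comp.
by have [_] := law_transfer i mg L3_std.2.
Qed.

Lemma indep_fam_stdX : indep_fam stdX.
Proof.
move=> r A ur mA.
have mA' i : measurable (std @^-1` A i) by rewrite -[_ @^-1` _]setTI; exact: m_std.
exact: (iid_indep_fam ur mA').
Qed.

Lemma sample_mean_std m w : (0 < m)%N ->
  sample_mean X m w - mu = sg * (sumX stdX (index_iota 0 m) w / m%:R).
Proof.
move=> m0; have mR : m%:R != 0 :> R by rewrite pnatr_eq0 -lt0n.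
have -> : sumX stdX (index_iota 0 m) w = (\sum_(i < m) X i w - m%:R * mu) / sg.
  rewrite /sumX -mulr_suml big_mkord; congr (_ / _).
  by rewrite sumrB sumr_const card_ord mulr_natl.
by rewrite /sample_mean; field; rewrite mR gt_eqF.
Qed.

Lemma measurable_sample_mean m : measurable_fun setT (sample_mean X m).
Proof. by apply: measurable_funM => //; exact: measurable_sum. Qed.

Lemma sample_mean_tail (eta : R) : 0 < eta -> exists K : R, 0 <= K /\
  forall m, (0 < m)%N ->
  (P [set w | (eta <= `|sample_mean X m w - mu|)%R] <= (K / (m%:R * Num.sqrt m%:R))%:E)%E.
Proof.
move=> eta0.
have e0 : 0 < eta / sg by rewrite divr_gt0.
have b0 := @b_ge0 _ _ _ _ _ _ stdX_moment3.
have c0 := cubic_bound_ge0 stdX_var stdX_moment3.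
eexists; split; last first.
  move=> m m0.
  have := tail_S indep_fam_stdX L3_stdX stdX_mean stdX_var stdX_moment3 e0 m0.
  congr (P _ <= _)%E; apply/seteqP; split => w /=;
    rewrite sample_mean_std// normrM (gtr0_norm sg0) normrM normfV
      (@gtr0_norm _ m%:R) ?ltr0n// mulrA ler_pdivlMr ?ltr0n// mulrAC ler_pdivrMr//;
    by rewrite [sg * _]mulrC.
by rewrite divr_ge0// exprn_ge0// ltW.
Qed.

Lemma sample_mean_SLLN :
  {ae P, forall w, sample_mean X m w @[m --> \oo] --> mu}.
Proof.
have := SLLN indep_fam_stdX L3_stdX stdX_mean stdX_var stdX_moment3.
apply: filterS => w Sw.
have h : (mu + sg * (sumX stdX (index_iota 0 m) w / m%:R)) @[m --> \oo] --> (mu + sg * 0).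
  by apply: cvgD; [exact: cvg_cst|apply: cvgM => //; exact: cvg_cst].
rewrite mulr0 addr0 in h; apply: cvg_trans h; apply: near_eq_cvg.
by exists 1%N => // m /= m0; rewrite -sample_mean_std// addrC subrK.
Qed.

Lemma sample_mean_clt (x : R) : 0 < x ->
  fine (P [set w | `|sample_mean X m w - mu| < x * sg / Num.sqrt m%:R]) @[m --> \oo]
    --> 2 * normal_cdf x - 1.
Proof.
move=> x0.
have := clt indep_fam_stdX L3_stdX stdX_mean stdX_var stdX_moment3 x0.
apply: cvg_trans; apply: near_eq_cvg.
exists 1%N => // m /= m0; congr (fine (P _)).
have s0 : 0 < Num.sqrt m%:R :> R by rewrite sqrtr_gt0 ltr0n.
have s2 : m%:R = Num.sqrt m%:R * Num.sqrt m%:R :> R by rewrite -expr2 sqr_sqrtr.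
set r := Num.sqrt _ in s0 s2 *.
have E w : `|sample_mean X m w - mu| = sg / r * `|sumX stdX (index_iota 0 m) w / r|.
  rewrite sample_mean_std// s2.
  have -> : sg * (sumX stdX (index_iota 0 m) w / (r * r)) =
    sg / r * (sumX stdX (index_iota 0 m) w / r) by field; rewrite gt_eqF.
  by rewrite normrM (gtr0_norm (divr_gt0 sg0 s0)).
have -> : x * sg / r = sg / r * x by ring.
by apply/seteqP; split => w /=; rewrite E ltr_pM2l// divr_gt0.
Qed.

End sample_mean_limits.

(** * Asymptotics of the stages *)

Section deterministic_asymptotics.
Context (R : realType) (Theta : set R) (V kappa : R -> R).
Hypotheses (V_out : forall x, ~ Theta x -> V x = 0)
  (V_gt0 : forall t : R, Theta t -> 0 < V t)
  (V_cont : {within Theta, continuous V}).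
Context (mu : R).
Hypotheses (mu_Theta : Theta mu) (kappa_gt0 : 0 < kappa mu).

(** Continuity within [Theta] bounds V at points of [Theta]; outside, V is 0 and the upper bound is
    free. This is the upper semicontinuity behind acceptance. *)
Lemma V_near_le eta : 0 < eta -> exists2 r, 0 < r & forall x, `|x - mu| < r -> V x <= V mu + eta.
Proof.
move=> eta0.
have /subspace_continuousP/(_ mu mu_Theta)/cvgrPdist_le/(_ _ eta0) := V_cont.
rewrite /within /= => /nbhs_ballP[r /= r0 hr]; exists r => // x xr.
have [Tx|nTx] := pselect (Theta x).
  have := hr x; rewrite /ball /= distrC => /(_ xr Tx).
  rewrite /from_subspace ler_norml => /andP[]; lra.
by rewrite V_out// addr_ge0 ?ltW// V_gt0.
Qed.

(** The lower bound needs a full neighbourhood inside [Theta], since V drops to 0 across the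
    boundary. *)
Lemma V_near_ge eta : 0 < eta -> interior Theta mu ->
  exists2 r, 0 < r & forall x, `|x - mu| < r -> V mu - eta <= V x.
Proof.
move=> eta0 /nbhs_ballP[r1 /= r10 hr1].
have /subspace_continuousP/(_ mu mu_Theta)/cvgrPdist_le/(_ _ eta0) := V_cont.
rewrite /within /= => /nbhs_ballP[r /= r0 hr]; exists (Num.min r r1).
  by rewrite lt_min r0.
move=> x; rewrite lt_min => /andP[xr xr1].
have Tx : Theta x by apply: hr1; rewrite /ball /= distrC.
have := hr x; rewrite /ball /= distrC => /(_ xr Tx).
rewrite /from_subspace ler_norml => /andP[]; lra.
Qed.

Lemma half_width_near (L U : R -> R -> R) eta : half_width_limit Theta kappa L U ->
  0 < eta -> exists2 r, 0 < r & \forall e \near (0 : R)^'+, forall z, `|z - mu| < r ->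
   `|(z - L z e) / e - kappa mu| <= eta /\ `|(U z e - z) / e - kappa mu| <= eta.
Proof.
move=> hw eta0; have [hL hU] := hw mu mu_Theta.
move/cvgrPdist_le: hL => /(_ _ eta0) [[A1 B1] /= [/nbhs_ballP[r1 /= r10 hr1] hB1] h1].
move/cvgrPdist_le: hU => /(_ _ eta0) [[A2 B2] /= [/nbhs_ballP[r2 /= r20 hr2] hB2] h2].
exists (Num.min r1 r2); first by rewrite lt_min r10.
near=> e => z; rewrite lt_min => /andP[z1 z2]; split.
  rewrite distrC; apply: (h1 (z, e)); split => /=; last by near: e; exact: hB1.
  by apply: hr1; rewrite /ball /= distrC.
rewrite distrC; apply: (h2 (z, e)); split => /=; last by near: e; exact: hB2.
by apply: hr2; rewrite /ball /= distrC.
Unshelve. all: by end_near. Qed.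

Context (sL sU : R -> R -> R) (rho : R) (C Upsilon : int -> R) (n : R -> int -> nat)
  (delta_ : int -> R).
Hypotheses (sLU_lim : half_width_limit Theta kappa sL sU) (rho01 : 0 <= rho <= 1)
  (Upsilon_def : forall l : int, Upsilon l = ln (1 / delta_ l))
  (Upsilon_gt0 : forall l, 0 < Upsilon l) (C_gt0 : forall l : int, 0 < C l)
  (C_inc : forall l : int, C l < C (l + 1))
  (n_lim : forall eta : R, 0 < eta -> \forall e \near (0 : R)^'+,
     forall l : int, 1 <= l ->
       `| e ^+ 2 * (n e l)%:R / (C l * Upsilon l) - 1 | <= eta).

Lemma C_mono (l l' : int) : l <= l' -> C l <= C l'.
Proof.
rewrite -subr_ge0 => h; have -> : l' = l + `|l' - l|%N.
  by rewrite gez0_abs//; ring.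
elim: `|_|%N => [|k IH]; first by rewrite addr0.
by rewrite (le_trans IH)// -addn1 PoszD addrA ltW.
Qed.

Lemma C_smono (l l' : int) : l < l' -> C l < C l'.
Proof. by rewrite -lezD1 => /C_mono; apply: lt_le_trans. Qed.

Let k0 := kappa mu.

(** The threshold of the rule factors as g h^2 C_l with g near 1 and h near kappa(mu). It is
    therefore about kappa(mu)^2 C_l, and comparing it with the variance amounts to comparing
    Lambda_l with 1. *)
Lemma scaled_square_bounds (e u eta : R) (m : nat) (l : int) :
  0 < eta -> eta < k0 -> eta < 1 -> 0 < e -> `|u / e - k0| <= eta ->
  `|e ^+ 2 * m%:R / (C l * Upsilon l) - 1| <= eta ->
  (1 - eta) * (k0 - eta) ^+ 2 * C l <= m%:R * u ^+ 2 / Upsilon l <=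
  (1 + eta) * (k0 + eta) ^+ 2 * C l.
Proof.
move=> eta0 etak eta1 e0; set h := u / e; set g := e ^+ 2 * _ / _ => hu hm.
have Ul := Upsilon_gt0 l; have Cl := C_gt0 l.
have -> : m%:R * u ^+ 2 / Upsilon l = g * h ^+ 2 * C l.
  by rewrite /g /h; field; rewrite !gt_eqF.
move: hu hm; rewrite !ler_norml => /andP[hu1 hu2] /andP[hm1 hm2].
have h1 : (k0 - eta) ^+ 2 <= h ^+ 2 by rewrite lerXn2r// ?nnegrE; lra.
have h2 : h ^+ 2 <= (k0 + eta) ^+ 2 by rewrite lerXn2r// ?nnegrE; lra.
have h3 := sqr_ge0 (k0 - eta).
by apply/andP; split; rewrite ler_wpM2r ?(ltW Cl)//; apply: ler_pM => //; lra.
Qed.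

(** One radius and one range of e serve all stages: the half-widths do not depend on [l], and the
    limit of the scaled sizes is uniform in [l >= 1]. *)
Lemma stopping_rule_near (eta r1 : R) : 0 < eta -> eta < k0 -> eta < 1 -> 0 < r1 ->
  exists2 r, 0 < r & \forall e \near (0 : R)^'+, forall z, `|z - mu| < r ->
   forall l : int, 1 <= l ->
   [/\ `|z + rho * (sU z e - z) - mu| < r1,
       `|z + rho * (sL z e - z) - mu| < r1,
     (1 - eta) * (k0 - eta) ^+ 2 * C l <= (n e l)%:R * (sU z e - z) ^+ 2 / Upsilon l <=
       (1 + eta) * (k0 + eta) ^+ 2 * C l &
     (1 - eta) * (k0 - eta) ^+ 2 * C l <= (n e l)%:R * (sL z e - z) ^+ 2 / Upsilon l <=
       (1 + eta) * (k0 + eta) ^+ 2 * C l].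
Proof.
move=> eta0 etak eta1 r10.
have [r2 r20 hw] := half_width_near sLU_lim eta0.
(* Half of [r1] is for the distance from z to mu, the other half for the half-width, which [rho] can
   only shorten. *)
exists (Num.min r2 (r1 / 2)); first by rewrite lt_min r20 divr_gt0.
have k1 : 0 < k0 + eta + 1 by move: kappa_gt0; rewrite -/k0; lra.
near=> e => z; rewrite lt_min => /andP[z1 z2] l l1.
have e0 : 0 < e by near: e; exact: nbhs_right_gt.
have er : e * (k0 + eta + 1) < r1 / 2.
  by rewrite -ltr_pdivlMr//; near: e; apply: nbhs_right_lt; rewrite !divr_gt0.
have [hL hU] : `|(z - sL z e) / e - k0| <= eta /\ `|(sU z e - z) / e - k0| <= eta.
  by move: z z1 {z2}; near: e.
have hn : `| e ^+ 2 * (n e l)%:R / (C l * Upsilon l) - 1 | <= eta.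
  by move: l l1; near: e; exact: n_lim.
have close u : `|u / e - k0| <= eta -> `|u| < r1 / 2.
  move=> hu; apply: le_lt_trans er.
  have -> : u = e * (u / e) by rewrite mulrC divfK// gt_eqF.
  rewrite normrM (gtr0_norm e0) ler_pM2l// ler_norml.
  by move: hu kappa_gt0; rewrite ler_norml -/k0 => /andP[? ?] ?; apply/andP; split; lra.
have rhou u : `|u| < r1 / 2 -> `|z + rho * u - mu| < r1.
  move=> hu; have -> : z + rho * u - mu = (z - mu) + rho * u by ring.
  rewrite (le_lt_trans (ler_normD _ _))// [ltRHS]splitr ltrD//.
  rewrite normrM (le_lt_trans _ hu)// ler_piMl//.
  by case/andP: rho01 => ? ?; rewrite ger0_norm.
have sN : sL z e - z = - (z - sL z e) by rewrite opprB.
split.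
- by apply: rhou; exact: close.
- by apply: rhou; rewrite sN normrN; exact: close.
- exact: (scaled_square_bounds eta0 etak eta1 e0 hU hn).
- by rewrite sN sqrrN; exact: (scaled_square_bounds eta0 etak eta1 e0 hL hn).
Unshelve. all: by end_near. Qed.

Let Lambda (l : int) := k0 ^+ 2 * C l / V mu.

(* [mu] may be a boundary point of [Theta]: as [V] vanishes outside [Theta], it
   is upper semicontinuous at [mu], which suffices for acceptance. *)
Lemma accept_near (l0 : int) : 1 <= l0 -> 1 < Lambda l0 ->
  exists2 r, 0 < r & \forall e \near (0 : R)^'+, forall z, `|z - mu| < r ->
   forall l : int, l0 <= l -> accepts V rho sL sU (n e l) (delta_ l) z e.
Proof.
move=> l01; have nu0 := V_gt0 mu_Theta; rewrite /Lambda ltr_pdivlMr// mul1r => Lam.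
have kp : 0 < k0 := kappa_gt0.
(* At eta = 0 this is the strict inequality Lambda > 1 at [l0]; continuity in eta leaves room for a
   positive tolerance. *)
have [eta [eta0 etak eta1 H]] : exists eta, [/\ 0 < eta, eta < k0, eta < 1 &
   V mu + eta <= (1 - eta) * (k0 - eta) ^+ 2 * C l0].
  pose f (x : R) := (1 - x) * (k0 - x) ^+ 2 * C l0 - (V mu + x).
  have cf : f x @[x --> (0 : R)] --> f 0.
    apply: cvgB; last by apply: cvgD; [exact: cvg_cst|exact: cvg_id].
    apply: cvgM; last exact: cvg_cst.
    apply: cvgM; first by apply: cvgB; [exact: cvg_cst|exact: cvg_id].
    by under eq_fun do rewrite expr2; rewrite expr2; apply: cvgM; (apply: cvgB; [exact: cvg_cst|exact: cvg_id]).
  have f0 : 0 < f 0 by rewrite /f !subr0 addr0 mul1r subr_gt0.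
  have hf := cvgr_gt _ (cvg_at_right_filter cf) _ f0.
  near (0 : R)^'+ => eta; exists eta; split.
  - by near: eta; exact: nbhs_right_gt.
  - by near: eta; exact: nbhs_right_lt.
  - by near: eta; exact: nbhs_right_lt.
  - by rewrite -subr_ge0 ltW//; near: eta; exact: hf.
have [r1 r10 hV] := V_near_le eta0.
have [r r0 hr] := stopping_rule_near eta0 etak eta1 r10.
exists r => //; near=> e => z zr l ll0.
have l1 : 1 <= l by exact: le_trans ll0.
have [u1 u2 /andP[h1 _] /andP[h2 _]] : [/\ `|z + rho * (sU z e - z) - mu| < r1,
       `|z + rho * (sL z e - z) - mu| < r1,
     (1 - eta) * (k0 - eta) ^+ 2 * C l <= (n e l)%:R * (sU z e - z) ^+ 2 / Upsilon l <=
       (1 + eta) * (k0 + eta) ^+ 2 * C l &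
     (1 - eta) * (k0 - eta) ^+ 2 * C l <= (n e l)%:R * (sL z e - z) ^+ 2 / Upsilon l <=
       (1 + eta) * (k0 + eta) ^+ 2 * C l].
  by move: l l1 {ll0}; move: z zr; near: e.
(* As C increases, the tolerance fixed at stage [l0] serves every later stage. *)
have HC : V mu + eta <= (1 - eta) * (k0 - eta) ^+ 2 * C l.
  rewrite (le_trans H)// ler_wpM2l ?C_mono// mulr_ge0 ?sqr_ge0//; lra.
by rewrite /accepts -Upsilon_def; apply/andP; split;
  (apply: le_trans (hV _ _) _ => //; apply: le_trans HC _).
Unshelve. all: by end_near. Qed.

(** Acceptance is a conjunction, so it is enough that the condition with [sU] fails: there V is
    close to its value at mu, above a threshold close to kappa(mu)^2 C_l. *)
Lemma reject_near (l : int) : 1 <= l -> Lambda l < 1 -> interior Theta mu ->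
  exists2 r, 0 < r & \forall e \near (0 : R)^'+, forall z, `|z - mu| < r ->
   accepts V rho sL sU (n e l) (delta_ l) z e = false.
Proof.
move=> l1; have nu0 := V_gt0 mu_Theta; rewrite /Lambda ltr_pdivrMr// mul1r => Lam iT.
have kp : 0 < k0 := kappa_gt0.
have [eta [eta0 etak eta1 H]] : exists eta, [/\ 0 < eta, eta < k0, eta < 1 &
   (1 + eta) * (k0 + eta) ^+ 2 * C l < V mu - eta].
  pose f (x : R) := V mu - x - (1 + x) * (k0 + x) ^+ 2 * C l.
  have cf : f x @[x --> (0 : R)] --> f 0.
    apply: cvgB; first by apply: cvgB; [exact: cvg_cst|exact: cvg_id].
    apply: cvgM; last exact: cvg_cst.
    apply: cvgM; first by apply: cvgD; [exact: cvg_cst|exact: cvg_id].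
    by under eq_fun do rewrite expr2; rewrite expr2; apply: cvgM; (apply: cvgD; [exact: cvg_cst|exact: cvg_id]).
  have f0 : 0 < f 0 by rewrite /f subr0 !addr0 mul1r subr_gt0.
  have hf := cvgr_gt _ (cvg_at_right_filter cf) _ f0.
  near (0 : R)^'+ => eta; exists eta; split.
  - by near: eta; exact: nbhs_right_gt.
  - by near: eta; exact: nbhs_right_lt.
  - by near: eta; exact: nbhs_right_lt.
  - by rewrite -subr_gt0; near: eta; exact: hf.
have [r1 r10 hV] := V_near_ge eta0 iT.
have [r r0 hr] := stopping_rule_near eta0 etak eta1 r10.
exists r => //; near=> e => z zr.
have [u1 _ /andP[_ h1] _] : [/\ `|z + rho * (sU z e - z) - mu| < r1,
       `|z + rho * (sL z e - z) - mu| < r1,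
     (1 - eta) * (k0 - eta) ^+ 2 * C l <= (n e l)%:R * (sU z e - z) ^+ 2 / Upsilon l <=
       (1 + eta) * (k0 + eta) ^+ 2 * C l &
     (1 - eta) * (k0 - eta) ^+ 2 * C l <= (n e l)%:R * (sL z e - z) ^+ 2 / Upsilon l <=
       (1 + eta) * (k0 + eta) ^+ 2 * C l].
  by move: l1; move: {Lam H} l; move: z zr; near: e.
apply/negbTE; rewrite /accepts -Upsilon_def negb_and -!ltNge; apply/orP; left.
by rewrite (le_lt_trans h1)// (lt_le_trans H)// hV.
Unshelve. all: by end_near. Qed.

Lemma size_scaled_cvg (l : int) : 1 <= l ->
  e ^+ 2 * (n e l)%:R @[e --> (0 : R)^'+] --> C l * Upsilon l.
Proof.
move=> l1; have c0 : 0 < C l * Upsilon l by rewrite mulr_gt0.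
apply/cvgrPdist_le => eta eta0.
have h : 0 < eta / (C l * Upsilon l) by rewrite divr_gt0.
near=> e; have : `| e ^+ 2 * (n e l)%:R / (C l * Upsilon l) - 1 | <= eta / (C l * Upsilon l).
  by near: e; apply: filterS (n_lim h) => e; apply.
rewrite ler_pdivlMr// -{2}(gtr0_norm c0) -normrM mulrBl divfK ?mul1r ?gt_eqF//.
by rewrite distrC.
Unshelve. all: by end_near. Qed.

End deterministic_asymptotics.

(** * Geometric growth from ratio bounds *)

Section ratio_bounds.
Context (R : realType) (F : int -> R).
Hypothesis F_gt0 : forall l, 0 < F l.

Lemma ratio_lower : (1 < ereal_inf (range (fun k : nat => (F (k%:Z + 1) / F k%:Z)%:E)))%E ->
  exists2 q, 1 < q & forall k : nat, q * F k%:Z <= F (k%:Z + 1).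
Proof.
set A := range _; move=> h1.
have hA k : (ereal_inf A <= (F (k%:Z + 1) / F k%:Z)%:E)%E by apply: ereal_inf_lbound; exists k.
have hfin : ereal_inf A \is a fin_num.
  rewrite fin_numE; apply/andP; split; first by case: (ereal_inf A) h1.
  by have := hA 0%N; case: (ereal_inf A).
move: h1 hA; rewrite -(fineK hfin) lte_fin => h1 hA.
exists (fine (ereal_inf A)) => // k.
by have := hA k; rewrite lee_fin ler_pdivlMr.
Qed.

Lemma ratio_upper : (ereal_sup (range (fun k : nat => (F (k%:Z + 1) / F k%:Z)%:E)) < +oo)%E ->
  exists2 M, 0 < M & forall k : nat, F (k%:Z + 1) <= M * F k%:Z.
Proof.
set A := range _; move=> h1.
have hA k : ((F (k%:Z + 1) / F k%:Z)%:E <= ereal_sup A)%E by apply: ereal_sup_ubound; exists k.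
have hfin : ereal_sup A \is a fin_num.
  rewrite fin_numE; apply/andP; split; last by case: (ereal_sup A) h1.
  by have := hA 0%N; case: (ereal_sup A).
move: hA; rewrite -(fineK hfin) => hA.
exists (fine (ereal_sup A)) => [|k].
  by have := hA 0%N; rewrite lee_fin; apply: lt_le_trans; rewrite divr_gt0.
by have := hA k; rewrite lee_fin ler_pdivrMr.
Qed.

Lemma geometric_lower q : 1 < q -> (forall k : nat, q * F k%:Z <= F (k%:Z + 1)) ->
  forall k : nat, q ^+ k * F 1 <= F (1 + k%:Z).
Proof.
move=> q1 hq; elim=> [|k IH]; first by rewrite expr0 mul1r addr0.
have := hq k.+1; have -> : k.+1%:Z + 1 = 1 + k.+1%:Z by rewrite addrC.
apply: le_trans; rewrite exprS -mulrA ler_wpM2l ?(le_trans ler01 (ltW q1))//.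
Qed.

Lemma sum_geometric_le (s : R) i m : 0 <= s -> s < 1 ->
  \sum_(i <= k < m) s ^+ k <= (1 - s)^-1.
Proof.
move=> s0 s1; apply: (@le_trans _ _ (\sum_(0 <= k < m) s ^+ k)).
  have [im|mi] := leqP i m; last by rewrite big_geq ?(ltnW mi)// sumr_ge0// => k _; exact: exprn_ge0.
  by rewrite [leRHS](big_cat_nat (leq0n i) im)/= lerDr sumr_ge0// => k _; exact: exprn_ge0.
rewrite -[leRHS]mul1r ler_pdivlMr ?subr_gt0//.
have -> : (\sum_(0 <= k < m) s ^+ k) * (1 - s) = 1 - s ^+ m.
  elim: m => [|m IH]; first by rewrite big_geq// mul0r expr0 subrr.
  by rewrite big_nat_recr//= mulrDl IH exprS; ring.
by rewrite gerBl exprn_ge0.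
Qed.

End ratio_bounds.

(** * Deviation probabilities along the stages *)

Section stage_probabilities.
Context (R : realType) (C Upsilon : int -> R) (n : R -> int -> nat) (tau : R -> int).
Hypotheses (C_gt0 : forall l : int, 0 < C l) (Upsilon_gt0 : forall l, 0 < Upsilon l)
  (Upsilon_mono : forall l, Upsilon l <= Upsilon (l + 1))
  (tau_lim : ((tau e)%:~R : R) @[e --> (0 : R)^'+] --> (1 : R))
  (n_gt0 : forall (e : R) (l : int), 0 < e -> tau e <= l -> (0 < n e l)%N)
  (n_lim : forall eta : R, 0 < eta -> \forall e \near (0 : R)^'+,
     forall l : int, 1 <= l ->
       `| e ^+ 2 * (n e l)%:R / (C l * Upsilon l) - 1 | <= eta).

(** An integer at distance less than 1 from 1 is 1, so for small e the stages start exactly at 1. *)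
Lemma near_tau1 : \forall e \near (0 : R)^'+, tau e = 1.
Proof.
move/cvgrPdist_lt: tau_lim => /(_ 1 ltr01); apply: filterS => e.
have -> : 1 - (tau e)%:~R = (1 - tau e)%:~R :> R by rewrite intrB.
rewrite -intr_norm -[X in _ < X]/(1%:~R) ltr_int -[X in _ < X]add0r ltzD1.
by rewrite normr_le0 subr_eq0 => /eqP.
Qed.

Let c l := C l * Upsilon l.
Let c_gt0 l : 0 < c l. Proof. exact: mulr_gt0. Qed.

Lemma near_size_bounds : \forall e \near (0 : R)^'+, 0 < e /\ forall l : int, 1 <= l ->
  c l / (2 * e ^+ 2) <= (n e l)%:R <= 3 / 2 * c l / e ^+ 2.
Proof.
(* The uniform limit is used with tolerance 1/2, which gives the factors 1/2 and 3/2. *)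
have h2 : (0 : R) < 1 / 2 by lra.
near=> e; have e0 : 0 < e by near: e; exact: nbhs_right_gt.
split=> // l l1.
have : `| e ^+ 2 * (n e l)%:R / c l - 1 | <= 1 / 2 by move: l l1; near: e; exact: n_lim.
have e20 : 0 < e ^+ 2 by rewrite exprn_gt0.
rewrite ler_norml => /andP[h3 h4].
have h5 : 1 / 2 <= e ^+ 2 * (n e l)%:R / c l by lra.
have h6 : e ^+ 2 * (n e l)%:R / c l <= 3 / 2 by lra.
rewrite ler_pdivlMr// in h5; rewrite ler_pdivrMr// in h6.
rewrite ler_pdivlMr// ler_pdivrMr ?mulr_gt0//; apply/andP; split; lra.
Unshelve. all: by end_near. Qed.

Lemma size_cvg_infty (l : int) : 1 <= l -> n e l @[e --> (0 : R)^'+] --> \oo.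
Proof.
move=> l1; apply/cvgnyPge => A; near=> e.
have [e0 /(_ l l1)/andP[h _]] : 0 < e /\ forall l : int, 1 <= l ->
  c l / (2 * e ^+ 2) <= (n e l)%:R <= 3 / 2 * c l / e ^+ 2.
  by near: e; exact: near_size_bounds.
rewrite -(ler_nat R); apply: le_trans h; rewrite ler_pdivlMr ?mulr_gt0 ?exprn_gt0//.
have e1 : e <= 1 by near: e; apply: nbhs_right_le.
have eA : e * (2 * A%:R + 1) <= c l.
  rewrite -ler_pdivlMr ?ltr_wpDl ?mulr_ge0//; near: e; apply: nbhs_right_le.
  by rewrite divr_gt0// ltr_wpDl// mulr_ge0.
have A0 : 0 <= A%:R :> R by [].
apply: le_trans eA.
have -> : A%:R * (2 * e ^+ 2) = e * (2 * A%:R * e) by ring.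
rewrite ler_pM2l// -[leLHS]addr0 lerD// ler_piMr// mulr_ge0//.
Unshelve. all: by end_near. Qed.

Context d (Omega : measurableType d) (P : probability Omega R) (X : nat -> {RV P >-> R})
  (mu : R).
Hypothesis tail : forall eta : R, 0 < eta -> exists K : R, 0 <= K /\
  forall m, (0 < m)%N ->
  (P [set w | (eta <= `|sample_mean X m w - mu|)%R] <= (K / (m%:R * Num.sqrt m%:R))%:E)%E.

Let Z (e : R) (l : int) (w : Omega) := sample_mean X (n e l) w.

Lemma far_measurable r e l : measurable [set w | r <= `|Z e l w - mu|].
Proof.
rewrite -[X in measurable X]setTI; apply: measurable_fun_le => //.
apply: measurableT_comp => //; apply: measurable_funB => //.
exact: measurable_sample_mean.
Qed.

Lemma far_le (r : R) : 0 < r -> exists2 K, 0 <= K & \forall e \near (0 : R)^'+,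
  forall l : int, 1 <= l ->
  (P [set w | (r <= `|Z e l w - mu|)%R] <=
    (K / ((n e l)%:R * Num.sqrt (n e l)%:R))%:E)%E.
Proof.
move=> r0; have [K [K0 hK]] := tail r0; exists K => //.
near=> e => l l1; apply: hK; apply: n_gt0; first by near: e; exact: nbhs_right_gt.
suff -> : tau e = 1 by [].
by near: e; exact: near_tau1.
Unshelve. all: by end_near. Qed.

Lemma far_cvg0 (r : R) (l : int) : 0 < r -> 1 <= l ->
  P [set w | (r <= `|Z e l w - mu|)%R] @[e --> (0 : R)^'+] --> 0%E.
Proof.
move=> r0 l1; have [K K0 hK] := far_le r0.
apply: (@squeeze_cvge _ _ _ _ (fun=> 0%E) _ (fun e => (K * 2 / c l * e ^+ 2)%:E)).
- near=> e; rewrite measure_ge0 /=.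
  have [e0 /(_ l l1)/andP[h _]] : 0 < e /\ forall l : int, 1 <= l ->
    c l / (2 * e ^+ 2) <= (n e l)%:R <= 3 / 2 * c l / e ^+ 2.
    by near: e; exact: near_size_bounds.
  have nR : 0 < (n e l)%:R :> R.
    by apply: lt_le_trans h; rewrite divr_gt0// mulr_gt0// exprn_gt0.
  have h2 : (P [set w | (r <= `|Z e l w - mu|)%R] <=
    (K / ((n e l)%:R * Num.sqrt (n e l)%:R))%:E)%E by move: l1 {h nR}; move: (l); near: e.
  apply: (le_trans h2); rewrite lee_fin -!mulrA ler_wpM2l//.
  apply: (@le_trans _ _ (n e l)%:R^-1).
    rewrite lef_pV2 ?posrE ?mulr_gt0 ?sqrtr_gt0//.
    have n1 : 1 <= Num.sqrt (n e l)%:R :> R.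
      by rewrite -[leLHS]sqrtr1 ler_sqrt// ler1n -(ltr_nat R).
    by rewrite ler_peMr// ltW.
  rewrite -[leRHS]invrK lef_pV2 ?posrE ?invr_gt0 ?mulr_gt0 ?invr_gt0 ?exprn_gt0//.
  apply: le_trans h; rewrite le_eqVlt; apply/orP; left; apply/eqP.
  by field; rewrite !gt_eqF.
- exact: cvg_cst.
- apply: cvg_EFin; first exact: nearW.
  rewrite -[X in _ --> X](mulr0 (K * 2 / c l)); apply: cvgM; first exact: cvg_cst.
  have -> : (0 : R) = 0 ^+ 2 by rewrite expr0n.
  apply: (@cvg_at_right_filter _ _ (fun e : R => e ^+ 2)).
  by have := @exprn_continuous R 2 0; rewrite /continuous_at expr0n.
Unshelve. all: by end_near. Qed.

(** The deviation bound n_l^(-3/2), multiplied by a size n_{l+1} of the same order as n_l, leaves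
    n_l^(-1/2). As e sqrt n_l grows at least like q^(k/2), the series is e times a geometric one of
    ratio 1 / sqrt q. *)
Lemma reject_tail_bound (D : R -> int -> set Omega) (l0 : nat) (r q M : R) :
  0 < r -> 1 < q -> 0 < M ->
  (forall k : nat, q ^+ k * C 1 <= C (1 + k%:Z)) ->
  (forall k : nat, C (k%:Z + 1) * Upsilon (k%:Z + 1) <= M * (C k%:Z * Upsilon k%:Z)) ->
  (forall e l, 0 < e -> measurable (D e l)) ->
  (\forall e \near (0 : R)^'+, forall l : int, 1 + l0%:Z <= l ->
     ~` D e l `<=` [set w | r <= `|Z e l w - mu|]) ->
  exists2 K, 0 <= K & \forall e \near (0 : R)^'+,
    (reject_tail P (stageD 1 (D e)) (stageN 1 (n e)) l0 <= (K * e)%:E)%E.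
Proof.
move=> r0 q1 M0 Cq cM mD DZ.
have [K K0 hK] := far_le r0.
have q0 : 0 < q by lra.
have sq1 : 1 < Num.sqrt q by rewrite -[ltLHS]sqrtr1 ltr_sqrt.
have sq0 : 0 < Num.sqrt q by lra.
pose s := (Num.sqrt q)^-1.
have s0 : 0 < s by rewrite invr_gt0.
have s1 : s < 1 by rewrite invf_lt1.
have U1 k : Upsilon 1 <= Upsilon (1 + k%:Z).
  elim: k => [|k IH]; first by rewrite addr0.
  by apply: (le_trans IH); rewrite -addn1 PoszD addrA.
(* From c_l / 2 <= e^2 n_l at l = 1: [B] bounds e sqrt n_1 from below. *)
pose B := Num.sqrt (c 1 / 2).
have B0 : 0 < B by rewrite sqrtr_gt0 divr_gt0.
exists (3 * M * K / B * (1 - s)^-1).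
  by rewrite mulr_ge0 ?invr_ge0 ?subr_ge0 ?(ltW s1)// divr_ge0 ?(ltW B0)// !mulr_ge0// ltW.
near=> e.
have [e0 hn] : 0 < e /\ forall l : int, 1 <= l ->
    c l / (2 * e ^+ 2) <= (n e l)%:R <= 3 / 2 * c l / e ^+ 2.
  by near: e; exact: near_size_bounds.
have e20 : 0 < e ^+ 2 by rewrite exprn_gt0.
have hP : forall l : int, 1 <= l -> (P [set w | (r <= `|Z e l w - mu|)%R] <=
    (K / ((n e l)%:R * Num.sqrt (n e l)%:R))%:E)%E by near: e.
have hD : forall l : int, 1 + l0%:Z <= l -> ~` D e l `<=` [set w | r <= `|Z e l w - mu|].
  by near: e.
have term k : (l0 <= k)%N ->
    ((stageN 1 (n e) k.+1)%:R%:E * P (~` stageD 1 (D e) k) <= (3 * M * K / B * e * s ^+ k)%:E)%E.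
  move=> lk; rewrite /stageN /stageD.
  have l1 : (1 : int) <= 1 + k%:Z by rewrite lerDl.
  have /andP[a1 a2] := hn _ l1.
  have l2 : (1 : int) <= 1 + k.+1%:Z by rewrite lerDl.
  have /andP[_ a3] := hn _ l2.
  have p1 : (P (~` D e (1 + k%:Z)%R) <=
    (K / ((n e (1 + k%:Z)%R)%:R * Num.sqrt (n e (1 + k%:Z)%R)%:R))%:E)%E.
    apply: le_trans (hP _ l1); apply: le_measure; rewrite ?inE.
    - by apply: measurableC; exact: mD.
    - exact: far_measurable.
    - by apply: hD; rewrite lerD2l lez_nat.
  have nR : 0 < (n e (1 + k%:Z))%:R :> R.
    by apply: lt_le_trans a1; rewrite divr_gt0// mulr_gt0.
  move: a1 a2 a3 p1 nR; set m := (n e (1 + k%:Z)); set m' := n e _ => a1 a2 a3 p1 nR.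
  have sm0 : 0 < Num.sqrt m%:R :> R by rewrite sqrtr_gt0.
  have cc : c (1 + k.+1%:Z) <= M * c (1 + k%:Z).
    have := cM k.+1; have -> : k.+1%:Z + 1 = 1 + k.+1%:Z by rewrite addrC.
    by have -> : k.+1%:Z = 1 + k%:Z by rewrite -addn1 PoszD addrC.
  (* The 3 is the quotient of the factors 3/2 and 1/2 of [near_size_bounds]; [M] bounds the ratio of
     consecutive values of [c]. *)
  have m'm : m'%:R <= 3 * M * m%:R :> R.
    apply: (le_trans a3); rewrite ler_pdivrMr//.
    rewrite ler_pdivrMr ?mulr_gt0// in a1.
    apply: (@le_trans _ _ (3 / 2 * (M * c (1 + k%:Z)))); first by rewrite ler_wpM2l//; lra.
    have -> : 3 * M * m%:R * e ^+ 2 = 3 / 2 * (M * (m%:R * (2 * e ^+ 2))) by field.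
    by rewrite ler_wpM2l// ler_wpM2l// ltW.
  have smB : B * Num.sqrt q ^+ k <= e * Num.sqrt m%:R.
    rewrite -(@ler_pXn2r _ 2)// ?nnegrE ?mulr_ge0 ?exprn_ge0 ?sqrtr_ge0 ?(ltW e0) ?(ltW B0)//.
    rewrite !exprMn !sqr_sqrtr ?(ltW nR)//; last by rewrite divr_ge0// ltW.
    rewrite exprAC sqr_sqrtr ?(ltW q0)//.
    rewrite ler_pdivrMr ?mulr_gt0// in a1.
    have : c 1 * q ^+ k <= c (1 + k%:Z).
      rewrite /c mulrAC [C 1 * _]mulrC; apply: ler_pM => //.
      - by rewrite mulr_ge0 ?exprn_ge0 ?(ltW q0) ?(ltW (C_gt0 _)).
      - exact/ltW/Upsilon_gt0.
    lra.
  apply: (@le_trans _ _ (m'%:R%:E * (K / (m%:R * Num.sqrt m%:R))%:E)%E).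
    by rewrite lee_wpmul2l// lee_fin.
  rewrite -EFinM lee_fin.
  apply: (@le_trans _ _ (3 * M * m%:R * (K / (m%:R * Num.sqrt m%:R)))).
    by rewrite ler_wpM2r// divr_ge0// mulr_ge0// ltW.
  have -> : 3 * M * m%:R * (K / (m%:R * Num.sqrt m%:R)) = 3 * M * K / Num.sqrt m%:R.
    by field; rewrite !gt_eqF.
  have -> : 3 * M * K / B * e * s ^+ k = 3 * M * K * (e / (B * Num.sqrt q ^+ k)).
    by rewrite /s exprVn; field; rewrite !gt_eqF ?exprn_gt0.
  rewrite ler_wpM2l ?mulr_ge0 ?(ltW M0)//.
  rewrite ler_pdivlMr ?mulr_gt0 ?exprn_gt0// mulrC ler_pdivrMr//.
apply: lime_le.
  by apply: is_cvg_nneseries => k _ _; rewrite mule_ge0.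
apply: nearW => m.
apply: (@le_trans _ _ (\sum_(l0 <= k < m) (3 * M * K / B * e * s ^+ k)%:E)%E).
  rewrite big_nat [leRHS]big_nat; apply: lee_sum => k /andP[lk _]; exact: term.
rewrite sumEFin lee_fin -mulr_sumr.
have := sum_geometric_le l0 m (ltW s0) s1.
have h : 0 <= 3 * M * K / B * e.
  by rewrite mulr_ge0 ?(ltW e0)// divr_ge0 ?(ltW B0)// !mulr_ge0// ltW.
by move=> /(ler_wpM2l h) /le_trans; apply; rewrite mulrAC.
Unshelve. all: by end_near. Qed.

End stage_probabilities.

(** * Lower and upper limits from eventual bounds *)

Section limf_bounds.
Context (R : realType) (F : set_system R) (FF : ProperFilter F).
Implicit Types (f g : R -> \bar R).
Local Open Scope ereal_scope.

Lemma le_limf_einf f a : (\forall x \near F, a <= f x) -> a <= limf_einf f F.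
Proof.
move=> af; rewrite limf_einfE; apply: le_trans (ereal_sup_ubound _); last by exists [set x | a <= f x].
by apply: le_ereal_inf_tmp => _ [x /= afx <-].
Qed.

Lemma limf_esup_le f a : (\forall x \near F, f x <= a) -> limf_esup f F <= a.
Proof.
move=> af; rewrite limf_esupE; apply: le_trans (ereal_inf_lbound _) _; first by exists [set x | f x <= a].
by apply: ge_ereal_sup => _ [x /= afx <-].
Qed.

Lemma limf_einf_esup f : limf_einf f F <= limf_esup f F.
Proof.
rewrite limf_einfE limf_esupE; apply: ge_ereal_sup => _ [A FA <-].
apply: le_ereal_inf_tmp => _ [B FB <-].
have [x [Ax Bx]] := filter_ex (filterI FA FB).
apply: (@le_trans _ _ (f x)); first by apply: ereal_inf_lbound; exists x.
by apply: ereal_sup_ubound; exists x.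
Qed.

Lemma cvg_le_limf_einf f g (l : R) : g @ F --> l%:E -> (\forall x \near F, g x <= f x) ->
  l%:E <= limf_einf f F.
Proof.
move=> gl gf; apply/lee_addgt0Pr => e e0; rewrite -leeBlDr// -EFinB.
apply: le_limf_einf.
move/fine_cvgP: gl => [gfin gl].
have le : (l - e < l)%R by rewrite ltrBlDr ltrDl.
have h : \forall x \near F, (l - e < fine (g x))%R by exact: (cvgr_gt _ gl _ le).
near=> x; apply: (@le_trans _ _ (g x)); last by near: x.
rewrite -[leRHS]fineK; last by near: x.
by rewrite lee_fin ltW//; near: x.
Unshelve. all: by end_near. Qed.

Lemma cvg_limf_esup_le f g (l : R) : g @ F --> l%:E -> (\forall x \near F, f x <= g x) ->
  limf_esup f F <= l%:E.
Proof.
move=> gl gf; apply/lee_addgt0Pr => e e0; rewrite -EFinD.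
apply: limf_esup_le.
move/fine_cvgP: gl => [gfin gl].
have le : (l < l + e)%R by rewrite ltrDl.
have h : \forall x \near F, (fine (g x) < l + e)%R by exact: (cvgr_lt _ gl _ le).
near=> x; apply: (@le_trans _ _ (g x)); first by near: x.
rewrite -[leLHS]fineK; last by near: x.
by rewrite lee_fin ltW//; near: x.
Unshelve. all: by end_near. Qed.

End limf_bounds.

Section stopping_complements.
Context d (Omega : measurableType d) (R : realType) (P : probability Omega R).

(** Each stage costs at least one sample, so the expected size is at least m times the probability
    of never stopping, for every m. *)
Lemma never_null (D : nat -> set Omega) (N : nat -> nat) (size_ : Omega -> \bar R) :
  (forall k, measurable (D k)) -> (forall k, (N k < N k.+1)%N) ->
  (forall k w, first_at D k w -> size_ w = (N k)%:R%:E) ->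
  (forall w, (forall k, ~ D k w) -> size_ w = +oo%E) ->
  (\int[P]_w size_ w < +oo)%E -> P (never D) = 0%E.
Proof.
move=> mD Ni s1 s2; rewrite (expected_size_series _ mD Ni s1 s2) => fin.
have mnv := measurable_never mD.
have H m : (m%:R%:E * P (never D) <= \int[P]_w size_ w)%E.
  rewrite (expected_size_series _ mD Ni s1 s2).
  apply: (@le_trans _ _ (\sum_(0 <= k < m) (Nstep R N k)%:E * P (not_yet D k))%E).
    have -> : (m%:R%:E * P (never D) = \sum_(0 <= k < m) P (never D))%E.
      rewrite -(fineK (fin_num_measure P _ mnv)) sumEFin sumr_const_nat subn0.
      by rewrite -EFinM mulr_natl.
    apply: lee_sum => k _; rewrite -[leLHS]mul1e; apply: lee_pmul => //.
      by rewrite lee_fin Nstep_ge1.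
    apply: le_measure; rewrite ?inE//; first exact: measurable_not_yet.
    by move=> w nv i _; exact: nv.
  rewrite -[leLHS]add0e; apply: leeD => //; apply: nneseries_lim_ge => k _ _.
  by rewrite mule_ge0// lee_fin Nstep_ge0.
apply/eqP; rewrite eq_le measure_ge0 andbT leNgt; apply/negP => p0.
rewrite -(expected_size_series _ mD Ni s1 s2) in fin.
have pE : P (never D) = (fine (P (never D)))%:E by rewrite fineK// fin_num_measure.
have E0 : (0 <= \int[P]_w size_ w)%E by have := H 0%N; rewrite mul0e.
have EE : (\int[P]_w size_ w = (fine (\int[P]_w size_ w))%:E)%E.
  by rewrite fineK// ge0_fin_numE.
move: p0 H E0; rewrite pE EE lte_fin lee_fin; set p := fine _; set x := fine _ => p0 H x0.
have := H (Num.bound (x / p)); rewrite -EFinM lee_fin -ler_pdivlMr// leNgt.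
by rewrite archi_boundP// divr_ge0// ltW.
Qed.

Context (t : int) (D : int -> set Omega).

Lemma stop_index_ext_ge m w : (forall i, (i < m)%N -> ~ stageD t D i w) ->
  ((t + m%:Z)%:~R%:E <= stop_index_ext R t D w)%E.
Proof.
move=> h; have [[k fk]|nv] := first_at_or_never (stageD t D) w; last first.
  by rewrite (stop_index_ext_never _ nv) leey.
rewrite (stop_index_ext_first _ fk) lee_fin ler_int lerD2l lez_nat leqNgt.
by apply/negP => km; exact: (h k km fk.1).
Qed.

Lemma stop_index_ext_le m w : stageD t D m w ->
  (stop_index_ext R t D w <= (t + m%:Z)%:~R%:E)%E.
Proof.
move=> h; have [[k fk]|nv] := first_at_or_never (stageD t D) w; last by case: (nv m).
rewrite (stop_index_ext_first _ fk) lee_fin ler_int lerD2l lez_nat leqNgt.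
by apply/negP => km; exact: (fk.2 m km h).
Qed.

End stopping_complements.

(** * Multistage sampling *)

(** The arithmetic of [coverage_cvg]: [p] is the coverage, [g1] and [g2] are the probabilities
    around it, [f1] and [f2] those of a large deviation. The error is 2 (eps / 4) + eps / 4 + eps /
    4, as the normal distribution function is doubled. *)
Lemma perturbed_bounds (R : realFieldType) (eps f2 g2 f1 p g1 phi phi2 phi1 : R) :
  g1 <= p + f1 -> p <= g2 + f2 -> f1 < eps / 4 -> f2 < eps / 4 ->
  2 * phi1 - 1 - eps / 4 < g1 -> g2 < 2 * phi2 - 1 + eps / 4 ->
  - (eps / 4) < phi1 - phi -> phi1 - phi < eps / 4 ->
  - (eps / 4) < phi2 - phi -> phi2 - phi < eps / 4 ->
  `|2 * phi - 1 - p| <= eps.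
Proof. by move=> *; rewrite ler_norml; apply/andP; split; lra. Qed.

Section multistage_sampling.
Context (R : realType)
  (Theta : set R) (dist : R -> probability R R)
  (Theta_itv : is_interval Theta)
  (dist_mean : forall t : R, Theta t -> ('E_(dist t)[idfun] = t%:E)%E)
  (dist_moment3 : forall t : R, Theta t ->
     ('E_(dist t)[fun x : R => (`|x| ^+ 3)%R] < +oo)%E)
  (V_gt0 : forall t : R, Theta t -> 0 < variance_of_mean Theta dist t)
  (V_cont : {within Theta, continuous (variance_of_mean Theta dist)})
  (kappa : R -> R)
  (kappa_gt0 : forall t : R, Theta t -> 0 < kappa t)
  (kappa_cont : {within Theta, continuous kappa})
  (sL sU : R -> R -> R)
  (sL_cont : forall z e : R, 0 < e ->
     {for (z, e), continuous (fun p : R * R => sL p.1 p.2)})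
  (sU_cont : forall z e : R, 0 < e ->
     {for (z, e), continuous (fun p : R * R => sU p.1 p.2)})
  (sLU_le : forall z e : R, 0 < e -> sL z e <= z <= sU z e)
  (sLU_lt : forall t e : R, Theta t -> 0 < e -> sL t e < t < sU t e)
  (sLU_lim : half_width_limit Theta kappa sL sU)
  (L U : R -> R -> R)
  (L_meas : forall e : R, 0 < e -> measurable_fun setT (fun z => L z e))
  (U_meas : forall e : R, 0 < e -> measurable_fun setT (fun z => U z e))
  (LU_lim : half_width_limit Theta kappa L U)
  (delta : R) (delta01 : 0 < delta < 1)
  (delta_ : int -> R)
  (delta_01 : forall l : int, 0 < delta_ l < 1)
  (delta_noninc : forall l : int, delta_ (l + 1) <= delta_ l)
  (C Upsilon : int -> R)
  (Upsilon_def : forall l : int, Upsilon l = ln (1 / delta_ l))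
  (C_gt0 : forall l : int, 0 < C l)
  (C_inc : forall l : int, C l < C (l + 1))
  (C_ratio_inf :
     (1 < ereal_inf (range (fun k : nat => (C (k%:Z + 1) / C k%:Z)%:E)))%E)
  (C_ratio_sup :
     (ereal_sup (range (fun k : nat => (C (k%:Z + 1) / C k%:Z)%:E)) < +oo)%E)
  (Upsilon_ratio_inf :
     (1 <= ereal_inf
             (range (fun k : nat => (Upsilon (k%:Z + 1) / Upsilon k%:Z)%:E)))%E)
  (Upsilon_ratio_sup :
     (ereal_sup
        (range (fun k : nat => (Upsilon (k%:Z + 1) / Upsilon k%:Z)%:E)) < +oo)%E)
  (C_dvg : C k%:Z @[k --> \oo] --> +oo)
  (tau : R -> int)
  (tau_lim : ((tau e)%:~R : R) @[e --> (0 : R)^'+] --> (1 : R))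
  (n : R -> int -> nat)
  (n_gt0 : forall (e : R) (l : int), 0 < e -> tau e <= l -> (0 < n e l)%N)
  (n_inc : forall (e : R) (l : int), 0 < e -> tau e <= l -> (n e l < n e (l + 1)%R)%N)
  (n_lim : forall eta : R, 0 < eta -> \forall e \near (0 : R)^'+,
     forall l : int, 1 <= l ->
       `| e ^+ 2 * (n e l)%:R / (C l * Upsilon l) - 1 | <= eta)
  (rho : R) (rho01 : 0 <= rho <= 1)
  (mu : R) (mu_Theta : Theta mu)
  (d : measure_display) (Omega : measurableType d) (P : probability Omega R)
  (X : nat -> {RV P >-> R})
  (X_iid : iid_with_law X (dist mu)).

Let V := variance_of_mean Theta dist.
Let nu := V mu.
Let Z (e : R) (l : int) (w : Omega) := sample_mean X (n e l) w.
Let D (e : R) (l : int) : set Omega :=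
  [set w | tau e <= l /\ accepts V rho sL sU (n e l) (delta_ l) (Z e l w) e].
Let I (e : R) (l : int) (w : Omega) : set R :=
  [set` `]L (Z e l w) e, U (Z e l w) e[].
Let idx (e : R) (w : Omega) : \bar R := stop_index_ext R (tau e) (D e) w.
Let size_ (e : R) (w : Omega) : \bar R := stop_size R (tau e) (D e) (n e) w.
Let covered (e : R) : set Omega := [set w | stop_interval (tau e) (D e) (I e) w mu].
Let En (e : R) : \bar R := (\int[P]_w size_ e w)%E.
Let xi (l : int) := kappa mu * Num.sqrt (C l * Upsilon l / nu).
Let Lambda (l : int) := kappa mu ^+ 2 * C l / nu.
Let SD (e : R) := stageD (tau e) (D e).
Let SN (e : R) := stageN (tau e) (n e).
Let SI (e : R) := stageI (tau e) (I e) mu.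

Let V_out x : ~ Theta x -> V x = 0.
Proof. by move=> nT; rewrite /V /variance_of_mean memNset. Qed.

Let nu_gt0 : 0 < nu. Proof. exact: V_gt0. Qed.

Let law_var : fine 'V_(dist mu)[idfun] = nu.
Proof. by rewrite /nu /V /variance_of_mean mem_set. Qed.

Let Upsilon_gt0 l : 0 < Upsilon l.
Proof.
rewrite Upsilon_def ln_gt0//; have /andP[d0 d1] := delta_01 l.
by rewrite ltr_pdivlMr// mul1r.
Qed.

Let Upsilon_mono l : Upsilon l <= Upsilon (l + 1).
Proof.
have /andP[d0 d1] := delta_01 l; have /andP[e0 e1] := delta_01 (l + 1).
rewrite !Upsilon_def ler_ln ?posrE ?divr_gt0// !div1r lef_pV2 ?posrE//.
Qed.

Let kappa_mu_gt0 : 0 < kappa mu. Proof. exact: kappa_gt0. Qed.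

Let tail := sample_mean_tail X_iid nu_gt0 (dist_mean mu_Theta) law_var (dist_moment3 mu_Theta).
Let tau1 := near_tau1 tau_lim.
Let far0 := far_cvg0 C_gt0 Upsilon_gt0 tau_lim n_gt0 n_lim tail.
Let accept := accept_near V_out V_gt0 V_cont mu_Theta kappa_mu_gt0 sLU_lim rho01
  Upsilon_def Upsilon_gt0 C_gt0 C_inc n_lim.
Let reject := reject_near V_gt0 V_cont mu_Theta kappa_mu_gt0 sLU_lim rho01
  Upsilon_def Upsilon_gt0 C_gt0 n_lim.

(** Off the interval [Theta], a measurable set, V is 0; so continuity within [Theta] is enough. *)
Let V_measurable : measurable_fun setT V.
Proof.
have mT : measurable Theta by exact: is_interval_measurable.
have -> : V = V \_ Theta.
  apply/funext => x; rewrite /patch; case: ifPn => // /negP xT.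
  by rewrite V_out// => Tx; apply: xT; rewrite inE.
apply/(measurable_restrictT _ mT).
exact: subspace_continuous_measurable_fun.
Qed.

Let sU_measurable e : 0 < e -> measurable_fun setT (fun z => sU z e).
Proof.
move=> e0; apply: continuous_measurable_fun => z.
apply: (@continuous_comp _ _ _ (fun z => (z, e)) (fun p : R * R => sU p.1 p.2)).
  by apply: (@cvg_pair _ _ _ (nbhs z) (nbhs z) (nbhs e)); [exact: cvg_id|exact: cvg_cst].
exact: sU_cont.
Qed.

Let sL_measurable e : 0 < e -> measurable_fun setT (fun z => sL z e).
Proof.
move=> e0; apply: continuous_measurable_fun => z.
apply: (@continuous_comp _ _ _ (fun z => (z, e)) (fun p : R * R => sL p.1 p.2)).
  by apply: (@cvg_pair _ _ _ (nbhs z) (nbhs z) (nbhs e)); [exact: cvg_id|exact: cvg_cst].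
exact: sL_cont.
Qed.

Let D_measurable e l : 0 < e -> measurable (D e l).
Proof.
move=> e0; have [tl|tl] := boolP (tau e <= l); last first.
  have -> : D e l = set0; last exact: measurable0.
  by apply/seteqP; split => // w [tl' _]; rewrite tl' in tl.
have half (B : R -> R) (mB : measurable_fun setT B) :
  measurable [set w | V (Z e l w + rho * (B (Z e l w) - Z e l w)) <=
     (n e l)%:R * (B (Z e l w) - Z e l w) ^+ 2 / ln (1 / delta_ l)].
  have mz : measurable_fun setT (fun z : R => V (z + rho * (B z - z))).
    apply: (measurableT_comp V_measurable); apply: measurable_funD => //.
    by apply: measurable_funM => //; exact: measurable_funB.
  have mz' : measurable_fun setT (fun z : R => (n e l)%:R * (B z - z) ^+ 2 / ln (1 / delta_ l)).
    apply: measurable_funM => //; apply: measurable_funM => //.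
    by apply: measurable_funX; exact: measurable_funB.
  have mZ := @measurable_sample_mean _ _ _ P X (n e l).
  rewrite -[X in measurable X]setTI; apply: measurable_fun_le => //.
    exact: (measurableT_comp mz mZ).
  exact: (measurableT_comp mz' mZ).
have -> : D e l = [set w | V (Z e l w + rho * (sU (Z e l w) e - Z e l w)) <=
     (n e l)%:R * (sU (Z e l w) e - Z e l w) ^+ 2 / ln (1 / delta_ l)] `&`
   [set w | V (Z e l w + rho * (sL (Z e l w) e - Z e l w)) <=
     (n e l)%:R * (sL (Z e l w) e - Z e l w) ^+ 2 / ln (1 / delta_ l)].
  by apply/seteqP; split => w; [move=> [_ /andP[]]|move=> [h1 h2]; split => //; apply/andP].
by apply: measurableI; [exact: half (sU_measurable e0)|exact: half (sL_measurable e0)].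
Qed.

Let I_measurable e l : 0 < e -> measurable [set w | I e l w mu].
Proof.
move=> e0; have mZ := @measurable_sample_mean _ _ _ P X (n e l).
have -> : [set w | I e l w mu] =
    ~` [set w | mu <= L (Z e l w) e] `&` ~` [set w | U (Z e l w) e <= mu].
  apply/seteqP; split => w; rewrite /I /= in_itv /=.
    by move=> /andP[h1 h2]; split; apply/negP; rewrite -ltNge.
  by move=> [/negP h1 /negP h2]; rewrite !ltNge h1 h2.
apply: measurableI; apply: measurableC; rewrite -[X in measurable X]setTI;
  apply: measurable_fun_le => //.
  exact: (measurableT_comp (L_meas e0) mZ).
exact: (measurableT_comp (U_meas e0) mZ).
Qed.

Let SD_measurable e k : 0 < e -> measurable (SD e k).
Proof. by move=> e0; exact: D_measurable. Qed.

Let SI_measurable e k : 0 < e -> measurable (SI e k).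
Proof. by move=> e0; exact: I_measurable. Qed.

Let SIC_measurable e k : 0 < e -> measurable (~` SI e k).
Proof. by move=> e0; apply: measurableC; exact: SI_measurable. Qed.

Let SN_inc e k : 0 < e -> (SN e k < SN e k.+1)%N.
Proof.
move=> e0; rewrite /SN /stageN -[k.+1]addn1 PoszD addrA; apply: n_inc => //.
by rewrite lerDl.
Qed.

Let D_early e l : l < tau e -> D e l = set0.
Proof. by move=> lt; apply/seteqP; split => // w [tl _]; move: lt; rewrite ltNge tl. Qed.

Let size_first e k w : first_at (SD e) k w -> size_ e w = (SN e k)%:R%:E.
Proof. exact: stop_size_first. Qed.

Let size_never e w : (forall k, ~ SD e k w) -> size_ e w = +oo%E.
Proof. exact: stop_size_never. Qed.

Lemma expected_size_le_size_bound e : 0 < e -> (En e <= size_bound P (tau e) (D e) (n e))%E.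
Proof.
move=> e0; rewrite size_boundE; apply: expected_size_le_bound.
- by move=> k; exact: SD_measurable.
- by move=> k; exact: SN_inc.
- exact: size_first.
- exact: size_never.
Qed.

Lemma prob_stop_later_le e l : 0 < e ->
  (P [set w | (l%:~R%:E < idx e w)%E] <= P (~` D e l))%E.
Proof.
move=> e0; have [tl|lt] := leP (tau e) l; last first.
  by rewrite (D_early lt) setC0 /idx stop_index_ext_gt_early.
have [k ->] := stage_of tl; rewrite /idx stop_index_ext_gt.
by apply: not_yet_le => i; exact: SD_measurable.
Qed.

Let finite_size e : P [set w | (size_ e w < +oo)%E] = 1%E -> 0 < e -> P (never (SD e)) = 0%E.
Proof.
move=> P1 e0.
have mnv : measurable (never (SD e)) by apply: measurable_never => k; exact: SD_measurable.
have E : [set w | (size_ e w < +oo)%E] = ~` never (SD e).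
  apply/seteqP; split => w /=.
    by move=> + nv; rewrite size_never.
  move=> nnv; have [[k fk]|//] := first_at_or_never (SD e) w.
  by rewrite (size_first fk) ltry.
move: P1; rewrite E probability_setC// => h.
have pE : P (never (SD e)) = (fine (P (never (SD e))))%:E by rewrite fineK// fin_num_measure.
move: h; rewrite pE -EFinB => -[h]; congr _%:E; lra.
Qed.

Let P_covered e : 0 < e -> P (covered e) = P (stop_in (SD e) (SI e)).
Proof. by move=> e0; rewrite /covered covered_stop_in. Qed.

(** Never stopping counts as not covered, so the complement contains [never], which is discarded
    here as a null set. *)
Let P_uncovered e : 0 < e -> P (never (SD e)) = 0%E ->
  P (~` covered e) = P (stop_in (SD e) (fun k => ~` SI e k)).
Proof.
move=> e0 nv; have nv' : (P (never (SD e)) <= 0)%E by rewrite nv.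
have -> : ~` covered e = stop_in (SD e) (fun k => ~` SI e k) `|` never (SD e).
  by rewrite /covered covered_stop_in setC_stop_in.
have mS : measurable (stop_in (SD e) (fun k => ~` SI e k)).
  by apply: measurable_stop_in => k; [exact: SD_measurable|exact: SIC_measurable].
have mnv : measurable (never (SD e)) by apply: measurable_never => k; exact: SD_measurable.
apply/eqP; rewrite eq_le; apply/andP; split.
  by apply: le_trans (measureU2 P mS mnv) _; rewrite -[leRHS]adde0; apply: leeD => //; exact: nv'.
by apply: le_measure; rewrite ?inE//; exact: measurableU.
Qed.

Lemma uncovered_bounds e : 0 < e -> P [set w | (size_ e w < +oo)%E] = 1%E ->
  [/\ (P_lower P (tau e) (D e) (I e) mu <= P (~` covered e))%E,
      (P (~` covered e) <= P_upper P (tau e) (D e) (I e) mu)%E &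
      (P_upper P (tau e) (D e) (I e) mu <= Q_bound P (tau e) (D e) (I e) mu)%E].
Proof.
move=> e0 /finite_size /(_ e0) nv.
have mD k : measurable (SD e k) by exact: SD_measurable.
have mI k : measurable (SI e k) by exact: SI_measurable.
have mIC k : measurable (~` SI e k) by exact: SIC_measurable.
have mcov : measurable (covered e).
  by rewrite /covered covered_stop_in; apply: measurable_stop_in.
split.
- rewrite (P_lowerE P (I e) mu (@D_early e)) probability_setC// leeB// P_covered//.
  exact: stop_in_le.
- by rewrite (P_upperE P (I e) mu (@D_early e)) P_uncovered//; exact: stop_in_le.
- rewrite (P_upperE P (I e) mu (@D_early e)) (Q_boundE P (I e) mu (@D_early e)).
  exact: candidates_le_min_series.
Qed.

(** * The critical stage *)

Let j : int := odflt 0 (int_min [set l : int | 1 <= l /\ 1 < Lambda l]).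
(** The position of stage [j] once counting starts at stage 1, that is, for small e. *)
Let J : nat := `|j - 1|%N.
Let star := j = 1 \/ (1 < j /\ Lambda (j - 1) < 1).

Let Lambda_mono l m : l <= m -> Lambda l <= Lambda m.
Proof.
move=> lm; rewrite /Lambda ler_wpM2r ?invr_ge0 ?(ltW nu_gt0)// ler_wpM2l ?sqr_ge0//.
exact: C_mono.
Qed.

Let Lambda_smono l m : l < m -> Lambda l < Lambda m.
Proof.
move=> lm; rewrite /Lambda ltr_pM2r ?invr_gt0// ltr_pM2l ?exprn_gt0//.
exact: C_smono.
Qed.

(** The minimum exists because C tends to infinity, so the default 0 of [odflt] is never taken. *)
Let j_spec : [/\ 1 <= j, 1 < Lambda j & forall l : int, 1 <= l -> 1 < Lambda l -> j <= l].
Proof.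
have exQ : exists k : nat, 1 < Lambda (1 + k%:Z).
  (* Beyond this level Lambda is at least 2, hence strictly above 1. *)
  move/cvgryPge: C_dvg => /(_ (2 * nu / kappa mu ^+ 2)) [N _ hN].
  exists N; have h : 2 * nu / kappa mu ^+ 2 <= C (1 + N%:Z) by exact: (hN N.+1 (leqnSn N)).
  rewrite /Lambda ltr_pdivlMr// mul1r; move: h; rewrite ler_pdivrMr ?exprn_gt0// => h.
  by rewrite mulrC (lt_le_trans _ h)// mulr_natl mulr2n ltrDl.
case: (ex_minnP exQ) => m Lm mmin.
have lb l : 1 <= l -> 1 < Lambda l -> 1 + m%:Z <= l.
  move=> l1 Ll; have [k E] := stage_of l1; rewrite E lerD2l lez_nat mmin//.
  by rewrite -E.
have -> : j = 1 + m%:Z.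
  rewrite /j (@int_min_eq _ (1 + m%:Z))//=; last by move=> l [l1 Ll]; exact: lb.
by split => //; rewrite lerDl.
Qed.

Let jE : j = 1 + J%:Z.
Proof.
by have [j1 _ _] := j_spec; rewrite /J gez0_abs ?subr_ge0// [1 + _]addrC subrK.
Qed.

(** Minimality of [j] gives Lambda <= 1 at j - 1; strictness is gained one stage earlier from the
    strict growth of C. *)
Let Lambda_small k : (k < J.-1)%N -> Lambda (1 + k%:Z) < 1.
Proof.
move=> kJ; have J0 : (0 < J)%N by case: (J) kJ.
apply: (@lt_le_trans _ _ (Lambda (1 + J.-1%:Z))); first by apply: Lambda_smono; rewrite ltrD2l ltz_nat.
rewrite leNgt; apply/negP => h; have [_ _ /(_ (1 + J.-1%:Z))] := j_spec.
by rewrite lerDl/= => /(_ isT h); rewrite jE lerD2l lez_nat leqNgt prednK// leqnn.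
Qed.

Let Lambda_star : star -> forall k, (k < J)%N -> Lambda (1 + k%:Z) < 1.
Proof.
move=> st k kJ; case: st => [j1|[j1 Lj]]; first by move: kJ; rewrite /J j1.
apply: le_lt_trans Lj; apply: Lambda_mono.
by rewrite jE [1 + J%:Z]addrC addrK -PoszD add1n lez_nat.
Qed.

(** One radius for all stages from [j] on, which is what lets the infinite tail be bounded at
    once. *)
Let reject_far : exists2 r, 0 < r & \forall e \near (0 : R)^'+, forall l : int, j <= l ->
  ~` D e l `<=` [set w | r <= `|Z e l w - mu|].
Proof.
have [j1 Lj _] := j_spec; have [r r0 h] := accept j1 Lj; exists r => //.
near=> e; have t1 : tau e = 1 by near: e; exact: tau1.
have ha : forall z, `|z - mu| < r -> forall l : int, j <= l ->
  accepts V rho sL sU (n e l) (delta_ l) z e by near: e.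
move=> l jl w nD /=; rewrite leNgt; apply/negP => zr; apply: nD; split.
  by rewrite t1 (le_trans j1).
exact: ha.
Unshelve. all: by end_near. Qed.

Let T e := reject_tail P (SD e) (SN e) J.

Let T_le : exists2 K, 0 <= K & \forall e \near (0 : R)^'+, (T e <= (K * e)%:E)%E.
Proof.
have [r r0 hr] := reject_far.
have [q q1 hq] := ratio_lower C_gt0 C_ratio_inf.
have [M1 M10 h1] := ratio_upper C_gt0 C_ratio_sup.
have [M2 M20 h2] := ratio_upper Upsilon_gt0 Upsilon_ratio_sup.
have [K K0 hK] : exists2 K, 0 <= K & \forall e \near (0 : R)^'+,
    (reject_tail P (stageD 1 (D e)) (stageN 1 (n e)) J <= (K * e)%:E)%E.
  apply: (reject_tail_bound C_gt0 Upsilon_gt0 Upsilon_mono tau_lim n_gt0 n_lim tail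
      (r := r) (q := q) (M := M1 * M2)) => //.
  - exact: mulr_gt0.
  - exact: geometric_lower.
  - move=> k; rewrite mulrACA; apply: ler_pM => //; exact: ltW.
  - by rewrite -jE.
exists K => //; near=> e; rewrite /T /SD /SN.
have -> : tau e = 1 by near: e; exact: tau1.
by near: e.
Unshelve. all: by end_near. Qed.

Let T_ge0 e : (0 <= T e)%E.
Proof. by apply: nneseries_ge0 => k _ _; rewrite mule_ge0. Qed.

Let cvg_mul0 (K : R) : (K * e)%:E @[e --> (0 : R)^'+] --> 0%E.
Proof.
apply: cvg_EFin; first by near=> e.
rewrite -[X in _ --> X](mulr0 K); apply: cvgM; first exact: cvg_cst.
exact: cvg_at_right_filter.
Unshelve. all: by end_near. Qed.

Let T_cvg0 : T e @[e --> (0 : R)^'+] --> 0%E.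
Proof.
have [K K0 hK] := T_le.
apply: (@squeeze_cvge _ _ _ _ (fun=> 0%E) _ (fun e => (K * e)%:E)).
- by near=> e; rewrite T_ge0/=; near: e.
- exact: cvg_cst.
- exact: cvg_mul0.
Unshelve. all: by end_near. Qed.

Let DC_cvg0 l : j <= l -> P (~` D e l) @[e --> (0 : R)^'+] --> 0%E.
Proof.
move=> jl; have [r r0 hr] := reject_far; have [j1 _ _] := j_spec.
apply: (@squeeze_cvge _ _ _ _ (fun=> 0%E) _ (fun e => P [set w | (r <= `|Z e l w - mu|)%R])).
- near=> e; rewrite measure_ge0/=; apply: le_measure; rewrite ?inE.
  + by apply: measurableC; apply: D_measurable; near: e; exact: nbhs_right_gt.
  + exact: far_measurable.
  + by move: jl; move: (l); near: e.
- exact: cvg_cst.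
- exact: (far0 r0 (le_trans j1 jl)).
Unshelve. all: by end_near. Qed.

Let accept_far l : Theta° mu -> 1 <= l -> Lambda l < 1 ->
  exists2 r, 0 < r & \forall e \near (0 : R)^'+, D e l `<=` [set w | r <= `|Z e l w - mu|].
Proof.
move=> iT l1 Ll; have [r r0 hr] := reject l1 Ll iT; exists r => //.
near=> e => w [_ +] /=; rewrite leNgt; apply: contraPN => zr.
by apply/negP; apply/negPf; move: zr; move: (Z e l w); near: e.
Unshelve. all: by end_near. Qed.

Let D_cvg0 l : Theta° mu -> 1 <= l -> Lambda l < 1 ->
  P (D e l) @[e --> (0 : R)^'+] --> 0%E.
Proof.
move=> iT l1 Ll; have [r r0 hr] := accept_far iT l1 Ll.
apply: (@squeeze_cvge _ _ _ _ (fun=> 0%E) _ (fun e => P [set w | (r <= `|Z e l w - mu|)%R])).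
- near=> e; rewrite measure_ge0/=; apply: le_measure; rewrite ?inE.
  + by apply: D_measurable; near: e; exact: nbhs_right_gt.
  + exact: far_measurable.
  + by near: e.
- exact: cvg_cst.
- exact: (far0 r0 l1).
Unshelve. all: by end_near. Qed.

Let accept_sum_cvg0 m : Theta° mu -> (forall k, (k < m)%N -> Lambda (1 + k%:Z) < 1) ->
  accept_sum P (SD e) m @[e --> (0 : R)^'+] --> 0%E.
Proof.
move=> iT; elim: m => [_|m IH h].
  by rewrite /accept_sum; under eq_fun do rewrite big_geq//; exact: cvg_cst.
have hm : P (SD e m) @[e --> (0 : R)^'+] --> 0%E.
  apply: cvg_trans (D_cvg0 iT (l := 1 + m%:Z) _ (h m (ltnSn m))); last by rewrite lerDl.
  apply: near_eq_cvg; near=> e; rewrite /SD /stageD.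
  by have -> : tau e = 1 by near: e; exact: tau1.
rewrite -[X in _ --> X]adde0 /accept_sum; under eq_fun do rewrite big_nat_recr//=.
by apply: cvgeD => //; apply: IH => k km; apply: h; exact: ltnW.
Unshelve. all: by end_near. Qed.

Let En_le e : 0 < e -> (En e <= (SN e J)%:R%:E + T e)%E.
Proof.
move=> e0; apply: expected_size_le.
- by move=> k; exact: SD_measurable.
- by move=> k; exact: SN_inc.
- exact: size_first.
- exact: size_never.
Qed.

Let finite_En : \forall e \near (0 : R)^'+, (En e < +oo)%E.
Proof.
have [K K0 hK] := T_le; near=> e.
have e0 : 0 < e by near: e; exact: nbhs_right_gt.
apply: le_lt_trans (En_le e0) _; rewrite lte_add_pinfty ?ltry//.
by apply: (@le_lt_trans _ _ (K * e)%:E); [near: e|rewrite ltry].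
Unshelve. all: by end_near. Qed.

Let never0 e : 0 < e -> (En e < +oo)%E -> P (never (SD e)) = 0%E.
Proof.
move=> e0; apply: (@never_null _ _ _ P (SD e) (SN e)).
- by move=> k; exact: SD_measurable.
- by move=> k; exact: SN_inc.
- exact: size_first.
- exact: size_never.
Qed.

Lemma stops_almost_surely : \forall e \near (0 : R)^'+,
  P [set w | (size_ e w < +oo)%E] = 1%E /\ (En e < +oo)%E.
Proof.
near=> e; have e0 : 0 < e by near: e; exact: nbhs_right_gt.
have fin : (En e < +oo)%E by near: e; exact: finite_En.
split => //; have -> : [set w | (size_ e w < +oo)%E] = ~` never (SD e).
  apply/seteqP; split => w /=.
    by move=> + nv; rewrite size_never.
  move=> nnv; have [[k fk]|//] := first_at_or_never (SD e) w.
  by rewrite (size_first fk) ltry.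
rewrite probability_setC; last by apply: measurable_never => k; exact: SD_measurable.
by rewrite never0// sube0.
Unshelve. all: by end_near. Qed.

(** For each outcome the stage means are read along one convergent sequence at indices tending to
    infinity, so a single null set serves all stages and the continuous parameter e. *)
Let Z_cvg : \forall w \ae P, forall l : int, 1 <= l -> Z e l w @[e --> (0 : R)^'+] --> mu.
Proof.
have := sample_mean_SLLN X_iid nu_gt0 (dist_mean mu_Theta) law_var (dist_moment3 mu_Theta).
apply: filterS => w h l l1.
by apply: cvg_comp h; exact: (size_cvg_infty C_gt0 Upsilon_gt0 n_lim l1).
Qed.

Let near_close (w : Omega) (l : int) r : 0 < r -> Z e l w @[e --> (0 : R)^'+] --> mu ->
  \forall e \near (0 : R)^'+, ~ (r <= `|Z e l w - mu|).
Proof.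
move=> r0 /cvgrPdist_lt/(_ r r0); apply: filterS => e.
by rewrite distrC => h; apply/negP; rewrite -ltNge.
Qed.

Let near_accept (w : Omega) : Z e j w @[e --> (0 : R)^'+] --> mu ->
  \forall e \near (0 : R)^'+, SD e J w.
Proof.
move=> h; have [r r0 hr] := reject_far; near=> e.
rewrite /SD /stageD; have -> : tau e = 1 by near: e; exact: tau1.
rewrite -jE; apply: contrapT => nD.
have : r <= `|Z e j w - mu|.
  have H : forall l : int, j <= l -> ~` D e l `<=` [set w | r <= `|Z e l w - mu|] by near: e.
  exact: (H j).
by near: e; exact: near_close.
Unshelve. all: by end_near. Qed.

Let near_reject (w : Omega) m : Theta° mu ->
  (forall l : int, 1 <= l -> Z e l w @[e --> (0 : R)^'+] --> mu) ->
  (forall k, (k < m)%N -> Lambda (1 + k%:Z) < 1) ->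
  \forall e \near (0 : R)^'+, forall i, (i < m)%N -> ~ SD e i w.
Proof.
move=> iT h; elim: m => [_|m IH Lm]; first by near=> e.
have m1 : 1 <= 1 + m%:Z by rewrite lerDl.
have [r r0 hr] := accept_far iT m1 (Lm m (ltnSn m)).
have {}IH := IH (fun k km => Lm k (ltnW km)).
near=> e => i; rewrite ltnS leq_eqVlt => /predU1P[->|]; last by move: i; near: e.
rewrite /SD /stageD; have -> : tau e = 1 by near: e; exact: tau1.
move=> De; have : r <= `|Z e (1 + m%:Z) w - mu|.
  have H : D e (1 + m%:Z) `<=` [set w | r <= `|Z e (1 + m%:Z) w - mu|] by near: e.
  exact: H.
by near: e; apply: near_close => //; exact: h.
Unshelve. all: by end_near. Qed.

Let idx_le w : (forall l : int, 1 <= l -> Z e l w @[e --> (0 : R)^'+] --> mu) ->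
  \forall e \near (0 : R)^'+, (idx e w <= j%:~R%:E)%E.
Proof.
move=> h; have [j1 _ _] := j_spec; have hD := near_accept (h j j1).
near=> e; have te : tau e = 1 by near: e; exact: tau1.
by rewrite jE -[X in X + _]te; apply: stop_index_ext_le; near: e.
Unshelve. all: by end_near. Qed.

Let idx_ge w m : Theta° mu ->
  (forall l : int, 1 <= l -> Z e l w @[e --> (0 : R)^'+] --> mu) ->
  (forall k, (k < m)%N -> Lambda (1 + k%:Z) < 1) ->
  \forall e \near (0 : R)^'+, ((1 + m%:Z)%:~R%:E <= idx e w)%E.
Proof.
move=> iT h Lm; have hD := near_reject iT h Lm.
near=> e; have te : tau e = 1 by near: e; exact: tau1.
by rewrite -[X in X + _]te; apply: stop_index_ext_ge; near: e.
Unshelve. all: by end_near. Qed.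

Lemma stop_index_limits : Theta° mu ->
  {ae P, forall w,
    [/\ ((j - 1)%:~R%:E <= limf_einf (idx^~ w) (0 : R)^'+)%E,
        (limf_einf (idx^~ w) (0 : R)^'+ <= limf_esup (idx^~ w) (0 : R)^'+)%E &
        (limf_esup (idx^~ w) (0 : R)^'+ <= j%:~R%:E)%E]} /\
  (star -> {ae P, forall w, idx e w @[e --> (0 : R)^'+] --> (j%:~R)%:E}).
Proof.
move=> iT; split.
  move: Z_cvg; apply: filterS => w h; split.
  - have H := idx_ge iT h Lambda_small.
    apply: le_trans (le_limf_einf H); rewrite lee_fin ler_int jE.
    by rewrite [1 + J%:Z]addrC addrK -PoszD add1n lez_nat leqSpred.
  - exact: limf_einf_esup.
  - by apply: limf_esup_le; exact: idx_le.
move=> st; move: Z_cvg; apply: filterS => w h.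
have H1 := idx_ge iT h (Lambda_star st); have H2 := idx_le h.
apply: cvg_near_cst; near=> e; apply/eqP; rewrite eq_le; apply/andP; split.
  by near: e.
by rewrite jE; near: e.
Unshelve. all: by end_near. Qed.

(** * Coverage *)

Let near_prob x e l : \bar R :=
  P [set w | (`|Z e l w - mu| < x * Num.sqrt nu / Num.sqrt (n e l)%:R)%R].

Let near_prob_cvg x l : 0 < x -> 1 <= l ->
  fine (near_prob x e l) @[e --> (0 : R)^'+] --> 2 * normal_cdf x - 1.
Proof.
move=> x0 l1.
have h := sample_mean_clt X_iid nu_gt0 (dist_mean mu_Theta) law_var (dist_moment3 mu_Theta) x0.
by apply: cvg_comp h; exact: (size_cvg_infty C_gt0 Upsilon_gt0 n_lim l1).
Qed.

Let near_measurable x e l :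
  measurable [set w | `|Z e l w - mu| < x * Num.sqrt nu / Num.sqrt (n e l)%:R].
Proof.
have -> : [set w | `|Z e l w - mu| < x * Num.sqrt nu / Num.sqrt (n e l)%:R] =
    ~` [set w | x * Num.sqrt nu / Num.sqrt (n e l)%:R <= `|Z e l w - mu|].
  by apply/seteqP; split => w /=; rewrite ltNge => /negP.
by apply: measurableC; exact: far_measurable.
Qed.

Let sqrt_size_cvg l : 1 <= l ->
  e * Num.sqrt (n e l)%:R @[e --> (0 : R)^'+] --> Num.sqrt (C l * Upsilon l).
Proof.
move=> l1; have h := size_scaled_cvg Upsilon_gt0 C_gt0 n_lim l1.
have h2 : Num.sqrt (e ^+ 2 * (n e l)%:R) @[e --> (0 : R)^'+] --> Num.sqrt (C l * Upsilon l).
  by apply: (cvg_comp _ _ h); exact: sqrt_continuous.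
apply: cvg_trans h2; apply: near_eq_cvg; near=> e.
have e0 : 0 < e by near: e; exact: nbhs_right_gt.
by rewrite /= sqrtrM ?sqr_ge0// sqrtr_sqr gtr0_norm.
Unshelve. all: by end_near. Qed.

Let n_pos l : 1 <= l -> \forall e \near (0 : R)^'+, 0 < Num.sqrt (n e l)%:R :> R.
Proof.
move=> l1; near=> e; rewrite sqrtr_gt0 ltr0n; apply: n_gt0.
  by near: e; exact: nbhs_right_gt.
by have -> : tau e = 1 by near: e; exact: tau1.
Unshelve. all: by end_near. Qed.

Let xiE l : xi l = kappa mu * Num.sqrt (C l * Upsilon l) / Num.sqrt nu.
Proof. by rewrite /xi sqrtrM ?sqrtrV ?mulrA// ?ltW// mulr_gt0. Qed.

Let c_sqrt_gt0 l : 0 < Num.sqrt (C l * Upsilon l).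
Proof. by rewrite sqrtr_gt0 mulr_gt0. Qed.

Let xi_gt0 l : 0 < xi l.
Proof. by rewrite xiE; apply: divr_gt0; [exact: mulr_gt0|rewrite sqrtr_gt0]. Qed.

(** Close to mu the half-widths are at least (kappa - eta) e, while the radius of [near_prob] is
    about e times x sqrt nu / sqrt (C_l Upsilon_l). This factor is below kappa exactly when x <
    xi_l, and eta is half the difference. *)
Let coverage_ge l x : 1 <= l -> 0 < x -> x < xi l ->
  exists2 r, 0 < r & \forall e \near (0 : R)^'+,
   (near_prob x e l <= P [set w | I e l w mu] + P [set w | (r <= `|Z e l w - mu|)%R])%E.
Proof.
move=> l1 x0 xxi; set s := Num.sqrt nu; set c := Num.sqrt (C l * Upsilon l).
have s0 : 0 < s by rewrite sqrtr_gt0.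
have c0 : 0 < c := c_sqrt_gt0 l.
have xk : x * s / c < kappa mu by rewrite ltr_pdivrMr// -ltr_pdivlMr// -xiE.
pose eta := (kappa mu - x * s / c) / 2.
have eta0 : 0 < eta by rewrite /eta; lra.
have H : x * s < (kappa mu - eta) * c by rewrite -ltr_pdivrMr// /eta; lra.
have [r r0 hr] := half_width_near mu_Theta LU_lim eta0.
exists r => //; near=> e.
have e0 : 0 < e by near: e; exact: nbhs_right_gt.
have m0 : 0 < Num.sqrt (n e l)%:R :> R by near: e; exact: n_pos.
have He : x * s < (kappa mu - eta) * (e * Num.sqrt (n e l)%:R).
  near: e; apply: (cvgr_gt ((kappa mu - eta) * c)) => //.
  by apply: cvgM; [exact: cvg_cst|exact: sqrt_size_cvg].
have HZ : forall z, `|z - mu| < r ->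
  `|(z - L z e) / e - kappa mu| <= eta /\ `|(U z e - z) / e - kappa mu| <= eta by near: e.
apply: (le_trans _ (measureU2 P _ _)); [|exact: I_measurable|exact: far_measurable].
apply: le_measure; rewrite ?inE; first exact: near_measurable.
  by apply: measurableU; [exact: I_measurable|exact: far_measurable].
move=> w /=; have [zr|zr] := ltP `|Z e l w - mu| r; last by right.
move=> hw; left; have [h1 h2] := HZ _ zr.
have hw2 : `|Z e l w - mu| < (kappa mu - eta) * e.
  by apply: (lt_trans hw); rewrite ltr_pdivrMr// -mulrA.
have h3 : (kappa mu - eta) * e <= Z e l w - L (Z e l w) e.
  by rewrite -ler_pdivlMr//; move: h1; rewrite ler_norml; lra.
have h4 : (kappa mu - eta) * e <= U (Z e l w) e - Z e l w.
  by rewrite -ler_pdivlMr//; move: h2; rewrite ler_norml; lra.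
move: hw2; rewrite ltr_norml => /andP[h5 h6].
by rewrite /I /= in_itv /=; apply/andP; split; lra.
Unshelve. all: by end_near. Qed.

Let coverage_le l x : 1 <= l -> xi l < x ->
  exists2 r, 0 < r & \forall e \near (0 : R)^'+,
   (P [set w | I e l w mu] <= near_prob x e l + P [set w | (r <= `|Z e l w - mu|)%R])%E.
Proof.
move=> l1 xxi; set s := Num.sqrt nu; set c := Num.sqrt (C l * Upsilon l).
have s0 : 0 < s by rewrite sqrtr_gt0.
have c0 : 0 < c := c_sqrt_gt0 l.
have xk : kappa mu < x * s / c by rewrite ltr_pdivlMr// -ltr_pdivrMr// -xiE.
pose eta := (x * s / c - kappa mu) / 2.
have eta0 : 0 < eta by rewrite /eta; lra.
have H : (kappa mu + eta) * c < x * s by rewrite -ltr_pdivlMr// /eta; lra.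
have [r r0 hr] := half_width_near mu_Theta LU_lim eta0.
exists r => //; near=> e.
have e0 : 0 < e by near: e; exact: nbhs_right_gt.
have m0 : 0 < Num.sqrt (n e l)%:R :> R by near: e; exact: n_pos.
have He : (kappa mu + eta) * (e * Num.sqrt (n e l)%:R) < x * s.
  near: e; apply: (cvgr_lt ((kappa mu + eta) * c)) => //.
  by apply: cvgM; [exact: cvg_cst|exact: sqrt_size_cvg].
have HZ : forall z, `|z - mu| < r ->
  `|(z - L z e) / e - kappa mu| <= eta /\ `|(U z e - z) / e - kappa mu| <= eta by near: e.
apply: (le_trans _ (measureU2 P _ _)); [|exact: near_measurable|exact: far_measurable].
apply: le_measure; rewrite ?inE; first exact: I_measurable.
  by apply: measurableU; [exact: near_measurable|exact: far_measurable].
move=> w; have [zr|zr] := ltP `|Z e l w - mu| r; last by right.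
rewrite /I /= in_itv /= => /andP[h5 h6]; left; have [h1 h2] := HZ _ zr.
apply: (@lt_trans _ _ ((kappa mu + eta) * e)); last by rewrite ltr_pdivlMr// -mulrA.
have h3 : Z e l w - L (Z e l w) e <= (kappa mu + eta) * e.
  by rewrite -ler_pdivrMr//; move: h1; rewrite ler_norml; lra.
have h4 : U (Z e l w) e - Z e l w <= (kappa mu + eta) * e.
  by rewrite -ler_pdivrMr//; move: h2; rewrite ler_norml; lra.
by rewrite ltr_norml; apply/andP; split; lra.
Unshelve. all: by end_near. Qed.

Let coverage_cvg l : 1 <= l ->
  P [set w | I e l w mu] @[e --> (0 : R)^'+] --> (2 * normal_cdf (xi l) - 1)%:E.
Proof.
move=> l1; apply/fine_cvgP; split.
  by near=> e; apply: fin_num_measure; apply: I_measurable; near: e; exact: nbhs_right_gt.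
apply/cvgrPdist_le => eps eps0.
have cPhi := @normal_cdf_continuous R (xi l).
have e4 : 0 < eps / 4 by lra.
have [r [r0 hr]] : exists r, 0 < r /\
    forall x, `|x - xi l| < r -> `|normal_cdf x - normal_cdf (xi l)| < eps / 4.
  move/cvgrPdist_lt: cPhi => /(_ _ e4)/nbhs_ballP[r /= r0 hr]; exists r; split => // x xr.
  by rewrite distrC; apply: hr; rewrite /ball /= distrC.
(* [y <= r] keeps both comparison points within reach of continuity; [y <= xi l] keeps the lower one
   positive, as the limit theorem requires. *)
pose y := Num.min r (xi l).
have y0 : 0 < y by rewrite lt_min r0 xi_gt0.
have [yr yx] : y <= r /\ y <= xi l by split; rewrite ge_min lexx ?orbT.
have x10 : 0 < xi l - y / 2 by lra.
have x1l : xi l - y / 2 < xi l by lra.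
have x2l : xi l < xi l + y / 2 by lra.
have x20 : 0 < xi l + y / 2 by lra.
have [r1 r10 hr1] := coverage_ge l1 x10 x1l.
have [r2 r20 hr2] := coverage_le l1 x2l.
have /fine_cvgP[_ f1] := far0 r10 l1; have /fine_cvgP[_ f2] := far0 r20 l1.
have g1 := near_prob_cvg x10 l1; have g2 := near_prob_cvg x20 l1.
have k1 : `|normal_cdf (xi l - y / 2) - normal_cdf (xi l)| < eps / 4.
  by apply: hr; rewrite addrAC subrr add0r normrN gtr0_norm; lra.
have k2 : `|normal_cdf (xi l + y / 2) - normal_cdf (xi l)| < eps / 4.
  by apply: hr; rewrite addrAC subrr add0r gtr0_norm; lra.
move: k1 k2; rewrite !ltr_norml => /andP[k1 k1'] /andP[k2 k2'].
near=> e.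
have e0 : 0 < e by near: e; exact: nbhs_right_gt.
have p1 : (near_prob (xi l - y / 2) e l <= P [set w | I e l w mu] + P [set w | (r1 <= `|Z e l w - mu|)%R])%E.
  by near: e.
have p2 : (P [set w | I e l w mu] <= near_prob (xi l + y / 2) e l + P [set w | (r2 <= `|Z e l w - mu|)%R])%E.
  by near: e.
have q1 : fine (P [set w | (r1 <= `|Z e l w - mu|)%R]) < eps / 4.
  by near: e; exact: (cvgr_lt _ f1).
have q2 : fine (P [set w | (r2 <= `|Z e l w - mu|)%R]) < eps / 4.
  by near: e; exact: (cvgr_lt _ f2).
have s1 : 2 * normal_cdf (xi l - y / 2) - 1 - eps / 4 < fine (near_prob (xi l - y / 2) e l).
  near: e; apply: (cvgr_gt _ g1); lra.
have s2 : fine (near_prob (xi l + y / 2) e l) < 2 * normal_cdf (xi l + y / 2) - 1 + eps / 4.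
  near: e; apply: (cvgr_lt _ g2); lra.
have fI : P [set w | I e l w mu] \is a fin_num by apply: fin_num_measure; exact: I_measurable.
have fn x : near_prob x e l \is a fin_num by apply: fin_num_measure; exact: near_measurable.
have ff r' : P [set w | r' <= `|Z e l w - mu|] \is a fin_num.
  by apply: fin_num_measure; exact: far_measurable.
move: p1 p2; rewrite -(fineK (fn _)) -(fineK fI) -(fineK (ff r1)) -EFinD lee_fin => p1.
rewrite -(fineK (fn _)) -(fineK (ff r2)) -EFinD lee_fin => p2.
rewrite /=; move: (fine _) (fine _) (fine _) (fine _) (fine _) (normal_cdf _)
  (normal_cdf _) (normal_cdf _) (p1) (p2) (q1) (q2) (s1) (s2) (k1) (k1') (k2) (k2').
exact: perturbed_bounds.
Unshelve. all: by end_near. Qed.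

Let SI_cvg k : P (SI e k) @[e --> (0 : R)^'+] --> (2 * normal_cdf (xi (1 + k%:Z)) - 1)%:E.
Proof.
apply: cvg_trans (coverage_cvg (l := 1 + k%:Z) _); last by rewrite lerDl.
apply: near_eq_cvg; near=> e; rewrite /SI /stageI.
by have -> : tau e = 1 by near: e; exact: tau1.
Unshelve. all: by end_near. Qed.

Let SIC_cvg k :
  P (~` SI e k) @[e --> (0 : R)^'+] --> (1 - (2 * normal_cdf (xi (1 + k%:Z)) - 1))%:E.
Proof.
have h : (1 - P (SI e k))%E @[e --> (0 : R)^'+] -->
    (1 - (2 * normal_cdf (xi (1 + k%:Z)) - 1))%:E.
  by rewrite EFinB; apply: cvgeB => //; exact: cvg_cst.
apply: cvg_trans h; apply: near_eq_cvg; near=> e; rewrite probability_setC//; apply: SI_measurable.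
by near: e; exact: nbhs_right_gt.
Unshelve. all: by end_near. Qed.

Let SDC_cvg0 : P (~` SD e J) @[e --> (0 : R)^'+] --> 0%E.
Proof.
apply: cvg_trans (DC_cvg0 (lexx j)); apply: near_eq_cvg; near=> e; rewrite /SD /stageD.
by have -> : tau e = 1 by [near: e; exact: tau1]; rewrite -jE.
Unshelve. all: by end_near. Qed.

Let accept_sum_pred_cvg0 : Theta° mu ->
  accept_sum P (SD e) J.-1 @[e --> (0 : R)^'+] --> 0%E.
Proof. by move=> iT; apply: accept_sum_cvg0 => // k; exact: Lambda_small. Qed.

Let accept_sum_star_cvg0 : Theta° mu -> star ->
  accept_sum P (SD e) J @[e --> (0 : R)^'+] --> 0%E.
Proof. by move=> iT st; apply: accept_sum_cvg0 => // k; exact: Lambda_star. Qed.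

Let covered_measurable e : 0 < e -> measurable (covered e).
Proof.
move=> e0; rewrite /covered covered_stop_in; apply: measurable_stop_in => k.
  exact: SD_measurable.
exact: SI_measurable.
Qed.

Let covered_cvg : Theta° mu -> star ->
  P (covered e) @[e --> (0 : R)^'+] --> (2 * normal_cdf (xi j) - 1)%:E.
Proof.
move=> iT st; have a0 := accept_sum_star_cvg0 iT st.
have d0 := SDC_cvg0; have c0 := @SI_cvg J; rewrite -jE in c0.
have ad : (accept_sum P (SD e) J + P (~` SD e J))%E @[e --> (0 : R)^'+] --> 0%E.
  by rewrite -[X in _ --> X]adde0; apply: cvgeD.
apply: (@squeeze_cvge _ _ _ _
  (fun e => P (SI e J) - (accept_sum P (SD e) J + P (~` SD e J)))%E _
  (fun e => P (SI e J) + (accept_sum P (SD e) J + P (~` SD e J)))%E).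
- near=> e; have e0 : 0 < e by near: e; exact: nbhs_right_gt.
  have mD k : measurable (SD e k) by exact: SD_measurable.
  have mI k : measurable (SI e k) by exact: SI_measurable.
  rewrite P_covered// leeBlDr; last first.
    by rewrite fin_numD accept_sum_fin// fin_num_measure//; exact: measurableC.
  by rewrite !addeA; apply/andP; split; [exact: stop_in_ge|exact: stop_in_le2].
- by rewrite -[X in _ --> X]sube0; apply: cvgeB.
- by rewrite -[X in _ --> X]adde0; apply: cvgeD.
Unshelve. all: by end_near. Qed.

(** Stopping at j - 1 or j is all that is known in general, so non-coverage is bounded by the sum of
    its probabilities at both stages; the limit is 1 - (2 - 2 Phi(xi_{j-1})) - (2 - 2 Phi(xi_j)). *)
Lemma coverage_limits : Theta° mu ->
  ((2 * (normal_cdf (xi (j - 1)) + normal_cdf (xi j)) - 3)%:E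
      <= limf_einf (fun e => P (covered e)) (0 : R)^'+)%E /\
  (star -> P (covered e) @[e --> (0 : R)^'+] --> (2 * normal_cdf (xi j) - 1)%:E).
Proof.
move=> iT; split; last exact: covered_cvg.
(* For j = 1 no stage precedes [j]; the condition star holds, and Phi <= 1 derives the bound from
   the exact limit. *)
have [J0|J0] := posnP J.
  have st : star by left; rewrite jE J0 addr0.
  apply: (@le_trans _ _ (2 * normal_cdf (xi j) - 1)%:E).
    by rewrite lee_fin; have := normal_cdf_le1 (xi (j - 1)); lra.
  by apply: (cvg_le_limf_einf _ (covered_cvg iT st)); near=> e.
have j1E : j - 1 = 1 + J.-1%:Z.
  by rewrite jE [1 + _]addrC addrK -PoszD add1n prednK.
have c1 := @SIC_cvg J.-1; rewrite -j1E in c1.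
have c2 := @SIC_cvg J; rewrite -jE in c2.
set g := fun e => (1 - (P (~` SI e J.-1) + P (~` SI e J) + accept_sum P (SD e) J.-1 +
  P (~` SD e J)))%E.
have gl : g e @[e --> (0 : R)^'+] -->
    (2 * (normal_cdf (xi (j - 1)) + normal_cdf (xi j)) - 3)%:E.
  have -> : (2 * (normal_cdf (xi (j - 1)) + normal_cdf (xi j)) - 3)%:E =
     (1 - ((1 - (2 * normal_cdf (xi (j - 1)) - 1))%:E +
       (1 - (2 * normal_cdf (xi j) - 1))%:E + 0 + 0))%E :> \bar R.
    rewrite !adde0; apply: (@etrans _ _ (1 - ((1 - (2 * normal_cdf (xi (j - 1)) - 1)) +
      (1 - (2 * normal_cdf (xi j) - 1))))%:E) => //; congr _%:E; lra.
  apply: cvgeB => //; first exact: cvg_cst.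
  apply: cvgeD => //; apply: cvgeD => //; last exact: accept_sum_pred_cvg0.
  by apply: (cvgeD _ c1 c2).
apply: (cvg_le_limf_einf _ gl); near=> e.
have e0 : 0 < e by near: e; exact: nbhs_right_gt.
have fin : (En e < +oo)%E by near: e; exact: finite_En.
have mD k : measurable (SD e k) by exact: SD_measurable.
have mIC k : measurable (~` SI e k) by exact: SIC_measurable.
have h := stop_in_le3 P mD mIC J0.
have := P_uncovered e0 (never0 e0 fin); rewrite probability_setC; last exact: covered_measurable.
have /fineK <- : P (covered e) \is a fin_num by apply: fin_num_measure; exact: covered_measurable.
move=> h2; rewrite /g leeBlDr; last first.
  by rewrite !fin_numD accept_sum_fin// !fin_num_measure//; exact: measurableC.
rewrite -leeBlDl//; apply: le_trans h; rewrite -h2.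
by [].
Unshelve. all: by end_near. Qed.

(** * Limits of the expected size and of the error bounds *)

Let Zq : R := normal_quantile (1 - delta / 2).
Let NN (e : R) := nu * Zq ^+ 2 / (kappa mu * e) ^+ 2.
(** Chosen so that 1 / NN(e) = a e^2: dividing by the reference size becomes a multiplication. *)
Let a := kappa mu ^+ 2 / (nu * Zq ^+ 2).

Let Zq_neq0 : Zq != 0.
Proof. by apply: normal_quantile_neq0; have := delta01; lra. Qed.

Let Zq2_gt0 : 0 < Zq ^+ 2.
Proof. by rewrite lt_neqAle sqr_ge0 andbT eq_sym expf_neq0. Qed.

Let a_gt0 : 0 < a.
Proof. by apply: divr_gt0; [exact: exprn_gt0|exact: mulr_gt0]. Qed.

Let xi_ratio l : (xi l / Zq) ^+ 2 = a * (C l * Upsilon l).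
Proof.
have c0 : 0 <= C l * Upsilon l / nu by rewrite divr_ge0 ?mulr_ge0// ltW.
rewrite /xi expr_div_n exprMn sqr_sqrtr// /a; field.
by rewrite Zq_neq0 gt_eqF.
Qed.

Let div_NN (x : \bar R) e : 0 < e -> (x / (NN e)%:E = x * (a * e ^+ 2)%:E)%E.
Proof.
move=> e0; have NN0 : NN e != 0.
  by rewrite gt_eqF//; apply: divr_gt0; [exact: mulr_gt0|apply: exprn_gt0; exact: mulr_gt0].
rewrite inver (negbTE NN0); congr (_ * _%:E)%E; rewrite /NN /a; field.
by rewrite Zq_neq0 !gt_eqF.
Qed.

Let En_scaled_ge m : Theta° mu -> (forall k, (k < m)%N -> Lambda (1 + k%:Z) < 1) ->
  exists2 g : R -> \bar R,
    g e @[e --> (0 : R)^'+] --> (a * (C (1 + m%:Z) * Upsilon (1 + m%:Z)))%:E &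
    \forall e \near (0 : R)^'+, (g e <= En e / (NN e)%:E)%E.
Proof.
move=> iT Lm; have m1 : 1 <= 1 + m%:Z by rewrite lerDl.
exists (fun e => (a * (e ^+ 2 * (n e (1 + m%:Z))%:R))%:E * (1 - accept_sum P (SD e) m))%E.
  rewrite -[X in _ --> X]mule1; apply: cvgeM => //.
    apply: cvg_EFin; first by near=> e.
    by apply: cvgM; [exact: cvg_cst|exact: (size_scaled_cvg Upsilon_gt0 C_gt0 n_lim m1)].
  rewrite -[X in _ --> X]sube0; apply: cvgeB => //; first exact: cvg_cst.
  exact: accept_sum_cvg0.
near=> e; have e0 : 0 < e by near: e; exact: nbhs_right_gt.
have te : tau e = 1 by near: e; exact: tau1.
have mD k : measurable (SD e k) by exact: SD_measurable.
have Ni k : (SN e k < SN e k.+1)%N by exact: SN_inc.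
have h : ((SN e m)%:R%:E * (1 - accept_sum P (SD e) m) <= En e)%E.
  by apply: expected_size_ge => //; [exact: size_first|exact: size_never].
have aee : 0 <= a * e ^+ 2 by rewrite mulr_ge0 ?sqr_ge0// ltW.
rewrite div_NN// muleC; apply: (le_trans _ (lee_wpmul2r _ h)); last by rewrite lee_fin.
rewrite muleAC -EFinM muleC /SN /stageN te.
by have -> : (n e (1 + m%:Z))%:R * (a * e ^+ 2) = a * (e ^+ 2 * (n e (1 + m%:Z))%:R) by ring.
Unshelve. all: by end_near. Qed.

Let En_scaled_le : exists2 g : R -> \bar R,
    g e @[e --> (0 : R)^'+] --> (a * (C j * Upsilon j))%:E &
    \forall e \near (0 : R)^'+, (En e / (NN e)%:E <= g e)%E.
Proof.
have [K K0 hK] := T_le; have [j1 _ _] := j_spec.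
exists (fun e => (a * (e ^+ 2 * (n e j)%:R + K * e * (e * e)))%:E).
  apply: cvg_EFin; first by near=> e.
  apply: cvgM; first exact: cvg_cst.
  rewrite -[X in _ --> X]addr0; apply: cvgD.
    exact: (size_scaled_cvg Upsilon_gt0 C_gt0 n_lim j1).
  have e0 : e @[e --> (0 : R)^'+] --> (0 : R) by exact: cvg_at_right_filter.
  rewrite -[X in _ --> X](mulr0 (K * 0)); apply: cvgM; first by apply: cvgM => //; exact: cvg_cst.
  by rewrite -[X in _ --> X](mulr0 0); exact: cvgM.
near=> e; have e0 : 0 < e by near: e; exact: nbhs_right_gt.
have te : tau e = 1 by near: e; exact: tau1.
have Tle : (T e <= (K * e)%:E)%E by near: e.
have aee : 0 <= a * e ^+ 2 by rewrite mulr_ge0 ?sqr_ge0// ltW.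
have h : (En e <= ((n e j)%:R + K * e)%:E)%E.
  apply: le_trans (En_le e0) _; rewrite EFinD; apply: leeD => //.
  by rewrite /SN /stageN te -jE.
rewrite div_NN//; apply: (le_trans (lee_wpmul2r _ h)); first by rewrite lee_fin.
rewrite -EFinM lee_fin.
by have -> : ((n e j)%:R + K * e) * (a * e ^+ 2) = a * (e ^+ 2 * (n e j)%:R + K * e * (e * e)) by ring.
Unshelve. all: by end_near. Qed.

Let C_Upsilon_mono l : C l * Upsilon l <= C (l + 1) * Upsilon (l + 1).
Proof. by apply: ler_pM => //; exact: ltW. Qed.

Lemma expected_size_limits : Theta° mu ->
  [/\ (((xi (j - 1) / Zq) ^+ 2)%:E
         <= limf_einf (fun e => En e / (NN e)%:E) (0 : R)^'+)%E,
      (limf_einf (fun e => En e / (NN e)%:E) (0 : R)^'+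
         <= limf_esup (fun e => En e / (NN e)%:E) (0 : R)^'+)%E,
      (limf_esup (fun e => En e / (NN e)%:E) (0 : R)^'+
         <= ((xi j / Zq) ^+ 2)%:E)%E &
      star -> (En e / (NN e)%:E)%E @[e --> (0 : R)^'+] --> ((xi j / Zq) ^+ 2)%:E].
Proof.
move=> iT; have [gu gul hgu] := En_scaled_le; split.
- have [gl gll hgl] := En_scaled_ge iT Lambda_small.
  apply: le_trans (cvg_le_limf_einf _ gll hgl); rewrite lee_fin xi_ratio ler_wpM2l ?(ltW a_gt0)//.
  have jm1 : j - 1 = J%:Z by rewrite jE [1 + _]addrC addrK.
  (* For J = 0 the bound refers to stage 1, as [J.-1] is 0, while the claim refers to stage 0;
     monotonicity of C Upsilon bridges them. *)
  rewrite jm1; case: (posnP J) => [->|J0]; last by rewrite -PoszD add1n prednK.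
  by rewrite /= addr0 -[X in _ <= C X * _]add0r -[X in _ <= _ * Upsilon X]add0r.
- exact: limf_einf_esup.
- by rewrite xi_ratio; exact: (cvg_limf_esup_le _ gul hgu).
move=> st; have [gl gll hgl] := En_scaled_ge iT (Lambda_star st).
rewrite xi_ratio; rewrite -jE in gll; apply: (squeeze_cvge _ gll gul).
by near=> e; apply/andP; split; near: e.
Unshelve. all: by end_near. Qed.

(** Three ranges: for l < 1 both events are certain; for 1 <= l < j they differ by acceptances
    before [l], hence before j - 1; for l >= j both probabilities vanish in the limit. *)
Lemma prob_stop_later_limit l : Theta° mu ->
  (P (~` D e l) - P [set w | (l%:~R%:E < idx e w)%E])%E @[e --> (0 : R)^'+] --> 0%E.
Proof.
move=> iT; have [l1|l1] := ltP l 1.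
  apply: cvg_near_cst; near=> e; have te : tau e = 1 by near: e; exact: tau1.
  have lt : l < tau e by rewrite te.
  rewrite D_early// /idx stop_index_ext_gt_early// setC0 probability_setT.
  by rewrite -EFinB subrr.
have [k kE] := stage_of l1; rewrite {}kE.
have [g g0 hg] : exists2 g : R -> \bar R, g e @[e --> (0 : R)^'+] --> 0%E &
    \forall e \near (0 : R)^'+, (P (~` SD e k) - P (not_yet (SD e) k) <= g e)%E.
  have fny e : 0 < e -> P (not_yet (SD e) k) \is a fin_num.
    by move=> e0; apply: fin_num_measure; apply: measurable_not_yet => i; exact: SD_measurable.
  have [kJ|Jk] := ltnP k J.
    exists (fun e => accept_sum P (SD e) k).
      apply: accept_sum_cvg0 => // i ik; apply: Lambda_small.
      by rewrite (leq_trans ik)// -ltnS prednK// (leq_ltn_trans _ kJ).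
    near=> e; have e0 : 0 < e by near: e; exact: nbhs_right_gt.
    by rewrite leeBlDl ?fny//; apply: rejectC_le => i; exact: SD_measurable.
  exists (fun e => P (~` D e (1 + k%:Z))).
    by apply: DC_cvg0; rewrite jE lerD2l lez_nat.
  near=> e; have e0 : 0 < e by near: e; exact: nbhs_right_gt.
  have te : tau e = 1 by near: e; exact: tau1.
  by rewrite /SD /stageD te leeBlDr ?leeDl// -[1]te; exact: fny.
apply: (@squeeze_cvge _ _ _ _ (fun=> 0%E) _ g) => //; last exact: cvg_cst.
near=> e; have e0 : 0 < e by near: e; exact: nbhs_right_gt.
have te : tau e = 1 by near: e; exact: tau1.
have hge : (P (~` SD e k) - P (not_yet (SD e) k) <= g e)%E by near: e.
have mD i : measurable (SD e i) by exact: SD_measurable.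
have fny : P (not_yet (SD e) k) \is a fin_num.
  by apply: fin_num_measure; exact: measurable_not_yet.
rewrite -te /idx stop_index_ext_gt -/(SD e) hge andbT sube_ge0 ?fny//.
exact: not_yet_le.
Unshelve. all: by end_near. Qed.

Let excess_cvg0 (x y g : R -> \bar R) : g e @[e --> (0 : R)^'+] --> 0%E ->
  (\forall e \near (0 : R)^'+, x e \is a fin_num) ->
  (\forall e \near (0 : R)^'+, (x e <= y e)%E) ->
  (\forall e \near (0 : R)^'+, (y e <= x e + g e)%E) ->
  (y e - x e)%E @[e --> (0 : R)^'+] --> 0%E.
Proof.
move=> g0 xfin xy yg; apply: (@squeeze_cvge _ _ _ _ (fun=> 0%E) _ g) => //; last exact: cvg_cst.
near=> e; have xf : x e \is a fin_num by near: e.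
by rewrite sube_ge0 ?xf// leeBlDl//; apply/andP; split; near: e.
Unshelve. all: by end_near. Qed.

Let dist_above_cvg0 (x y : R -> \bar R) : (y e - x e)%E @[e --> (0 : R)^'+] --> 0%E ->
  (\forall e \near (0 : R)^'+, x e \is a fin_num) ->
  (\forall e \near (0 : R)^'+, (x e <= y e)%E) ->
  `|x e - y e|%E @[e --> (0 : R)^'+] --> 0%E.
Proof.
move=> yx xfin xy; apply: cvg_trans yx; apply: near_eq_cvg; near=> e.
have xf : x e \is a fin_num by near: e.
have h : (x e <= y e)%E by near: e.
have -> : (x e - y e = - (y e - x e))%E by rewrite fin_num_oppeB// addeC.
by rewrite abseN gee0_abs// sube_ge0 ?xf.
Unshelve. all: by end_near. Qed.

Let dist_below_cvg0 (x y : R -> \bar R) : (x e - y e)%E @[e --> (0 : R)^'+] --> 0%E ->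
  (\forall e \near (0 : R)^'+, y e \is a fin_num) ->
  (\forall e \near (0 : R)^'+, (y e <= x e)%E) ->
  `|x e - y e|%E @[e --> (0 : R)^'+] --> 0%E.
Proof.
move=> yx xfin xy; apply: cvg_trans yx; apply: near_eq_cvg; near=> e.
have xf : y e \is a fin_num by near: e.
have h : (y e <= x e)%E by near: e.
by rewrite gee0_abs// sube_ge0 ?xf.
Unshelve. all: by end_near. Qed.

(** The error of [candidates_le], used both for the intervals and for their complements; it avoids
    stage j - 1, so its limit does not depend on the condition star. *)
Let excess e : \bar R := ((J.+1)%:R%:E * accept_sum P (SD e) J.-1 + T e)%E.

Let excess0 : Theta° mu -> excess e @[e --> (0 : R)^'+] --> 0%E.
Proof.
move=> iT; rewrite -[X in _ --> X]adde0; apply: cvgeD => //.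
rewrite -[X in _ --> X](mule0 (J.+1)%:R%:E); apply: cvgeM => //; first exact: cvg_cst.
exact: accept_sum_pred_cvg0.
Qed.

Lemma uncovered_limits : Theta° mu ->
  [/\ `|P (~` covered e) - P_upper P (tau e) (D e) (I e) mu|%E @[e --> (0 : R)^'+] --> 0%E,
      `|P (~` covered e) - P_lower P (tau e) (D e) (I e) mu|%E @[e --> (0 : R)^'+] --> 0%E &
      star -> (Q_bound P (tau e) (D e) (I e) mu - P (~` covered e))%E
        @[e --> (0 : R)^'+] --> 0%E].
Proof.
move=> iT.
have fincov : \forall e \near (0 : R)^'+, P (~` covered e) \is a fin_num.
  near=> e; apply: fin_num_measure; apply: measurableC; apply: covered_measurable.
  by near: e; exact: nbhs_right_gt.
have bounds : \forall e \near (0 : R)^'+,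
    [/\ (P_lower P (tau e) (D e) (I e) mu <= P (~` covered e))%E,
        (P (~` covered e) <= P_upper P (tau e) (D e) (I e) mu)%E &
        (P_upper P (tau e) (D e) (I e) mu <= Q_bound P (tau e) (D e) (I e) mu)%E].
  near=> e; apply: uncovered_bounds; first by near: e; exact: nbhs_right_gt.
  suff [] : P [set w | (size_ e w < +oo)%E] = 1%E /\ (En e < +oo)%E by [].
  by near: e; exact: stops_almost_surely.
have unc : \forall e \near (0 : R)^'+,
    P (~` covered e) = P (stop_in (SD e) (fun k => ~` SI e k)).
  near=> e; have e0 : 0 < e by near: e; exact: nbhs_right_gt.
  by apply: P_uncovered => //; apply: never0 => //; near: e; exact: finite_En.
have up1 : \forall e \near (0 : R)^'+, (P (~` covered e) <= P_upper P (tau e) (D e) (I e) mu)%E.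
  by apply: filterS bounds => e [].
have low1 : \forall e \near (0 : R)^'+, (P_lower P (tau e) (D e) (I e) mu <= P (~` covered e))%E.
  by apply: filterS bounds => e [].
have q1 : \forall e \near (0 : R)^'+, (P (~` covered e) <= Q_bound P (tau e) (D e) (I e) mu)%E.
  by apply: filterS bounds => e [_]; exact: le_trans.
split.
- apply: dist_above_cvg0 => //; apply: (excess_cvg0 (excess0 iT)) => //.
  near=> e; have e0 : 0 < e by near: e; exact: nbhs_right_gt.
  have -> : P (~` covered e) = P (stop_in (SD e) (fun k => ~` SI e k)) by near: e.
  rewrite (P_upperE P (I e) mu (@D_early e)) /excess addeA; apply: candidates_le => k.
  + exact: SD_measurable.
  + exact: SN_inc.
  + exact: SIC_measurable.
- have /fine_cvgP[gfin _] := excess0 iT.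
  have sum_le : \forall e \near (0 : R)^'+,
      (\sum_(k <oo) P (candidate (SD e) (SI e) k) <= P (covered e) + excess e)%E.
    near=> e; have e0 : 0 < e by near: e; exact: nbhs_right_gt.
    rewrite P_covered// /excess addeA; apply: candidates_le => k.
    + exact: SD_measurable.
    + exact: SN_inc.
    + exact: SI_measurable.
  (* Finiteness of the series comes from the upper bound just proved, and permits the subtractions
     in the extended reals. *)
  have lowfin : \forall e \near (0 : R)^'+,
      (\sum_(k <oo) P (candidate (SD e) (SI e) k))%E \is a fin_num /\
      P (covered e) \is a fin_num.
    near=> e; have e0 : 0 < e by near: e; exact: nbhs_right_gt.
    have fc : P (covered e) \is a fin_num.
      by apply: fin_num_measure; exact: covered_measurable.
    have fe : excess e \is a fin_num by near: e.
    split => //; rewrite ge0_fin_numE; last exact: nneseries_ge0.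
    apply: (@le_lt_trans _ _ (P (covered e) + excess e)%E); first by near: e.
    by rewrite ltey_eq fin_numD fc fe.
  apply: dist_below_cvg0 => //; last first.
    near=> e; rewrite (P_lowerE P (I e) mu (@D_early e)) fin_numB/=.
    suff [] : (\sum_(k <oo) P (candidate (SD e) (SI e) k))%E \is a fin_num /\
      P (covered e) \is a fin_num by [].
    by near: e.
  apply: (excess_cvg0 (excess0 iT)) => //.
    near=> e; rewrite (P_lowerE P (I e) mu (@D_early e)) fin_numB/=.
    suff [] : (\sum_(k <oo) P (candidate (SD e) (SI e) k))%E \is a fin_num /\
      P (covered e) \is a fin_num by [].
    by near: e.
  near=> e; have e0 : 0 < e by near: e; exact: nbhs_right_gt.
  rewrite (P_lowerE P (I e) mu (@D_early e)) probability_setC; last exact: covered_measurable.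
  have fe : excess e \is a fin_num by near: e.
  have [fs fc] : (\sum_(k <oo) P (candidate (SD e) (SI e) k))%E \is a fin_num /\
      P (covered e) \is a fin_num by near: e.
  have : (\sum_(k <oo) P (candidate (SD e) (SI e) k) <= P (covered e) + excess e)%E by near: e.
  rewrite -/(SD e) -/(SI e); move: fe fs fc; move: (excess e) (P (covered e)) (limn _).
  by move=> [x| |]// [y| |]// [z| |]// _ _ _; rewrite !lee_fin => h; lra.
- move=> st; have a0 := accept_sum_star_cvg0 iT st.
  (* The comparison passes through stage J alone: [min_series_le] bounds Q by the non-coverage at J,
     and [stop_in_ge] bounds the latter by the non-coverage at the stopping stage. *)
  have g0 : (accept_sum P (SD e) J + P (~` SD e J) + (accept_sum P (SD e) J + T e))%E
      @[e --> (0 : R)^'+] --> 0%E.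
    by rewrite -[X in _ --> X]adde0; apply: cvgeD => //;
      rewrite -[X in _ --> X]adde0; apply: cvgeD.
  apply: (excess_cvg0 g0) => //.
  near=> e; have e0 : 0 < e by near: e; exact: nbhs_right_gt.
  have mD k : measurable (SD e k) by exact: SD_measurable.
  have mI k : measurable (~` SI e k) by exact: SIC_measurable.
  have Ni k : (SN e k < SN e k.+1)%N by exact: SN_inc.
  have -> : P (~` covered e) = P (stop_in (SD e) (fun k => ~` SI e k)) by near: e.
  rewrite (Q_boundE P (I e) mu (@D_early e)); apply: (le_trans (min_series_le P (SD e) J Ni (fun k => ~` SI e k))).
  by rewrite !addeA leeD2r// leeD2r//; exact: stop_in_ge.
Unshelve. all: by end_near. Qed.

(** The expected size is at least the first size, of order e^(-2). Dividing by it leaves a bounded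
    multiple of [accept_sum J.-1] from the early stages and of [T] from the tail. *)
Lemma size_bound_limit : Theta° mu ->
  (1 / En e * size_bound P (tau e) (D e) (n e))%E @[e --> (0 : R)^'+] --> 1%E.
Proof.
move=> iT; pose c1 := C 1 * Upsilon 1; pose cj := C j * Upsilon j.
have c10 : 0 < c1 by exact: mulr_gt0.
have [j1 _ _] := j_spec.
(* 1 / E[n] is at most 2 e^2 / c1 and n_j at most (3/2) cj / e^2, whose product is 3 cj / c1; for
   the tail, e <= 1 gives 2 / c1. *)
pose b e := ((3 * cj / c1)%:E * accept_sum P (SD e) J.-1 + (2 / c1)%:E * T e)%E.
have b0 : b e @[e --> (0 : R)^'+] --> 0%E.
  rewrite -[X in _ --> X]adde0; apply: cvgeD => //.
    rewrite -[X in _ --> X](mule0 (3 * cj / c1)%:E); apply: cvgeM => //; first exact: cvg_cst.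
    exact: accept_sum_pred_cvg0.
  rewrite -[X in _ --> X](mule0 (2 / c1)%:E); apply: cvgeM => //; exact: cvg_cst.
apply: (@squeeze_cvge _ _ _ _ (fun=> 1%E) _ (fun e => 1 + b e)%E).
- near=> e.
  have [e0 nb] : 0 < e /\ forall l : int, 1 <= l ->
      C l * Upsilon l / (2 * e ^+ 2) <= (n e l)%:R <= 3 / 2 * (C l * Upsilon l) / e ^+ 2.
    by near: e; exact: (near_size_bounds C_gt0 Upsilon_gt0 n_lim).
  have e1 : e <= 1 by near: e; apply: nbhs_right_le.
  have te : tau e = 1 by near: e; exact: tau1.
  have fin : (En e < +oo)%E by near: e; exact: finite_En.
  have mD k : measurable (SD e k) by exact: SD_measurable.
  have Ni k : (SN e k < SN e k.+1)%N by exact: SN_inc.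
  have e20 : 0 < e ^+ 2 by rewrite exprn_gt0.
  have Enge : ((c1 / (2 * e ^+ 2))%:E <= En e)%E.
    apply: (@le_trans _ _ ((SN e 0)%:R%:E * (1 - accept_sum P (SD e) 0))%E).
      rewrite /accept_sum big_geq// sube0 mule1 lee_fin /SN /stageN te.
      by have /andP[] := nb 1 (lexx _).
    by apply: expected_size_ge => //; [exact: size_first|exact: size_never].
  have v0 : 0 < c1 / (2 * e ^+ 2) by rewrite divr_gt0// mulr_gt0.
  have Enfin : En e \is a fin_num.
    by rewrite ge0_fin_numE// (le_trans _ Enge)// lee_fin ltW.
  pose v := fine (En e); have vE : En e = v%:E by rewrite fineK.
  have vge : c1 / (2 * e ^+ 2) <= v by rewrite -lee_fin -vE.
  have vgt : 0 < v by exact: lt_le_trans vge.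
  have bd : (size_bound P (tau e) (D e) (n e) <=
      En e + (SN e J)%:R%:E * accept_sum P (SD e) J.-1 + T e)%E.
    rewrite size_boundE; apply: bound_le_expected_size => //.
      exact: size_first.
    exact: size_never.
  have bg := expected_size_le_size_bound e0.
  rewrite div1e vE inver gt_eqF//.
  have v1 : (v^-1%:E * v%:E = 1)%E by rewrite -EFinM mulVf// gt_eqF.
  apply/andP; split.
    by rewrite -[X in (X <= _)%E]v1 lee_wpmul2l ?lee_fin ?invr_ge0 ?(ltW vgt)// -vE.
  apply: (le_trans (lee_wpmul2l _ bd)); first by rewrite lee_fin invr_ge0 ltW.
  have ac0 := accept_sum_ge0 P (SD e) J.-1.
  have iv : v^-1 <= 2 * e ^+ 2 / c1.
    by rewrite -[leRHS]invf_div lef_pV2.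
  rewrite vE -addeA ge0_muleDr ?lee_fin ?(ltW vgt)//; last first.
    by rewrite adde_ge0 ?T_ge0// mule_ge0.
  rewrite v1 leeD2l// /b ge0_muleDr ?T_ge0 ?mule_ge0//; apply: leeD.
    rewrite muleA -EFinM lee_wpmul2r// lee_fin.
    have /andP[_ nj] := nb j j1; rewrite /SN /stageN te -jE.
    apply: (le_trans (ler_pM _ _ iv nj)) => //; first by rewrite invr_ge0 ltW.
    rewrite -/cj; have -> : 2 * e ^+ 2 / c1 * (3 / 2 * cj / e ^+ 2) = 3 * cj / c1 by field; rewrite !gt_eqF.
    by [].
  rewrite lee_wpmul2r ?T_ge0// lee_fin (le_trans iv)// ler_wpM2r ?invr_ge0 ?(ltW c10)//.
  by rewrite ler_piMr// exprn_ile1// ltW.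
- exact: cvg_cst.
- by rewrite -[X in _ --> X]adde0; apply: cvgeD => //; exact: cvg_cst.
Unshelve. all: by end_near. Qed.

End multistage_sampling.

Theorem theorem7 (R : realType)
  (* the family of distributions, indexed by the mean *)
  (Theta : set R) (dist : R -> probability R R)
  (Theta_itv : is_interval Theta)
  (dist_mean : forall t : R, Theta t -> ('E_(dist t)[idfun] = t%:E)%E)
  (dist_moment3 : forall t : R, Theta t ->
     ('E_(dist t)[fun x : R => (`|x| ^+ 3)%R] < +oo)%E)
  (V_gt0 : forall t : R, Theta t -> 0 < variance_of_mean Theta dist t)
  (V_cont : {within Theta, continuous (variance_of_mean Theta dist)})
  (* the functions defining the stopping rule and the interval estimator *)
  (kappa : R -> R)
  (kappa_gt0 : forall t : R, Theta t -> 0 < kappa t)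
  (kappa_cont : {within Theta, continuous kappa})
  (sL sU : R -> R -> R)
  (sL_cont : forall z e : R, 0 < e ->
     {for (z, e), continuous (fun p : R * R => sL p.1 p.2)})
  (sU_cont : forall z e : R, 0 < e ->
     {for (z, e), continuous (fun p : R * R => sU p.1 p.2)})
  (sLU_le : forall z e : R, 0 < e -> sL z e <= z <= sU z e)
  (sLU_lt : forall t e : R, Theta t -> 0 < e -> sL t e < t < sU t e)
  (sLU_lim : half_width_limit Theta kappa sL sU)
  (L U : R -> R -> R)
  (L_meas : forall e : R, 0 < e -> measurable_fun setT (fun z => L z e))
  (U_meas : forall e : R, 0 < e -> measurable_fun setT (fun z => U z e))
  (LU_lim : half_width_limit Theta kappa L U)
  (* the multistage setting *)
  (delta : R) (delta01 : 0 < delta < 1)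
  (delta_ : int -> R)
  (delta_01 : forall l : int, 0 < delta_ l < 1)
  (delta_noninc : forall l : int, delta_ (l + 1) <= delta_ l)
  (C Upsilon : int -> R)
  (Upsilon_def : forall l : int, Upsilon l = ln (1 / delta_ l))
  (C_gt0 : forall l : int, 0 < C l)
  (C_inc : forall l : int, C l < C (l + 1))
  (C_ratio_inf :
     (1 < ereal_inf (range (fun k : nat => (C (k%:Z + 1) / C k%:Z)%:E)))%E)
  (C_ratio_sup :
     (ereal_sup (range (fun k : nat => (C (k%:Z + 1) / C k%:Z)%:E)) < +oo)%E)
  (Upsilon_ratio_inf :
     (1 <= ereal_inf
             (range (fun k : nat => (Upsilon (k%:Z + 1) / Upsilon k%:Z)%:E)))%E)
  (Upsilon_ratio_sup :
     (ereal_sup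
        (range (fun k : nat => (Upsilon (k%:Z + 1) / Upsilon k%:Z)%:E)) < +oo)%E)
  (C_dvg : C k%:Z @[k --> \oo] --> +oo)
  (tau : R -> int)
  (tau_lim : ((tau e)%:~R : R) @[e --> (0 : R)^'+] --> (1 : R))
  (n : R -> int -> nat)
  (n_gt0 : forall (e : R) (l : int), 0 < e -> tau e <= l -> (0 < n e l)%N)
  (n_inc : forall (e : R) (l : int), 0 < e -> tau e <= l -> (n e l < n e (l + 1)%R)%N)
  (n_lim : forall eta : R, 0 < eta -> \forall e \near (0 : R)^'+,
     forall l : int, 1 <= l ->
       `| e ^+ 2 * (n e l)%:R / (C l * Upsilon l) - 1 | <= eta)
  (rho : R) (rho01 : 0 <= rho <= 1)
  (* the true mean and the samples *)
  (mu : R) (mu_Theta : Theta mu)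
  (d : measure_display) (Omega : measurableType d) (P : probability Omega R)
  (X : nat -> {RV P >-> R})
  (X_iid : iid_with_law X (dist mu)) :
  let V := variance_of_mean Theta dist in
  let nu := V mu in
  let Phi := @normal_cdf R in
  let Zq := normal_quantile (1 - delta / 2) in
  let NN (e : R) := nu * Zq ^+ 2 / (kappa mu * e) ^+ 2 in
  let Z (e : R) (l : int) (w : Omega) := sample_mean X (n e l) w in
  let D (e : R) (l : int) : set Omega :=
    [set w | tau e <= l /\ accepts V rho sL sU (n e l) (delta_ l) (Z e l w) e] in
  let I (e : R) (l : int) (w : Omega) : set R :=
    [set` `]L (Z e l w) e, U (Z e l w) e[] in
  let idx (e : R) (w : Omega) : \bar R := stop_index_ext R (tau e) (D e) w in
  let size_ (e : R) (w : Omega) : \bar R :=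
    stop_size R (tau e) (D e) (n e) w in
  let covered (e : R) : set Omega :=
    [set w | stop_interval (tau e) (D e) (I e) w mu] in
  let En (e : R) : \bar R := (\int[P]_w size_ e w)%E in
  let Pup (e : R) := P_upper P (tau e) (D e) (I e) mu in
  let Plow (e : R) := P_lower P (tau e) (D e) (I e) mu in
  let Q (e : R) := Q_bound P (tau e) (D e) (I e) mu in
  let bound_n (e : R) := size_bound P (tau e) (D e) (n e) in
  let xi (l : int) := kappa mu * Num.sqrt (C l * Upsilon l / nu) in
  let Lambda (l : int) := kappa mu ^+ 2 * C l / nu in
  let j : int := odflt 0 (int_min [set l : int | 1 <= l /\ 1 < Lambda l]) in
  let star := j = 1 \/ (1 < j /\ Lambda (j - 1) < 1) in
  let interior_mu := interior Theta mu in
  [/\ (* (I) *)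
      (\forall e \near (0 : R)^'+,
        P [set w | (size_ e w < +oo)%E] = 1%E /\ (En e < +oo)%E),
      (* (II) *)
      (interior_mu ->
        {ae P, forall w,
          [/\ ((j - 1)%:~R%:E <= limf_einf (idx^~ w) (0 : R)^'+)%E,
              (limf_einf (idx^~ w) (0 : R)^'+
                 <= limf_esup (idx^~ w) (0 : R)^'+)%E &
              (limf_esup (idx^~ w) (0 : R)^'+ <= j%:~R%:E)%E]} /\
        (star ->
          {ae P, forall w, idx e w @[e --> (0 : R)^'+] --> (j%:~R)%:E})),
      (* (III) *)
      (interior_mu ->
        ((2 * (Phi (xi (j - 1)) + Phi (xi j)) - 3)%:E
           <= limf_einf (fun e => P (covered e)) (0 : R)^'+)%E /\
        (star ->
          P (covered e) @[e --> (0 : R)^'+] --> (2 * Phi (xi j) - 1)%:E)),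
      (* (IV) *)
      (interior_mu ->
        [/\ (((xi (j - 1) / Zq) ^+ 2)%:E
               <= limf_einf (fun e => En e / (NN e)%:E) (0 : R)^'+)%E,
            (limf_einf (fun e => En e / (NN e)%:E) (0 : R)^'+
               <= limf_esup (fun e => En e / (NN e)%:E) (0 : R)^'+)%E,
            (limf_esup (fun e => En e / (NN e)%:E) (0 : R)^'+
               <= ((xi j / Zq) ^+ 2)%:E)%E &
            star -> (En e / (NN e)%:E)%E @[e --> (0 : R)^'+]
                      --> ((xi j / Zq) ^+ 2)%:E]) &
  [/\ (* (V) *)
      forall l : int,
        (forall e : R, 0 < e ->
          (P [set w | (l%:~R%:E < idx e w)%E] <= P (~` D e l))%E) /\
        (interior_mu ->
          (P (~` D e l) - P [set w | (l%:~R%:E < idx e w)%E])%E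
            @[e --> (0 : R)^'+] --> 0%E),
      (* (VI) *)
      (forall e : R, 0 < e -> P [set w | (size_ e w < +oo)%E] = 1%E ->
        [/\ (Plow e <= P (~` covered e))%E,
            (P (~` covered e) <= Pup e)%E & (Pup e <= Q e)%E]) /\
      (interior_mu ->
        [/\ `|P (~` covered e) - Pup e|%E @[e --> (0 : R)^'+] --> 0%E,
            `|P (~` covered e) - Plow e|%E @[e --> (0 : R)^'+] --> 0%E &
            star -> (Q e - P (~` covered e))%E @[e --> (0 : R)^'+] --> 0%E]) &
      (* (VII) *)
      (forall e : R, 0 < e -> (En e <= bound_n e)%E) /\
      (interior_mu ->
        (1 / En e * bound_n e)%E @[e --> (0 : R)^'+] --> 1%E)]].
Proof.
move=> V nu Phi Zq NN Z D I idx size_ covered En Pup Plow Q bound_n xi Lambda j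
  star interior_mu.
have stops := stops_almost_surely Theta_itv dist_mean dist_moment3 V_gt0 V_cont
  kappa_gt0 sL_cont sU_cont sLU_lim delta_01 delta_noninc Upsilon_def C_gt0 C_inc
  C_ratio_inf C_ratio_sup Upsilon_ratio_sup C_dvg tau_lim n_gt0 n_inc n_lim rho01
  mu_Theta X_iid.
have idx_lim := stop_index_limits dist_mean dist_moment3 V_gt0 V_cont kappa_gt0
  sLU_lim delta_01 Upsilon_def C_gt0 C_inc C_dvg tau_lim n_lim rho01 mu_Theta X_iid.
have cov_lim := coverage_limits Theta_itv dist_mean dist_moment3 V_gt0 V_cont
  kappa_gt0 sL_cont sU_cont sLU_lim L_meas U_meas LU_lim delta_01 delta_noninc
  Upsilon_def C_gt0 C_inc C_ratio_inf C_ratio_sup Upsilon_ratio_sup C_dvg tau_lim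
  n_gt0 n_inc n_lim rho01 mu_Theta X_iid.
have En_lim := expected_size_limits Theta_itv dist_mean dist_moment3 V_gt0 V_cont
  kappa_gt0 sL_cont sU_cont sLU_lim delta01 delta_01 delta_noninc Upsilon_def C_gt0
  C_inc C_ratio_inf C_ratio_sup Upsilon_ratio_sup C_dvg tau_lim n_gt0 n_inc n_lim
  rho01 mu_Theta X_iid.
split => //; split.
- move=> l; split.
    move=> e; exact: (prob_stop_later_le Theta_itv V_cont sL_cont sU_cont).
  exact: (prob_stop_later_limit Theta_itv dist_mean dist_moment3 V_gt0 V_cont
    kappa_gt0 sL_cont sU_cont sLU_lim delta_01 Upsilon_def C_gt0 C_inc C_dvg tau_lim
    n_gt0 n_lim rho01 mu_Theta X_iid).
- split.
    move=> e; exact: (uncovered_bounds Theta_itv V_cont sL_cont sU_cont L_meas U_meas).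
  exact: (uncovered_limits Theta_itv dist_mean dist_moment3 V_gt0 V_cont
    kappa_gt0 sL_cont sU_cont sLU_lim L_meas U_meas delta_01 delta_noninc
    Upsilon_def C_gt0 C_inc C_ratio_inf C_ratio_sup Upsilon_ratio_sup C_dvg tau_lim
    n_gt0 n_inc n_lim rho01 mu_Theta X_iid).
split.
  move=> e; exact: (expected_size_le_size_bound Theta_itv V_cont sL_cont sU_cont
    delta_ n_inc rho X).
exact: (size_bound_limit Theta_itv dist_mean dist_moment3 V_gt0 V_cont kappa_gt0
  sL_cont sU_cont sLU_lim delta_01 delta_noninc Upsilon_def C_gt0 C_inc C_ratio_inf
  C_ratio_sup Upsilon_ratio_sup C_dvg tau_lim n_gt0 n_inc n_lim rho01 mu_Theta X_iid).
Qed.
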